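(* Let $p\ge 1$ be an integer, let $0<m<M$, and let $f:\mathbb R^p\to\mathbb R$ be continuously differentiable and such that for all $\theta,\theta'\in\mathbb R^p$, $$f(\theta)-f(\theta')-\nabla f(\theta')^\top(\theta-\theta')\ge \tfrac m2\|\theta-\theta'\|_2^2,\qquad \|\nabla f(\theta)-\nabla f(\theta')\|_2\le M\|\theta-\theta'\|_2 .$$ Let $\pi$ be the probability distribution on $\mathbb R^p$ with Lebesgue density proportional to $e^{-f}$. Let $\nu_0$ be the distribution of $\vartheta_0$, with $W_2(\nu_0,\pi)<\infty$, and let $K_1$ be the smallest non-negative integer satisfying $$K_1\ge \frac{\ln\big(W_2(\nu_0,\pi)/\sqrt p\big)+\ln(m/M)+\frac12\ln(M+m)}{\ln\big(1+\frac{2m}{M-m}\big)}$$ (with $\ln 0=-\infty$). Consider the Langevin Monte Carlo algorithm $$\vartheta_{k+1}=\vartheta_k-h_{k+1}\nabla f(\vartheta_k)+\sqrt{2h_{k+1}}\,\xi_{k+1},\qquad h_{k+1}=\frac{2}{M+m+\frac23 m\,(k-K_1)_+},\qquad k=0,1,2,\ldots,$$ and let $\nu_k$ be the distribution of $\vartheta_k$. Then for every integer $k\ge K_1$, $$W_2(\nu_k,\pi)\le \frac{3.5\,M\sqrt p}{m\sqrt{M+m+\frac23 m\,(k-K_1)}}.$$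
   Context: $\|\cdot\|_2$ is the Euclidean norm and $x_+=\max(x,0)$. The $\xi_1,\xi_2,\ldots$ are mutually independent $\mathcal N_p(0,I_p)$ random vectors, independent of the (deterministic or random) initial point $\vartheta_0$. $W_2(\mu,\nu)=\big(\inf_{\varrho}\int\|\theta-\theta'\|_2^2\,d\varrho(\theta,\theta')\big)^{1/2}$, the infimum being over all joint distributions $\varrho$ on $\mathbb R^p\times\mathbb R^p$ with marginals $\mu$ and $\nu$. *)

(* Defs.v *)
From HB Require Import structures.
From mathcomp Require Import all_boot all_order all_algebra.
From mathcomp Require Import all_classical all_reals all_analysis.
From mathcomp Require Import measurable_realfun.

Set Implicit Arguments.
Unset Strict Implicit.
Unset Printing Implicit Defensive.

Import Order.TTheory GRing.Theory Num.Theory.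
Import numFieldNormedType.Exports.

Local Open Scope classical_set_scope.
Local Open Scope ring_scope.

(* The topology carried by ['rV[R]_n] is that of the sup norm, which is the
   usual topology of R^n; hence this is the usual Borel sigma-algebra. *)
Section borel_rV.
Context {R : realType} {n : nat}.

Definition borel_rV := g_sigma_algebraType (@open 'rV[R]_n).

HB.instance Definition _ :
    isMeasurable (sigma_display (@open 'rV[R]_n)) 'rV[R]_n :=
  @isMeasurable.Build _ 'rV[R]_n (@measurable _ borel_rV)
    (@measurable0 _ borel_rV) (@measurableC _ borel_rV)
    (@bigcupT_measurable _ borel_rV).

Lemma open_measurable_rV (A : set 'rV[R]_n) : open A -> measurable A.
Proof. exact: sub_sigma_algebra. Qed.

Lemma measurable_coord_rV (i : 'I_n) :
  measurable_fun setT (fun x : 'rV[R]_n => x 0 i).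
Proof.
apply: (measurability _ (RGenOpens.measurableE R)).
move=> _ [_ [a [b ->]] <-]; rewrite setTI; apply: open_measurable_rV.
apply: open_comp; last exact: interval_open.
by move=> x _; exact: coord_continuous.
Qed.

Lemma open_rat_ballsE (U : set 'rV[R]_n) : open U ->
  U = \bigcup_(qr in [set qr : 'rV[rat]_n * rat |
         ball (map_mx ratr qr.1 : 'rV[R]_n) (ratr qr.2 : R) `<=` U])
      ball (map_mx ratr qr.1 : 'rV[R]_n) (ratr qr.2 : R).
Proof.
move=> oU; apply/seteqP; split => [x Ux|x [qr /= qrU qrx]]; last exact: qrU.
move: oU; rewrite openE => /(_ _ Ux)/nbhs_ballP[e /= e0 xeU].
have [r /itvP r0e] := @rat_in_itvoo R 0 (e / 2) (divr_gt0 e0 (ltr0n _ 2)).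
have r0 : 0 < (ratr r : R) by rewrite r0e.
have xr (i : 'I_n) : exists q : rat, ball (x 0 i) (ratr r) (ratr q : R).
  have [q /itvP qP] := @rat_in_itvoo R (x 0 i) (x 0 i + ratr r)
    (ltac:(by rewrite ltrDl)).
  exists q; rewrite /ball/= distrC ltr_distl qP andbT.
  by rewrite (lt_trans _ (_ : x 0 i < _))// ?qP// ltrBlDr ltrDl.
have [q qP] := choice xr.
have bq : ball x (ratr r) (map_mx ratr (\row_i q i) : 'rV[R]_n).
  by split=> // i j; rewrite ord1 !mxE.
exists (\row_i q i, r) => /=; last exact: ball_sym.
move=> y qy; apply: xeU; apply: (@le_ball _ _ _ (ratr r + ratr r)).
  by rewrite (splitr e) lerD// ltW// r0e.
exact: ball_triangle bq qy.
Qed.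

Lemma measurable_fun_rVP d (T : measurableType d) (f : T -> 'rV[R]_n) :
  measurable_fun setT f <->
  (forall i, measurable_fun setT (fun t => f t 0 i)).
Proof.
split=> [mf i|mf].
  exact: (measurableT_comp (measurable_coord_rV i) mf).
apply: (measurability (@open 'rV[R]_n)) => // _ [U oU <-].
rewrite setTI (open_rat_ballsE oU) preimage_bigcup bigcup_mkcond.
apply: countable_bigcupT_measurable => // -[q r]; case: ifP => //= _.
have [r0|r0] := ltP 0 (ratr r : R); last first.
  rewrite (_ : _ @^-1` _ = set0)//; apply/seteqP; split=> // t [/=].
  by rewrite ltNge r0.
rewrite (_ : _ @^-1` _ =
    \big[setI/setT]_(i < n)
      ((fun t => f t 0 i) @^-1` ball (ratr (q 0 i) : R) (ratr r))); last first.
  apply/seteqP; split => t /=.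
    move=> [_ tq]; rewrite -bigcap_seq => i _ /=.
    by have := tq 0 i; rewrite mxE.
  rewrite -bigcap_seq => tq; split=> // i j; rewrite ord1 mxE.
  by apply: tq; rewrite /= mem_index_enum.
apply: bigsetI_measurable => i _; rewrite -[X in measurable X]setTI.
by apply: mf => //; apply: open_measurable; exact: ball_open.
Qed.

End borel_rV.

Section cons_rV.
Context {R : realType} {n : nat}.

Definition cons_rV (z : R * 'rV[R]_n) : 'rV[R]_n.+1 :=
  \row_i oapp (z.2 0) z.1 (unlift ord0 i).

Definition uncons_rV (x : 'rV[R]_n.+1) : R * 'rV[R]_n :=
  (x 0 ord0, \row_j x 0 (lift ord0 j)).

Lemma cons_rVK : cancel cons_rV uncons_rV.
Proof.
move=> [r x]; rewrite /uncons_rV mxE unlift_none; congr pair.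
by apply/rowP => j; rewrite !mxE liftK.
Qed.

Lemma uncons_rVK : cancel uncons_rV cons_rV.
Proof.
move=> x; apply/rowP => i; rewrite !mxE.
by case: unliftP => [j|] -> //=; rewrite mxE.
Qed.

Lemma measurable_cons_rV : measurable_fun setT cons_rV.
Proof.
apply/measurable_fun_rVP => i; under eq_fun do rewrite mxE.
case: unliftP => [j _|_] /=; last exact: measurable_fst.
exact: (measurableT_comp (measurable_coord_rV j) measurable_snd).
Qed.

Lemma measurable_uncons_rV : measurable_fun setT uncons_rV.
Proof.
apply/measurable_fun_pair; first exact: measurable_coord_rV.
apply/measurable_fun_rVP => i; under eq_fun do rewrite mxE.
exact: measurable_coord_rV.
Qed.

End cons_rV.

Section lebesgue_cons.
Context {R : realType} {n : nat}.
Variable mu : {sigma_finite_measure set 'rV[R]_n -> \bar R}.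
Local Open Scope ereal_scope.

Definition lebesgue_cons : set 'rV[R]_n.+1 -> \bar R :=
  pushforward (@lebesgue_measure R \x mu) cons_rV.

Let lebesgue_cons0 : lebesgue_cons set0 = 0.
Proof. by rewrite /lebesgue_cons /pushforward preimage_set0 measure0. Qed.

Let lebesgue_cons_ge0 A : 0 <= lebesgue_cons A.
Proof. by rewrite /lebesgue_cons /pushforward measure_ge0. Qed.

Let lebesgue_cons_sigma_additive : semi_sigma_additive lebesgue_cons.
Proof.
have mcons (A : set 'rV[R]_n.+1) : measurable A -> measurable (cons_rV @^-1` A).
  by move=> mA; rewrite -[X in measurable X]setTI; exact: measurable_cons_rV.
move=> F mF tF mUF; rewrite /lebesgue_cons /pushforward preimage_bigcup.
apply: measure_semi_sigma_additive => [k||]; first exact: mcons.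
- apply/trivIsetP => /= i j _ _ ij; rewrite -preimage_setI.
  by move/trivIsetP : tF => /(_ _ _ _ _ ij) ->//; rewrite preimage_set0.
- by rewrite -preimage_bigcup; exact: mcons.
Qed.

HB.instance Definition _ := isMeasure.Build _ _ _ lebesgue_cons
  lebesgue_cons0 lebesgue_cons_ge0 lebesgue_cons_sigma_additive.

Let lebesgue_cons_sigma_finite : sigma_finite setT lebesgue_cons.
Proof.
have /sigma_finiteP[F [TF ndF Foo]] := sigma_finiteT (@lebesgue_measure R).
have /sigma_finiteP[G [TG ndG Goo]] := sigma_finiteT mu.
exists (fun k => uncons_rV @^-1` (F k `*` G k)).
  rewrite -preimage_bigcup; apply/esym/seteqP; split=> // x _.
  have [[i _ Fi] [j _ Gj]] : (\bigcup_i F i) (uncons_rV x).1 /\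
    (\bigcup_i G i) (uncons_rV x).2 by rewrite -TF -TG.
  exists (maxn i j) => //; split.
    by move: Fi; exact/subsetPset/ndF/leq_maxl.
  by move: Gj; exact/subsetPset/ndG/leq_maxr.
move=> k; have [mF Fk] := Foo k; have [mG Gk] := Goo k; split.
  rewrite -[X in measurable X]setTI; apply: measurable_uncons_rV => //.
  exact: measurableX.
rewrite /lebesgue_cons /pushforward -comp_preimage.
rewrite (_ : _ \o _ = id); last by apply/funext => z; exact: cons_rVK.
by rewrite preimage_id product_measure1E// lte_mul_pinfty// ge0_fin_numE.
Qed.

HB.instance Definition _ := Measure_isSigmaFinite.Build _ _ _ lebesgue_cons
  lebesgue_cons_sigma_finite.

End lebesgue_cons.

Fixpoint lebesgue_rV {R : realType} (n : nat) :
    {sigma_finite_measure set 'rV[R]_n -> \bar R} :=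
  if n is k.+1 then lebesgue_cons (lebesgue_rV k) else \d_(0 : 'rV[R]_0).

Lemma lebesgue_rV_box {R : realType} (n : nat) (A : 'I_n -> set R) :
  (forall i, measurable (A i)) ->
  lebesgue_rV n [set x : 'rV[R]_n | forall i, A i (x 0 i)] =
  (\prod_(i < n) lebesgue_measure (A i))%E.
Proof.
elim: n A => [|n IHn] A mA.
  by rewrite big_ord0 /= diracE mem_set//= => -[].
rewrite big_ord_recl -IHn//= /lebesgue_cons /pushforward -product_measure1E//.
  congr (_ _); apply/seteqP; split => [[r x]|[r x]] /=.
    move=> Arx; split; first by have := Arx ord0; rewrite mxE unlift_none.
    by move=> i; have := Arx (lift ord0 i); rewrite mxE liftK.
  by move=> [Ar Ax] i; rewrite mxE; case: unliftP => [j|] -> /=.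
  exact: mA.
rewrite (_ : [set _ | _] = \big[setI/setT]_(i < n)
    ((fun x : 'rV[R]_n => x 0 i) @^-1` A (lift ord0 i))); last first.
  rewrite -bigcap_seq; apply/seteqP; split => x /= Ax i.
    by move=> _; exact: Ax.
  by apply: Ax; rewrite /= mem_index_enum.
apply: bigsetI_measurable => i _.
by rewrite -[X in measurable X]setTI; apply: measurable_coord_rV.
Qed.

Section euclidean.
Context {R : realType} {n : nat}.
Implicit Types (x y : 'rV[R]_n) (f : 'rV[R]_n -> R).

(* [`|x|] is the sup norm in the library. *)
Definition norm2 x : R := Num.sqrt (\sum_i x 0 i ^+ 2).

Definition dot x y : R := \sum_i x 0 i * y 0 i.

Definition grad f x : 'rV[R]_n := \row_i 'D_(delta_mx 0 i) f x.

Definition continuously_differentiable f :=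
  (forall x, differentiable f x) /\ continuous (grad f).

End euclidean.

Section laws.
Context {R : realType} (n : nat).
Local Open Scope ereal_scope.

Definition std_normal_pdf (x : 'rV[R]_n) : R :=
  ((Num.sqrt (2 * pi)) ^- n * expR (- (norm2 x ^+ 2 / 2)))%R.

Definition std_normal (A : set 'rV[R]_n) : \bar R :=
  \int[lebesgue_rV n]_(x in A) (std_normal_pdf x)%:E.

Definition has_density_proportional_to (mu : probability 'rV[R]_n R)
    (g : 'rV[R]_n -> R) :=
  exists c : R, forall A, measurable A ->
    mu A = \int[lebesgue_rV n]_(x in A) (c * g x)%:E.

End laws.

Section wasserstein.
Context {R : realType} {n : nat}.
Local Open Scope ereal_scope.

Definition coupling (mu nu : probability 'rV[R]_n R)
    (rho : probability ('rV[R]_n * 'rV[R]_n)%type R) :=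
  forall A, measurable A ->
    rho (A `*` setT) = mu A /\ rho (setT `*` A) = nu A.

Definition W2 (mu nu : probability 'rV[R]_n R) : \bar R :=
  sqrte (ereal_inf
    [set \int[rho]_z (norm2 (z.1 - z.2) ^+ 2)%:E | rho in coupling mu nu]).

End wasserstein.

Section independence.
Context {R : realType} d d' (T : measurableType d) (T' : measurableType d').
Variable P : probability T R.
Local Open Scope ereal_scope.

Definition mutually_independent (X : nat -> {RV P >-> T'}) :=
  forall (J : seq nat) (A : nat -> set T'), uniq J ->
    (forall j, measurable (A j)) ->
    P (\bigcap_(j in [set` J]) (X j @^-1` A j)) =
    \prod_(j <- J) P (X j @^-1` A j).

Definition sigma_sequence (X : nat -> {RV P >-> T'}) : set (set T) :=
  <<s \bigcup_j preimage_set_system setT (X j) measurable >>.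

Definition independent_of_sequence (Y : {RV P >-> T'})
    (X : nat -> {RV P >-> T'}) :=
  forall A B, measurable A -> sigma_sequence X B ->
    P (Y @^-1` A `&` B) = P (Y @^-1` A) * P B.

End independence.

Section step_sizes.
Context {R : realType}.
Implicit Types m M : R.

(* [lne 0 = -oo], so a vanishing distance [w] gives the threshold [-oo]. *)
Definition K1_threshold (p : nat) m M (w : \bar R) : \bar R :=
  ((lne (w / (Num.sqrt p%:R)%:E) + (ln (m / M))%:E
      + (2^-1 * ln (M + m))%:E)
    / (ln (1 + 2 * m / (M - m)))%:E)%E.

Definition is_smallest_nat_above (w : \bar R) (K : nat) :=
  (w <= K%:R%:E)%E /\ forall j : nat, (w <= j%:R%:E)%E -> (K <= j)%N.

(* [step m M K k] is the step size used to go from iterate k to k + 1. *)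
Definition step m M (K k : nat) : R :=
  2 / (M + m + 2 / 3 * m * Num.max (k%:R - K%:R) 0).

End step_sizes.

(* Main.v *)
(** One step of the algorithm, of size h, is compared with a chain that leaves
    pi exactly invariant.  Take (theta, x0) in a near-optimal coupling of nu_k
    and pi, and run from x0 the random-walk Metropolis chain with N Gaussian
    proposals of variance 2 delta = 2 h / N, whose sum is the Gaussian noise
    added to theta.  By detailed balance the chain ends with law pi.  Its
    displacement is the same Gaussian sum minus the rejected proposals, and a
    rejection has conditional mean delta grad f and variance of order
    delta^(3/2); so after N steps the noises cancel in the difference, and as N
    tends to infinity there remain

      - the deterministic step x - h grad f x, contracting by 1 - m h because
        f - (m/2) |x|^2 has a cocoercive gradient, and
      - the integral over time of the variation of grad f along the stationary
        chain, at most M sqrt p (sqrt M h^2 / 2 + (2/3) h sqrt (2 h)) in L^2.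

    The moments of grad f under pi come from translating the density: the
    descent lemma gives E_pi exp (- grad f . v) <= exp (M |v|^2 / 2).  The
    resulting recursion w_(k+1) <= (1 - m h) w_k + O(h^(3/2)) is then solved by
    induction, first for the constant step size 2 / (M + m) up to K1, and then
    for the decreasing one. *)

Require Import Defs.
From HB Require Import structures.
From mathcomp Require Import all_boot all_order all_algebra.
From mathcomp Require Import all_classical all_reals all_analysis.
From mathcomp Require Import measurable_realfun ring lra.

Set Implicit Arguments.
Unset Strict Implicit.
Unset Printing Implicit Defensive.

Import Order.TTheory GRing.Theory Num.Theory.
Import numFieldNormedType.Exports.

Local Open Scope classical_set_scope.
Local Open Scope ring_scope.

(** * Strongly convex functions with Lipschitz gradient *)

(** The natural comparison process is the Langevin diffusion, whose study rests on stochastic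
    integration. A Metropolis chain replaces this by finitely many kernels and changes of variables:
    it preserves the target exactly for every [N], so no limiting process is constructed and only a
    numerical bound passes to the limit. The difficulty is that a rejection depends on position and
    proposal together; averaged over the sign of the proposal [u], the positive part of [g x . u]
    acts as half of the linear term, which is why the drift per move is [(r ^+ 2 / 2) *: g x]. All
    integrands are kept nonnegative, so that Tonelli applies throughout, and L^2 norms occur only as
    inequalities between an integral of squares and the square of a real. The value 7/2 comes from
    the recursion: with [C = M sqrt p / m] and [h = 2 / A], a local error [14/3 M sqrt p / A^(3/2)]
    sustains the level [7/3 C / sqrt A] at a frozen step, and 7/2 is the least factor for which the
    induction closes in this way while [A] grows by [2/3 m] per step. *)

Section euclidean_geometry.
Context {R : realType} {n : nat}.
Implicit Types (x y z : 'rV[R]_n) (a : R).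

Lemma dotC x y : dot x y = dot y x.
Proof. by apply: eq_bigr => i _; rewrite mulrC. Qed.

Lemma dotDl x y z : dot (x + y) z = dot x z + dot y z.
Proof. by rewrite -big_split; apply: eq_bigr => i _; rewrite mxE mulrDl. Qed.

Lemma dotZl a x y : dot (a *: x) y = a * dot x y.
Proof. by rewrite mulr_sumr; apply: eq_bigr => i _; rewrite mxE mulrA. Qed.

Lemma dotNl x y : dot (- x) y = - dot x y.
Proof. by rewrite -scaleN1r dotZl mulN1r. Qed.

Lemma dotDr x y z : dot x (y + z) = dot x y + dot x z.
Proof. by rewrite dotC dotDl !(dotC x). Qed.

Lemma dotZr a x y : dot x (a *: y) = a * dot x y.
Proof. by rewrite dotC dotZl dotC. Qed.

Lemma dotNr x y : dot x (- y) = - dot x y.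
Proof. by rewrite dotC dotNl dotC. Qed.

Lemma dotBl x y z : dot (x - y) z = dot x z - dot y z.
Proof. by rewrite dotDl dotNl. Qed.

Lemma dotBr x y z : dot x (y - z) = dot x y - dot x z.
Proof. by rewrite dotDr dotNr. Qed.

Definition dotE := (dotDl, dotDr, dotNl, dotNr, dotZl, dotZr).

Lemma norm2_sqr x : norm2 x ^+ 2 = dot x x.
Proof.
rewrite /norm2 sqr_sqrtr; first by apply: eq_bigr => i _; rewrite expr2.
by apply: sumr_ge0 => i _; rewrite sqr_ge0.
Qed.

Lemma norm2_ge0 x : 0 <= norm2 x.
Proof. exact: sqrtr_ge0. Qed.

Lemma norm2_sqrD x y : norm2 (x + y) ^+ 2 = norm2 x ^+ 2 + 2 * dot x y + norm2 y ^+ 2.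
Proof. by rewrite !norm2_sqr !dotE (dotC y x); ring. Qed.

Lemma norm2_sqrB x y : norm2 (x - y) ^+ 2 = norm2 x ^+ 2 - 2 * dot x y + norm2 y ^+ 2.
Proof. by rewrite norm2_sqrD dotNr !norm2_sqr dotNl dotNr opprK mulrN. Qed.

Lemma norm2N x : norm2 (- x) = norm2 x.
Proof. by rewrite /norm2; congr Num.sqrt; apply: eq_bigr => i _; rewrite mxE sqrrN. Qed.

Lemma norm2Z a x : norm2 (a *: x) = `|a| * norm2 x.
Proof.
apply/eqP; rewrite -(@eqrXn2 _ 2)//; last 2 first.
- exact: norm2_ge0.
- by rewrite mulr_ge0// norm2_ge0.
by rewrite exprMn !norm2_sqr dotZl dotZr mulrA -expr2 real_normK// num_real.
Qed.

Lemma norm2_0 : norm2 (0 : 'rV[R]_n) = 0.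
Proof. by rewrite -(scale0r 0) norm2Z normr0 mul0r. Qed.

Lemma norm2_eq0 x : norm2 x = 0 -> x = 0.
Proof.
move/(congr1 (fun t => t ^+ 2)); rewrite norm2_sqr expr0n/= => /eqP.
rewrite psumr_eq0 => [/allP x0|i _]; last by rewrite -expr2 sqr_ge0.
apply/rowP => i; rewrite mxE; apply/eqP.
by have := x0 i (mem_index_enum i); rewrite /= -expr2 sqrf_eq0.
Qed.

(** Cauchy-Schwarz, by expanding the square of [norm2 y *: x - norm2 x *: y]; vanishing norms are
    treated apart because their product is cancelled. *)
Lemma dot_le_norm2 x y : dot x y <= norm2 x * norm2 y.
Proof.
have [/norm2_eq0 ->|x0] := eqVneq (norm2 x) 0.
  by rewrite norm2_0 mul0r -(scale0r 0) dotZl mul0r.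
have [/norm2_eq0 ->|y0] := eqVneq (norm2 y) 0.
  by rewrite norm2_0 mulr0 -(scale0r 0) dotZr mul0r.
have xp : 0 < norm2 x by rewrite lt_def x0 norm2_ge0.
have yp : 0 < norm2 y by rewrite lt_def y0 norm2_ge0.
have : 0 <= norm2 (norm2 y *: x - norm2 x *: y) ^+ 2 by exact: sqr_ge0.
rewrite norm2_sqrB !norm2Z !ger0_norm ?norm2_ge0// dotZl dotZr => h.
by rewrite -(ler_pM2l (mulr_gt0 xp yp)); nra.
Qed.

Lemma normr_dot_le x y : `|dot x y| <= norm2 x * norm2 y.
Proof.
by rewrite ler_norml dot_le_norm2 andbT lerNl -dotNl -(norm2N x) dot_le_norm2.
Qed.

Lemma ler_norm2D x y : norm2 (x + y) <= norm2 x + norm2 y.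
Proof.
rewrite -ler_sqr ?nnegrE ?addr_ge0 ?norm2_ge0//.
by rewrite norm2_sqrD; have := dot_le_norm2 x y; lra.
Qed.

Lemma norm2_rowE x : norm2 x ^+ 2 = \sum_i x 0 i ^+ 2.
Proof. by rewrite norm2_sqr; apply: eq_bigr => i _; rewrite expr2. Qed.

End euclidean_geometry.

(** * Descent lemma, cocoercivity and contraction of the gradient step *)

Section strongly_convex_smooth.
Context {R : realType} {n : nat}.
Variables (m M : R) (f : 'rV[R]_n -> R) (g : 'rV[R]_n -> 'rV[R]_n).
Hypotheses (m0 : 0 < m) (mM : m < M).
Hypothesis fconv : forall x y,
  m / 2 * norm2 (x - y) ^+ 2 <= f x - f y - dot (g y) (x - y).
Hypothesis glip : forall x y, norm2 (g x - g y) <= M * norm2 (x - y).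
Implicit Types x y v : 'rV[R]_n.

Lemma tangent_below x v : dot (g x) v <= f (x + v) - f x.
Proof.
have := fconv (x + v) x; rewrite addrAC subrr add0r.
have := mulr_ge0 (ltW m0) (sqr_ge0 (norm2 v)); lra.
Qed.

(* Convexity at the endpoint of each of [N] subsegments, plus the Lipschitz
   bound on the gradient there, gives the constant M/2 up to a factor 1+1/N. *)
Lemma descent_subdivided (N : nat) x v : (0 < N)%N ->
  f (x + v) - f x <= dot (g x) v + M * (N%:R + 1) / (2 * N%:R) * norm2 v ^+ 2.
Proof.
move=> N0.
have N0' : 0 < N%:R :> R by rewrite ltr0n.
have H (i : nat) : f (x + (i%:R / N%:R) *: v) - f x <=
    i%:R / N%:R * dot (g x) v + M * (i%:R * (i%:R + 1)) / (2 * N%:R ^+ 2) * norm2 v ^+ 2.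
  elim: i => [|i IH]; first by rewrite !mul0r scale0r addr0 subrr mulr0 !mul0r addr0.
  set y := x + (i.+1%:R / N%:R) *: v.
  have yE : x + (i%:R / N%:R) *: v = y + (- N%:R^-1) *: v.
    by rewrite /y -addrA -scalerDl; congr (_ + _ *: _); rewrite -natr1; field; rewrite gt_eqF.
  have := tangent_below y ((- N%:R^-1) *: v); rewrite -yE dotZr => h.
  have h2 : dot (g y - g x) v <= M * (i.+1%:R / N%:R) * norm2 v ^+ 2.
    apply: (le_trans (dot_le_norm2 _ _)).
    rewrite expr2 mulrA ler_wpM2r ?norm2_ge0//.
    apply: (le_trans (glip _ _)); rewrite /y addrAC subrr add0r norm2Z.
    by rewrite ger0_norm ?mulrA// divr_ge0.
  move: h2; rewrite dotDl dotNl => h2.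
  have h3 : N%:R^-1 * dot (g y) v <= N%:R^-1 * (dot (g x) v + M * (i.+1%:R / N%:R) * norm2 v ^+ 2).
    by rewrite ler_wpM2l ?invr_ge0//; lra.
  have -> : i.+1%:R / N%:R * dot (g x) v + M * (i.+1%:R * (i.+1%:R + 1)) / (2 * N%:R ^+ 2) * norm2 v ^+ 2
    = i%:R / N%:R * dot (g x) v + M * (i%:R * (i%:R + 1)) / (2 * N%:R ^+ 2) * norm2 v ^+ 2
      + N%:R^-1 * (dot (g x) v + M * (i.+1%:R / N%:R) * norm2 v ^+ 2).
    by rewrite -natr1; field; rewrite gt_eqF.
  by move: h h3 IH; lra.
have := H N; rewrite divff ?gt_eqF// scale1r mul1r.
suff -> : M * (N%:R * (N%:R + 1)) / (2 * N%:R ^+ 2) = M * (N%:R + 1) / (2 * N%:R) by [].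
by field; rewrite gt_eqF.
Qed.

(** The surplus factor [(N + 1) / N] disappears as the number of pieces grows; this takes the place
    of integrating the gradient along the segment. *)
Lemma descent x v : f (x + v) - f x <= dot (g x) v + M / 2 * norm2 v ^+ 2.
Proof.
apply/ler_addgt0Pr => e e0.
pose K := M * norm2 v ^+ 2 / 2.
have K0 : 0 <= K by have := mulr_ge0 (ltW (lt_trans m0 mM)) (sqr_ge0 (norm2 v)); rewrite /K; lra.
have [N0 NK] : exists N : nat, K / e < N.+1%:R.
  exists (Num.truncn (K / e)).
  by have := @truncn_itv R (K / e) (divr_ge0 K0 (ltW e0)) => /andP[].
apply: (le_trans (@descent_subdivided N0.+1 x v isT)).
have -> : M * (N0.+1%:R + 1) / (2 * N0.+1%:R) * norm2 v ^+ 2 = M / 2 * norm2 v ^+ 2 + K / N0.+1%:R.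
  have N1 : N0.+1%:R != 0 :> R by rewrite pnatr_eq0.
  by move: (N0.+1%:R : R) N1 => q q0; rewrite /K; field.
rewrite addrA lerD2l ler_pdivrMr ?ltr0n//.
by move: NK; rewrite ltr_pdivrMr// => /ltW; rewrite mulrC.
Qed.

Let L := M - m.
Let phi x := f x - m / 2 * norm2 x ^+ 2.
Let gphi x := g x - m *: x.

Let L0 : 0 < L. Proof. by rewrite subr_gt0. Qed.

Let phi_convex x v : dot (gphi x) v <= phi (x + v) - phi x.
Proof.
rewrite /phi /gphi norm2_sqrD dotBl dotZl.
have := fconv (x + v) x; rewrite addrAC subrr add0r; lra.
Qed.

(** The subtracted quadratic is its own second-order expansion, so the upper model passes to [phi]
    with constant [M - m], whereas the triangle inequality would only give [gphi] the Lipschitz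
    constant [M + m]. *)
Let phi_smooth x v : phi (x + v) - phi x <= dot (gphi x) v + L / 2 * norm2 v ^+ 2.
Proof.
rewrite /phi /gphi norm2_sqrD dotBl dotZl.
have := descent x v; rewrite /L; lra.
Qed.

(* Compare the tangent at x with the quadratic upper model at y, at the
   minimiser of their difference. *)
Let phi_cocoercive1 x y : norm2 (gphi y - gphi x) ^+ 2 / (2 * L) <=
  phi y - phi x - dot (gphi x) (y - x).
Proof.
set e := gphi y - gphi x.
have h1 := phi_convex x (y - x - L^-1 *: e).
have h2 := phi_smooth y (- (L^-1 *: e)).
move: h1 h2.
rewrite addrA [x + (y - x)]addrC subrK => h1 h2.
rewrite norm2N norm2Z exprMn real_normK ?num_real// dotNr dotZr in h2.
rewrite dotBr dotZr in h1.
have h3 : dot e e = dot (gphi y) e - dot (gphi x) e by rewrite -dotBl.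
rewrite norm2_sqr in h2 *.
have -> : dot e e / (2 * L) = L^-1 * (dot (gphi y) e - dot (gphi x) e) - L / 2 * (L^-1 ^+ 2 * dot e e).
  by rewrite -h3; field; rewrite gt_eqF.
by move: h1 h2; lra.
Qed.

(** Adding the one-sided inequality to itself with [x] and [y] exchanged cancels the values of
    [phi]. *)
Let phi_cocoercive x y :
  norm2 (gphi y - gphi x) ^+ 2 / L <= dot (gphi y - gphi x) (y - x).
Proof.
have h1 := phi_cocoercive1 x y; have h2 := phi_cocoercive1 y x.
have gE : gphi x - gphi y = - (gphi y - gphi x) by rewrite (opprB (gphi y)).
rewrite gE norm2N -(opprB y x) dotNr in h2.
rewrite (dotBl (gphi y)).
set S := norm2 _ ^+ 2 in h1 h2 *.
have -> : S / L = S / (2 * L) + S / (2 * L) by field; rewrite gt_eqF.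
by move: h1 h2; lra.
Qed.

Lemma cocoercive x y : m * M * norm2 (y - x) ^+ 2 + norm2 (g y - g x) ^+ 2 <=
  (m + M) * dot (g y - g x) (y - x).
Proof.
have := phi_cocoercive x y; rewrite ler_pdivrMr//.
have -> : gphi y - gphi x = (g y - g x) - m *: (y - x).
  by rewrite /gphi scalerBr !opprD !opprK !addrA; congr (_ + _); rewrite addrAC.
set G := g y - g x; set D := y - x.
rewrite (norm2_sqrB G) norm2Z exprMn real_normK ?num_real// dotZr (dotBl G) dotZl -norm2_sqr /L.
lra.
Qed.

Lemma strongly_monotone x y : m * norm2 (y - x) ^+ 2 <= dot (g y - g x) (y - x).
Proof.
have h1 := fconv y x; have h2 := fconv x y.
rewrite -(opprB y x) norm2N dotNr in h2.
rewrite dotBl; move: h1 h2; lra.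
Qed.

(** After expanding the square, cocoercivity with weight [2 h / (m + M)] removes the inner product.
    The remaining coefficient of the squared gradient difference is nonpositive exactly when
    [h (m + M) <= 2]; the lower bound [G >= m D] then completes the square [(1 - m h)^2]. *)
Lemma gradient_step_contracts (h : R) x y : 0 < h -> h * (m + M) <= 2 ->
  norm2 ((y - h *: g y) - (x - h *: g x)) <= (1 - m * h) * norm2 (y - x).
Proof.
move=> h0 hle.
have mh1 : 0 <= 1 - m * h by have := mulr_gt0 h0 L0; rewrite /L; move: hle; nra.
rewrite -ler_sqr ?nnegrE ?norm2_ge0 ?mulr_ge0 ?norm2_ge0//.
have -> : (y - h *: g y) - (x - h *: g x) = (y - x) - h *: (g y - g x).
  by rewrite scalerBr !opprD !opprK !addrA; congr (_ + _); rewrite addrAC.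
rewrite norm2_sqrB norm2Z exprMn real_normK ?num_real// dotZr dotC.
have h1 := cocoercive x y; have h2 := strongly_monotone x y.
have h3 := dot_le_norm2 (g y - g x) (y - x).
set D := norm2 (y - x) in h1 h2 h3 *; set G := norm2 (g y - g x) in h1 h3 *.
set d := dot _ _ in h1 h2 h3 *.
have D0 : 0 <= D by exact: norm2_ge0.
have G0 : 0 <= G by exact: norm2_ge0.
(* Strong monotonicity and Cauchy-Schwarz give [m D^2 <= G D]. *)
have GD : m ^+ 2 * D ^+ 2 <= G ^+ 2.
  have [D00|Dn0] := eqVneq D 0; first by rewrite D00 expr0n/= mulr0 sqr_ge0.
  have Dp : 0 < D by rewrite lt_def Dn0.
  have : m * D <= G by rewrite -(ler_pM2r Dp); move: h2 h3; nra.
  by move=> mDG; rewrite -exprMn lerXn2r ?nnegrE// mulr_ge0// ltW.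
have s0 : 0 < m + M by move: m0 mM; lra.
have k1 : 2 * h / (m + M) * (m * M * D ^+ 2 + G ^+ 2) <= 2 * h / (m + M) * ((m + M) * d).
  by rewrite ler_wpM2l// divr_ge0 ?mulr_ge0// ltW.
have k2 : (2 * h / (m + M) - h ^+ 2) * (m ^+ 2 * D ^+ 2) <= (2 * h / (m + M) - h ^+ 2) * G ^+ 2.
  rewrite ler_wpM2l// subr_ge0 ler_pdivlMr// expr2 -mulrA mulrC ler_pM2r//.
have e1 : 2 * h / (m + M) * ((m + M) * d) = 2 * (h * d) by field; rewrite gt_eqF.
have -> : ((1 - m * h) * D) ^+ 2 = D ^+ 2 - 2 * h / (m + M) * (m * M * D ^+ 2)
   - (2 * h / (m + M) - h ^+ 2) * (m ^+ 2 * D ^+ 2).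
  by field; rewrite gt_eqF.
rewrite e1 in k1.
move: k1 k2; rewrite mulrDr; lra.
Qed.

End strongly_convex_smooth.

(** * Measurability and affine substitutions *)

Section measurability_rV.
Context {R : realType} {n : nat} d (T : measurableType d).
Implicit Types (f g : T -> 'rV[R]_n) (a : T -> R).

Lemma measurable_rVD f g : measurable_fun setT f -> measurable_fun setT g ->
  measurable_fun setT (fun t => f t + g t).
Proof.
move=> /measurable_fun_rVP mf /measurable_fun_rVP mg; apply/measurable_fun_rVP => i.
by under eq_fun do rewrite mxE; exact: measurable_funD.
Qed.

Lemma measurable_rVZ a f : measurable_fun setT a -> measurable_fun setT f ->
  measurable_fun setT (fun t => a t *: f t).
Proof.
move=> ma /measurable_fun_rVP mf; apply/measurable_fun_rVP => i.
by under eq_fun do rewrite mxE; exact: measurable_funM.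
Qed.

Lemma measurable_rVZc (c : R) f : measurable_fun setT f ->
  measurable_fun setT (fun t => c *: f t).
Proof. by move=> mf; apply: measurable_rVZ. Qed.

Lemma measurable_rVN f : measurable_fun setT f ->
  measurable_fun setT (fun t => - f t).
Proof.
by move=> mf; under eq_fun do rewrite -scaleN1r; exact: measurable_rVZc.
Qed.

Lemma measurable_rVB f g : measurable_fun setT f -> measurable_fun setT g ->
  measurable_fun setT (fun t => f t - g t).
Proof. by move=> mf mg; apply: measurable_rVD => //; exact: measurable_rVN. Qed.

Lemma measurable_dot f g : measurable_fun setT f -> measurable_fun setT g ->
  measurable_fun setT (fun t => dot (f t) (g t)).
Proof.
move=> /measurable_fun_rVP mf /measurable_fun_rVP mg.
by apply: (measurable_sum (index_enum 'I_n) (h := fun i t => f t 0 i * g t 0 i)) => i; exact: measurable_funM.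
Qed.

Lemma measurable_norm2 f : measurable_fun setT f ->
  measurable_fun setT (fun t => norm2 (f t)).
Proof.
move=> /measurable_fun_rVP mf; apply: (measurableT_comp (f := @Num.sqrt R)).
  by apply: continuous_measurable_fun => x; exact: sqrt_continuous.
by apply: (measurable_sum (index_enum 'I_n) (h := fun i t => f t 0 i ^+ 2)) => i; exact: measurable_funX.
Qed.

End measurability_rV.

Lemma continuous_measurable_rV {R : realType} {n : nat} (f : 'rV[R]_n -> R) :
  continuous f -> measurable_fun setT f.
Proof.
move=> cf; apply: (measurability _ (RGenOpens.measurableE R)).
move=> _ [_ [a [b ->]] <-]; rewrite setTI; apply: open_measurable_rV.
by apply: open_comp; [move=> x _; exact: cf|exact: interval_open].
Qed.

(** * Lebesgue measure under scalings and translations *)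

Section lebesgue_affine.
Context {R : realType}.
Local Open Scope ereal_scope.
Notation leb := (@lebesgue_measure R).

Section one_dim.
Variables (a b : R).
Let h (r : measurableTypeR R) : measurableTypeR R := (a * r + b)%R.

Let mh : measurable_fun setT h.
Proof.
apply: measurable_funD; last exact: measurable_cst.
by apply: measurable_funM; [exact: measurable_cst|exact: measurable_id].
Qed.

Let push_affine : {measure set (measurableTypeR R) -> \bar R} :=
  mscale (NngNum (normr_ge0 a))
    (measure_function_pushforward__canonical__measure_function_Measure leb mh).

(** Uniqueness of Lebesgue measure: the rescaled image measure has the right value on the intervals
    []c, e]]. A negative [a] reverses the ends, whence the two computations. *)
Lemma lebesgue_measure_affine (A : set R) : (a != 0)%R -> measurable A ->
  `|a|%:E * leb (h @^-1` A) = leb A.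
Proof.
move=> a0 mA; apply/esym.
rewrite (@lebesgue_measure_unique R push_affine _ A mA); first by [].
move=> _ [[c e] _ <-]; rewrite /= /mscale /= /pushforward.
have [a_lt0|a_gt0|a00] := ltgtP a 0%R; last by rewrite a00 eqxx in a0.
- rewrite (_ : h @^-1` _ = `[((e - b) / a)%R, ((c - b) / a)%R[%classic); last first.
    apply/seteqP; split => r /=; rewrite !in_itv/= /h.
      by move=> /andP[cr re]; rewrite ler_ndivrMr// ltr_ndivlMr//; apply/andP; split; lra.
    by rewrite ler_ndivrMr// ltr_ndivlMr// => /andP[cr re]; apply/andP; split; lra.
  rewrite !lebesgue_measure_itv/= !lte_fin ltr_ndivlMr// divfK// ltrD2r.
  case: ifPn => _; last by rewrite mule0.
  by rewrite -!EFinB -EFinM ltr0_norm//; congr EFin; field.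
- rewrite (_ : h @^-1` _ = `]((c - b) / a)%R, ((e - b) / a)%R]%classic); last first.
    apply/seteqP; split => r /=; rewrite !in_itv/= /h.
      by move=> /andP[cr re]; rewrite ltr_pdivrMr// ler_pdivlMr//; apply/andP; split; lra.
    by rewrite ltr_pdivrMr// ler_pdivlMr// => /andP[cr re]; apply/andP; split; lra.
  rewrite !lebesgue_measure_itv/= !lte_fin ltr_pdivlMr// divfK// ltrD2r.
  case: ifPn => _; last by rewrite mule0.
  by rewrite -!EFinB -EFinM gtr0_norm//; congr EFin; field.
Qed.

Lemma integral_lebesgue_affine (F : R -> \bar R) :
  (a != 0)%R -> measurable_fun setT F -> (forall x, 0 <= F x) ->
  `|a|%:E * \int[leb]_x F (a * x + b)%R = \int[leb]_x F x.
Proof.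
move=> a0 mF F0.
transitivity (\int[push_affine]_x F x).
  rewrite ge0_integral_mscale//=; congr (_ * _).
  by rewrite ge0_integral_pushforward.
by apply: eq_measure_integral => /= A mA _; rewrite -lebesgue_measure_affine.
Qed.

End one_dim.

Lemma integral_lebesgue_rVS n (F : 'rV[R]_n.+1 -> \bar R) :
  measurable_fun setT F -> (forall x, 0 <= F x) ->
  \int[lebesgue_rV n.+1]_x F x =
  \int[leb]_r \int[lebesgue_rV n]_y F (cons_rV (r, y)).
Proof.
move=> mF F0 /=; rewrite /lebesgue_cons.
rewrite ge0_integral_pushforward//=; last exact: measurable_cons_rV.
rewrite fubini_tonelli1//=.
by apply: measurableT_comp => //; exact: measurable_cons_rV.
Qed.

Lemma cons_rV_affine n (a r : R) (y : 'rV[R]_n) (v : 'rV[R]_n.+1) :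
  (a *: cons_rV (r, y) + v = cons_rV (a * r + v 0 ord0, a *: y + (uncons_rV v).2))%R.
Proof.
by apply/rowP => i; rewrite !mxE/=; case: unliftP => [j|] -> /=; rewrite ?mxE.
Qed.

Lemma measurable_rV_affine n (a : R) (v : 'rV[R]_n) :
  measurable_fun setT (fun x : 'rV[R]_n => a *: x + v)%R.
Proof.
by apply: measurable_rVD; [apply: measurable_rVZc; exact: measurable_id|exact: measurable_cst].
Qed.

(** Each coordinate contributes one factor [|a|]: the one-dimensional rule acts on the outer
    integral of Tonelli, the induction hypothesis on the inner one. *)
Lemma integral_lebesgue_rV_affine n (a : R) (v : 'rV[R]_n) (F : 'rV[R]_n -> \bar R) :
  (a != 0)%R -> measurable_fun setT F -> (forall x, 0 <= F x) ->
  (`|a| ^+ n)%:E * \int[lebesgue_rV n]_x F (a *: x + v)%R = \int[lebesgue_rV n]_x F x.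
Proof.
move=> a0; elim: n v F => [|n IHn] v F mF F0.
  rewrite expr0 mul1e; apply: eq_integral => x _.
  by congr F; apply/rowP => -[].
rewrite !integral_lebesgue_rVS//; last first.
  by apply: (measurableT_comp mF); exact: measurable_rV_affine.
have mFc : measurable_fun setT (fun z => F (cons_rV z)).
  exact: (measurableT_comp mF measurable_cons_rV).
rewrite -[RHS](@integral_lebesgue_affine a (v ord0 ord0) _ a0); last 2 first.
- exact: (measurable_fun_fubini_tonelli_F _ mFc (fun z => F0 _)).
- by move=> x; exact: integral_ge0.
rewrite exprS EFinM -muleA; congr (_ * _).
have mFa : measurable_fun setT (fun z => F (a *: cons_rV z + v)%R).
  apply: (measurableT_comp mF).
  exact: (measurableT_comp (measurable_rV_affine a v) measurable_cons_rV).
rewrite -ge0_integralZl//; last 2 first.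
- exact: (measurable_fun_fubini_tonelli_F _ mFa (fun z => F0 _)).
- by move=> x _; exact: integral_ge0.
apply: eq_integral => r _.
under eq_integral do rewrite cons_rV_affine.
rewrite (IHn _ (fun y => F (cons_rV (a * r + v 0 ord0, y))%R))//.
by apply: (measurableT_comp mFc); exact: measurable_pair1.
Qed.

Lemma integral_lebesgue_rV_shift n (v : 'rV[R]_n) (F : 'rV[R]_n -> \bar R) :
  measurable_fun setT F -> (forall x, 0 <= F x) ->
  \int[lebesgue_rV n]_x F (x + v)%R = \int[lebesgue_rV n]_x F x.
Proof.
move=> mF F0; rewrite -(@integral_lebesgue_rV_affine n 1%R v F (oner_neq0 _) mF F0).
by rewrite normr1 expr1n mul1e; under [RHS]eq_integral do rewrite scale1r.
Qed.

Lemma integral_lebesgue_rV_opp n (F : 'rV[R]_n -> \bar R) :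
  measurable_fun setT F -> (forall x, 0 <= F x) ->
  \int[lebesgue_rV n]_x F (- x)%R = \int[lebesgue_rV n]_x F x.
Proof.
move=> mF F0; rewrite -(@integral_lebesgue_rV_affine n (-1)%R 0%R F _ mF F0) ?oppr_eq0 ?oner_eq0//.
by rewrite normrN1 expr1n mul1e; under [RHS]eq_integral do rewrite scaleN1r addr0.
Qed.

End lebesgue_affine.

(** * Integral inequalities *)

Section exp_pair.
Context {R : realType}.
Implicit Types y : R.

(** Terms of the series of [2 cosh y]. They are nonnegative, so every truncation is a lower bound,
    and the odd ones vanish, so no linear term has to be controlled. *)
Let c y (k : nat) : R := exp_coeff y k + exp_coeff (- y) k.

Let c_ge0 y k : 0 <= c y k.
Proof.
rewrite /c /exp_coeff /= -mulrDl divr_ge0// exprNn.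
have [ok|ek] := boolP (odd k); first by rewrite -signr_odd ok/= expr1 mulN1r subrr.
by rewrite -signr_odd (negbTE ek)/= expr0 mul1r addr_ge0// exprn_even_ge0.
Qed.

Let c_le y k : c y k.+4 <= y ^+ 4 * c y k.
Proof.
have -> : c y k.+4 = y ^+ 4 * c y k * (k`!%:R / k.+4`!%:R).
  rewrite /c /exp_coeff /=.
  have [A0 B0] : k`!%:R != 0 :> R /\ k.+4`!%:R != 0 :> R.
    by rewrite !pnatr_eq0 -!lt0n !fact_gt0.
  move: (k`!%:R : R) (k.+4`!%:R : R) A0 B0 => A B A0 B0.
  rewrite -[k.+4]addn4 !exprD (_ : (- y) ^+ 4 = y ^+ 4); last by ring.
  by move: (y ^+ k) ((- y) ^+ k) => u v; field; rewrite A0 B0.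
rewrite ler_piMr//; first by rewrite mulr_ge0// exprn_even_ge0.
rewrite ler_pdivrMr ?ltr0n ?fact_gt0// mul1r ler_nat.
by apply: leq_fact; rewrite -addn4 leq_addr.
Qed.

Let cvg_c y : series (c y) n @[n --> \oo] --> expR y + expR (- y).
Proof.
have -> : series (c y) = series (exp_coeff y) \+ series (exp_coeff (- y)).
  by apply/funext => n; rewrite /series/= -big_split.
by apply: cvgD; exact: is_cvg_series_exp_coeff.
Qed.

Lemma expR_pair_ge y : 2 + y ^+ 2 <= expR y + expR (- y).
Proof.
have -> : 2 + y ^+ 2 = series (c y) 3.
  rewrite /series /= !big_nat_recr//= big_geq// /c /exp_coeff /= !expr0 !expr1 sqrrN.
  by rewrite !fact0 factS/= !fact0 !factS fact0; field.
have <- := cvg_lim (@Rhausdorff R) (@cvg_c y).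
apply: nondecreasing_cvgn_le; last by apply/cvg_ex; eexists; exact: (@cvg_c y).
apply/nondecreasing_seqP => k.
by rewrite /series /= big_nat_recr//= lerDl.
Qed.

(** Beyond the first four terms, worth [2 + y ^+ 2], the series is dominated term by term by
    [y ^+ 4] times itself. *)
Lemma expR_pair_le y :
  expR y + expR (- y) <= 2 + y ^+ 2 + y ^+ 4 * (expR y + expR (- y)).
Proof.
rewrite -{1}(cvg_lim (@Rhausdorff R) (@cvg_c y)).
apply: limr_le; first by apply/cvg_ex; eexists; exact: (@cvg_c y).
have nd : nondecreasing_seq (series (c y)).
  by apply/nondecreasing_seqP => k; rewrite /series /= big_nat_recr//= lerDl.
near=> k.
apply: (@le_trans _ _ (series (c y) k.+4)).
  by apply: nd; rewrite -addn4 leq_addr.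
have -> : series (c y) k.+4 = 2 + y ^+ 2 + \sum_(0 <= i < k) c y i.+4.
  rewrite /series /=; do 4 rewrite big_nat_recl//; rewrite {1 2 3 4}/c /exp_coeff /=.
  rewrite !expr0 !expr1 sqrrN !fact0 !factS fact0 exprNn -signr_odd/= expr1 mulN1r.
  by field.
rewrite lerD2l.
have <- := cvg_lim (@Rhausdorff R) (@cvg_c y).
apply: (@le_trans _ _ (y ^+ 4 * series (c y) k)).
  by rewrite /series /= mulr_sumr; apply: ler_sum => i _; exact: c_le.
rewrite ler_wpM2l ?exprn_even_ge0//.
by apply: nondecreasing_cvgn_le => //; apply/cvg_ex; eexists; exact: (@cvg_c y).
Unshelve. all: by end_near. Qed.

Lemma exprn_even_le_expR_pair y k : ~~ odd k.+1 ->
  y ^+ k.+1 <= k.+1`!%:R * (expR y + expR (- y)).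
Proof.
move=> ek; rewrite mulrC -ler_pdivrMr ?ltr0n ?fact_gt0//.
have h : y ^+ k.+1 = `|y| ^+ k.+1 by rewrite -normrX ger0_norm// exprn_even_ge0.
apply: (@le_trans _ _ (expR `|y|)).
  rewrite h; apply: le_trans (expR_ge1Dxn k (normr_ge0 y)).
  by rewrite lerDr.
by case: (ger0P y) => _; rewrite ?lerDl ?lerDr expR_ge0.
Qed.

End exp_pair.

Section push_probability.
Context d d' (T : measurableType d) (T' : measurableType d') (R : realType).
Variables (P : probability T R) (h : T -> T').
Hypothesis mh : measurable_fun setT h.

Let hX : {RV P >-> T'} := HB.pack h (isMeasurableFun.Build _ _ _ _ h mh).

Definition push_probability : probability T' R := distribution P hX.

Lemma integral_push_probability (F : T' -> \bar R) :
  measurable_fun setT F -> (forall x, 0 <= F x)%E ->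
  (\int[push_probability]_x F x = \int[P]_x F (h x))%E.
Proof. by move=> mF F0; rewrite ge0_integral_distribution. Qed.

End push_probability.

Section integral_tools.
Context d (T : measurableType d) (R : realType).
Local Open Scope ereal_scope.
Implicit Types (mu : {measure set T -> \bar R}) (P : probability T R) (F G : T -> R).

Lemma integral_cst1 P (r : R) : \int[P]_x r%:E = r%:E.
Proof.
transitivity (r%:E * P setT); last by rewrite probability_setT mule1.
exact: (integral_cst P measurableT r%:E).
Qed.

Lemma le_integral_EFin mu F G : measurable_fun setT F -> measurable_fun setT G ->
  (forall x, (0 <= F x)%R) -> (forall x, (F x <= G x)%R) ->
  \int[mu]_x (F x)%:E <= \int[mu]_x (G x)%:E.
Proof.
move=> mF mG F0 FG; apply: ge0_le_integral => //.
- by move=> x _; rewrite lee_fin.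
- exact/measurable_EFinP.
- exact/measurable_EFinP.
- by move=> x _; rewrite lee_fin.
Qed.

Lemma integral_EFinD mu F G : measurable_fun setT F -> measurable_fun setT G ->
  (forall x, (0 <= F x)%R) -> (forall x, (0 <= G x)%R) ->
  \int[mu]_x (F x + G x)%:E = \int[mu]_x (F x)%:E + \int[mu]_x (G x)%:E.
Proof.
move=> mF mG F0 G0; under eq_integral do rewrite EFinD; rewrite ge0_integralD//.
- by move=> x _; rewrite lee_fin.
- exact/measurable_EFinP.
- by move=> x _; rewrite lee_fin.
- exact/measurable_EFinP.
Qed.

Lemma integral_EFinZ mu F (a : R) : measurable_fun setT F ->
  (forall x, (0 <= F x)%R) -> (0 <= a)%R ->
  \int[mu]_x (a * F x)%:E = a%:E * \int[mu]_x (F x)%:E.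
Proof.
move=> mF F0 a0; under eq_integral do rewrite EFinM; rewrite ge0_integralZl//.
- exact/measurable_EFinP.
- by move=> x _; rewrite lee_fin.
Qed.

Lemma integral_EFin_ge0 mu F : (forall x, (0 <= F x)%R) -> 0 <= \int[mu]_x (F x)%:E.
Proof. by move=> F0; apply: integral_ge0 => x _; rewrite lee_fin. Qed.

(* With weight t = b / a, (F + G)^2 <= (1 + t) F^2 + (1 + 1/t) G^2. *)
Lemma L2_triangle mu F G (a b : R) :
  measurable_fun setT F -> measurable_fun setT G -> (0 <= a)%R -> (0 <= b)%R ->
  \int[mu]_x (F x ^+ 2)%:E <= (a ^+ 2)%:E ->
  \int[mu]_x (G x ^+ 2)%:E <= (b ^+ 2)%:E ->
  \int[mu]_x ((F x + G x) ^+ 2)%:E <= ((a + b) ^+ 2)%:E.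
Proof.
move=> mF mG a0 b0 Fa Gb.
have mF2 : measurable_fun setT (fun x => F x ^+ 2)%R by exact: measurable_funX.
have mG2 : measurable_fun setT (fun x => G x ^+ 2)%R by exact: measurable_funX.
have pos (e : R) : (0 < e)%R ->
    \int[mu]_x ((F x + G x) ^+ 2)%:E <= ((a + b + e) ^+ 2)%:E.
  (* Enlarging both bounds makes them positive, so that the weights [b' / a'] and [a' / b'] make
     sense even when [a] or [b] is 0. *)
  move=> e0; pose a' := (a + e / 2)%R; pose b' := (b + e / 2)%R.
  have a'0 : (0 < a')%R by rewrite /a'; lra.
  have b'0 : (0 < b')%R by rewrite /b'; lra.
  have t0 : (0 <= 1 + b' / a')%R by rewrite addr_ge0// divr_ge0// ltW.
  have s0 : (0 <= 1 + a' / b')%R by rewrite addr_ge0// divr_ge0// ltW.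
  apply: (@le_trans _ _ (\int[mu]_x ((1 + b' / a') * F x ^+ 2 + (1 + a' / b') * G x ^+ 2)%:E)).
    apply: le_integral_EFin => [|||x].
    - by apply: measurable_funX; exact: measurable_funD.
    - by apply: measurable_funD; apply: measurable_funM.
    - by move=> x; rewrite sqr_ge0.
    - rewrite -subr_ge0.
      have -> : ((1 + b' / a') * F x ^+ 2 + (1 + a' / b') * G x ^+ 2 - (F x + G x) ^+ 2 =
        (b' * F x - a' * G x) ^+ 2 / (a' * b'))%R by field; rewrite !gt_eqF.
      by rewrite divr_ge0 ?sqr_ge0// mulr_ge0// ltW.
  rewrite integral_EFinD; last 4 first.
  - exact: measurable_funM.
  - exact: measurable_funM.
  - by move=> x; rewrite mulr_ge0// sqr_ge0.
  - by move=> x; rewrite mulr_ge0// sqr_ge0.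
  rewrite !integral_EFinZ//; do ?by move=> x; rewrite sqr_ge0.
  apply: (@le_trans _ _ ((1 + b' / a')%:E * (a' ^+ 2)%:E + (1 + a' / b')%:E * (b' ^+ 2)%:E)).
    apply: leeD; apply: lee_wpmul2l; rewrite ?lee_fin//.
      by apply: (le_trans Fa); rewrite lee_fin ler_sqr ?nnegrE /a'; lra.
    by apply: (le_trans Gb); rewrite lee_fin ler_sqr ?nnegrE /b'; lra.
  rewrite -!EFinM -EFinD lee_fin.
  have -> : ((1 + b' / a') * a' ^+ 2 + (1 + a' / b') * b' ^+ 2 = (a' + b') ^+ 2)%R.
    by field; rewrite !gt_eqF.
  suff -> : (a' + b' = a + b + e)%R by [].
  by rewrite /a' /b'; field.
have I0 : 0 <= \int[mu]_x ((F x + G x) ^+ 2)%:E.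
  by apply: integral_EFin_ge0 => x; exact: sqr_ge0.
have Ifin : \int[mu]_x ((F x + G x) ^+ 2)%:E \is a fin_num.
  by rewrite ge0_fin_numE//; apply: le_lt_trans (pos 1%R ltr01) (ltry _).
rewrite -(fineK Ifin) lee_fin; apply/ler_addgt0Pr => e e0.
(* With [s = a + b] and [d <= 1], [(s + d)^2 - s^2 <= d (2 s + 1) <= e]. *)
have d0 : (0 < Num.min 1 (e / (2 * (a + b) + 1)))%R.
  by rewrite lt_min ltr01/= divr_gt0//; lra.
have := pos _ d0; rewrite -(fineK Ifin) lee_fin => /le_trans; apply.
set dd := Num.min _ _ in d0 *.
have d1 : (dd <= 1)%R by rewrite /dd ge_min lexx.
have d2 : (dd * (2 * (a + b) + 1) <= e)%R.
  by rewrite -ler_pdivlMr; [rewrite /dd ge_min lexx orbT|lra].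
have := mulr_ge0 (ltW d0) (_ : 0 <= 1 - dd)%R; rewrite subr_ge0 => /(_ d1); nra.
Qed.

Lemma L2_mono mu F G (a : R) :
  measurable_fun setT F -> measurable_fun setT G ->
  (forall x, `|F x| <= G x)%R ->
  \int[mu]_x (G x ^+ 2)%:E <= (a ^+ 2)%:E -> \int[mu]_x (F x ^+ 2)%:E <= (a ^+ 2)%:E.
Proof.
move=> mF mG FG; apply: le_trans; apply: le_integral_EFin => [|||x].
- exact: measurable_funX.
- exact: measurable_funX.
- by move=> x; rewrite sqr_ge0.
- rewrite -(real_normK (num_real (F x))) ler_sqr ?nnegrE//.
  by rewrite (le_trans _ (FG x)).
Qed.

Lemma L2_scale mu F (c a : R) : measurable_fun setT F ->
  \int[mu]_x (F x ^+ 2)%:E <= (a ^+ 2)%:E ->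
  \int[mu]_x ((c * F x) ^+ 2)%:E <= ((c * a) ^+ 2)%:E.
Proof.
move=> mF Fa; under eq_integral do rewrite exprMn.
rewrite integral_EFinZ ?sqr_ge0//; last 2 first.
- exact: measurable_funX.
- by move=> x; rewrite sqr_ge0.
by rewrite exprMn (EFinM (c ^+ 2)) lee_wpmul2l// lee_fin sqr_ge0.
Qed.

End integral_tools.

(** * Densities and subgaussian moments *)

Section integral_density.
Context d (T : measurableType d) (R : realType).
Local Open Scope ereal_scope.
Variables (mu lam : {measure set T -> \bar R}) (k : T -> R).
Hypotheses (mk : measurable_fun setT k) (k0 : forall x, (0 <= k x)%R).
Hypothesis muE : forall A, measurable A -> mu A = \int[lam]_(x in A) (k x)%:E.

Let integral_density_indic E : measurable E ->
  \int[mu]_x (\1_E x)%:E = \int[lam]_x (\1_E x * k x)%:E.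
Proof.
move=> mE; rewrite integral_indic// setIT muE// integral_mkcond/=.
apply: eq_integral => x _; rewrite patchE indicE.
by case: ifPn => _; rewrite ?mul1r ?mul0r.
Qed.

Import HBNNSimple.

Let integral_density_nnsfun (h : {nnsfun T >-> R}) :
  \int[mu]_x (h x)%:E = \int[lam]_x (h x * k x)%:E.
Proof.
under [LHS]eq_integral do rewrite fimfunE -fsumEFin//.
rewrite [LHS]ge0_integral_fsum//; last 2 first.
  - by move=> r; exact/measurable_EFinP/measurableT_comp.
  - by move=> n x _; rewrite EFinM nnfun_muleindic_ge0.
under [RHS]eq_integral.
  move=> x xD; rewrite fimfunE EFinM -fsumEFin// ge0_mule_fsuml; last first.
    by move=> r; rewrite EFinM nnfun_muleindic_ge0.
  over.
rewrite [RHS]ge0_integral_fsum//; last 2 first.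
  - move=> r; apply: emeasurable_funM; last exact/measurable_EFinP.
    exact/measurable_EFinP/measurableT_comp.
  - move=> n x _; apply: mule_ge0; last by rewrite lee_fin.
    by rewrite EFinM nnfun_muleindic_ge0.
apply: eq_fsbigr => r _.
(* A negative [r] is not a value of [h], so both sides vanish. *)
have [r0|r0] := leP 0%R r.
  rewrite integral_EFinZ//; do ?by move=> x; rewrite indicE.
  under [RHS]eq_integral do rewrite -EFinM -mulrA.
  rewrite integral_EFinZ//; last 2 first.
  - by apply: measurable_funM => //; exact: measurable_indic.
  - by move=> x; rewrite mulr_ge0// indicE.
  by rewrite integral_density_indic.
rewrite !preimage_nnfun0//.
by under eq_integral do rewrite indic0 mulr0;
  under [RHS]eq_integral do rewrite indic0 mulr0 mul0e; rewrite !integral0.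
Qed.

(** Indicators, simple functions, monotone limits. Values in [\bar R] allow inner integrals of
    Tonelli arguments as test functions. *)
Lemma integral_density (F : T -> \bar R) :
  measurable_fun setT F -> (forall x, 0 <= F x) ->
  \int[mu]_x F x = \int[lam]_x (F x * (k x)%:E).
Proof.
move=> mF F0.
pose f_ := nnsfun_approx measurableT mF.
transitivity (limn (fun n => \int[mu]_x (f_ n x)%:E)).
  rewrite -monotone_convergence//=.
  - apply: eq_integral => ? /[!inE] xD; apply/esym/cvg_lim => //=.
    exact: cvg_nnsfun_approx.
  - by move=> n; exact/measurable_EFinP/measurable_funTS.
  - by move=> n ? _; rewrite lee_fin.
  - by move=> ? _ ? ? mn; rewrite lee_fin; exact/lefP/nd_nnsfun_approx.
transitivity (limn (fun n => \int[lam]_x (f_ n x * k x)%:E)).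
  by congr (limn _); apply/funext => n; exact: integral_density_nnsfun.
rewrite -monotone_convergence//=.
- apply: eq_integral => x /[!inE] xD; apply/cvg_lim => //=.
  under eq_fun do rewrite EFinM.
  apply: cvgeZr => //.
  exact: cvg_nnsfun_approx.
- by move=> n; apply/measurable_EFinP/measurable_funM.
- by move=> n x _; rewrite lee_fin mulr_ge0.
- move=> x _ a b ab; rewrite lee_fin ler_wpM2r//.
  exact/lefP/nd_nnsfun_approx.
Qed.

End integral_density.

Section subgaussian_moments.
Context d (T : measurableType d) (R : realType).
Local Open Scope ereal_scope.
Variables (P : probability T R) (X : T -> R) (s : R).
Hypotheses (mX : measurable_fun setT X) (s0 : (0 <= s)%R).
Hypothesis mgf : forall t : R,
  \int[P]_x (expR (t * X x))%:E <= (expR (t ^+ 2 * s / 2))%:E.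

Let mexp (t : R) : measurable_fun setT (fun x => expR (t * X x)).
Proof. by apply: measurableT_comp => //; exact: measurable_funM. Qed.

Lemma integral_expR_pair_le (t : R) :
  \int[P]_x (expR (t * X x) + expR (- (t * X x)))%:E <=
  (2 * expR (t ^+ 2 * s / 2))%:E.
Proof.
under eq_integral do rewrite -mulNr.
rewrite integral_EFinD//; do ?by move=> x; rewrite expR_ge0.
have -> : (2 * expR (t ^+ 2 * s / 2) = expR (t ^+ 2 * s / 2) + expR (t ^+ 2 * s / 2))%R by ring.
rewrite EFinD; apply: leeD; first exact: mgf.
by rewrite -(sqrrN t); exact: mgf.
Qed.

Let mpair (t : R) : measurable_fun setT (fun x => expR (t * X x) + expR (- (t * X x)))%R.
Proof.
by under eq_fun do rewrite -mulNr; exact: measurable_funD.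
Qed.

Let pair0 (y : R) : (0 <= expR y + expR (- y))%R.
Proof. by rewrite addr_ge0// expR_ge0. Qed.

(** The symmetrised bound at [t = 1]. The crude constant is harmless: it enters finiteness arguments
    and error terms that vanish as the chain is refined. *)
Lemma subgaussian_even_moment (k : nat) : ~~ odd k.+1 ->
  \int[P]_x (X x ^+ k.+1)%:E <= (k.+1`!%:R * (2 * expR (s / 2)))%:E.
Proof.
move=> ek.
have h := integral_expR_pair_le 1; rewrite expr1n mul1r in h.
rewrite EFinM; apply: (le_trans _ (lee_wpmul2l _ h)); last by rewrite lee_fin.
rewrite -integral_EFinZ//.
  apply: le_integral_EFin => [|||x].
  - exact: measurable_funX.
  - exact: measurable_funM.
  - by move=> x; rewrite exprn_even_ge0.
  - by rewrite mul1r; exact: exprn_even_le_expR_pair.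
Qed.

(** Integrating [2 + (t X)^2 <= expR (t X) + expR (- t X)], dividing by [t^2] and letting [t] tend
    to 0 gives the sharp constant [s], which the final bound inherits. *)
Lemma subgaussian_variance_le : \int[P]_x (X x ^+ 2)%:E <= s%:E.
Proof.
have I0 : 0 <= \int[P]_x (X x ^+ 2)%:E by apply: integral_EFin_ge0 => x; exact: sqr_ge0.
have key (t : R) : (0 < t)%R ->
    (t ^+ 2)%:E * \int[P]_x (X x ^+ 2)%:E <= (2 * (expR (t ^+ 2 * s / 2) - 1))%:E.
  move=> t0.
  have h : \int[P]_x (2 + (t * X x) ^+ 2)%:E <= (2 * expR (t ^+ 2 * s / 2))%:E.
    apply: le_trans (integral_expR_pair_le t); apply: le_integral_EFin => [||x|x] //.
    - by apply: measurable_funD => //; apply: measurable_funX; exact: measurable_funM.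
    - by rewrite addr_ge0// sqr_ge0.
    - exact: expR_pair_ge.
  move: h; under eq_integral do rewrite exprMn.
  rewrite integral_EFinD//; last 2 first.
  - by apply: measurable_funM => //; exact: measurable_funX.
  - by move=> x; rewrite mulr_ge0// sqr_ge0.
  rewrite integral_cst1 integral_EFinZ ?sqr_ge0//; last 2 first.
  - exact: measurable_funX.
  - by move=> x; rewrite sqr_ge0.
  by rewrite mulrBr mulr1 EFinB leeBrDl.
have fin : \int[P]_x (X x ^+ 2)%:E \is a fin_num.
  rewrite ge0_fin_numE//; have := @subgaussian_even_moment 1 isT.
  by move=> /le_lt_trans; apply; exact: ltry.
rewrite -(fineK fin) lee_fin; set I := fine _.
have I0' : (0 <= I)%R by exact: fine_ge0.
apply/ler_addgt0Pr => e e0.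
(* [w] plays the part of [t ^+ 2]: the first entry keeps [1 - w s / 2] positive, the second makes
   the loss [I w s / 2] smaller than [e]. *)
pose w := Num.min (1 / (s + 1))%R (e / (I * s + 1))%R.
have Is0 : (0 <= I * s)%R by exact: mulr_ge0.
have w0 : (0 < w)%R by rewrite lt_min; apply/andP; split; apply: divr_gt0 => //; move: s0; lra.
have w1 : (w * (s + 1) <= 1)%R.
  by rewrite -ler_pdivlMr; [rewrite /w ge_min lexx|move: s0; lra].
have w2 : (w * (I * s + 1) <= e)%R.
  by rewrite -ler_pdivlMr; [rewrite /w ge_min lexx orbT|move: Is0; lra].
have ws : (0 <= w * s)%R by rewrite mulr_ge0// ltW.
have := key (Num.sqrt w); rewrite sqrtr_gt0 => /(_ w0).
rewrite sqr_sqrtr ?(ltW w0)// -(fineK fin) -/I -EFinM lee_fin => k1.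
have r1 : (0 < 1 - w * s / 2)%R by move: w1 ws; lra.
have k2 : (expR (w * s / 2) <= (1 - w * s / 2)^-1)%R.
  rewrite -[expR _]invrK -expRN lef_pV2 ?posrE ?expR_gt0//.
  by have := expR_ge1Dx (- (w * s / 2)); lra.
have k3 : (w * I * (1 - w * s / 2) <= w * s)%R.
  apply: (@le_trans _ _ (2 * ((1 - w * s / 2)^-1 - 1) * (1 - w * s / 2))%R).
    by rewrite ler_pM2r//; apply: (le_trans k1); lra.
  by rewrite -mulrA mulrBl mulVf ?gt_eqF//; lra.
have k4 : (I * (1 - w * s / 2) <= s)%R by rewrite -(ler_pM2l w0) mulrA.
by move: k4 w2 w0; nra.
Qed.

End subgaussian_moments.

Section gaussian_variance.
Context d (T : measurableType d) (R : realType).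
Local Open Scope ereal_scope.
Variables (P : probability T R) (X : T -> R) (s : R).
Hypotheses (mX : measurable_fun setT X) (s0 : (0 <= s)%R).
Hypothesis mgf : forall t : R,
  \int[P]_x (expR (t * X x))%:E = (expR (t ^+ 2 * s / 2))%:E.

Let mgf_le (t : R) : \int[P]_x (expR (t * X x))%:E <= (expR (t ^+ 2 * s / 2))%:E.
Proof. by rewrite mgf. Qed.

Let mexp (t : R) : measurable_fun setT (fun x => expR (t * X x)).
Proof. by apply: measurableT_comp => //; exact: measurable_funM. Qed.

Let mpair (t : R) : measurable_fun setT (fun x => expR (t * X x) + expR (- (t * X x)))%R.
Proof.
by under eq_fun do rewrite -mulNr; exact: measurable_funD.
Qed.

Let pair0 (y : R) : (0 <= expR y + expR (- y))%R.
Proof. by rewrite addr_ge0// expR_ge0. Qed.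

(** Domination uniform in [t <= 1]: the fourth power is at most [4!] times [expR |X|], each
    exponential at most [expR |X|], and the square of [expR |X|] lies below the pair at 2. *)
Let pair_bound (t : R) x : (0 <= t)%R -> (t <= 1)%R ->
  (X x ^+ 4 * (expR (t * X x) + expR (- (t * X x))) <=
   96 * (expR (2 * X x) + expR (- (2 * X x))))%R.
Proof.
move=> t0 t1.
set E := expR `|X x|.
have EE : (E ^+ 2 <= expR (2 * X x) + expR (- (2 * X x)))%R.
  rewrite /E -expRM_natl; case: (ger0P (X x)) => _.
    by rewrite lerDl expR_ge0.
  by rewrite mulrN lerDr expR_ge0.
have X4 : (X x ^+ 4 <= 24 * E)%R.
  have := expR_ge1Dxn 3 (normr_ge0 (X x)); rewrite -/E.
  rewrite -normrX ger0_norm ?exprn_even_ge0// => h.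
  have : (X x ^+ 4 / 4`!%:R <= E)%R by apply: le_trans h; rewrite lerDr.
  by rewrite ler_pdivrMr ?ltr0n// mulrC !factS fact0.
have tE (b : bool) : (expR ((-1) ^+ b * (t * X x)) <= E)%R.
  rewrite ler_expR; apply: (le_trans (ler_norm _)).
  by rewrite normrM normr_sign mul1r normrM ger0_norm// ler_piMl.
have E0 : (0 <= E)%R by exact: expR_ge0.
have := tE true; have := tE false; rewrite expr0 expr1 mul1r mulN1r => t2 t3.
apply: (@le_trans _ _ ((24 * E) * (E + E))%R).
  by apply: ler_pM => //; [rewrite exprn_even_ge0|exact: lerD].
by have := sqr_ge0 E; move: EE; rewrite expr2; lra.
Qed.

(** The lower bound holds because the remainder of the quadratic expansion is of order [t^4], hence
    negligible after division by [t^2]. Equality matters: squares of Gaussian linear forms will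
    stand on both sides of the symmetrised estimate for one move. *)
Lemma gaussian_variance : \int[P]_x (X x ^+ 2)%:E = s%:E.
Proof.
have le := subgaussian_variance_le mX s0 mgf_le.
have I0 : 0 <= \int[P]_x (X x ^+ 2)%:E by apply: integral_EFin_ge0 => x; exact: sqr_ge0.
have fin : \int[P]_x (X x ^+ 2)%:E \is a fin_num.
  by rewrite ge0_fin_numE//; apply: le_lt_trans le (ltry _).
apply/eqP; rewrite eq_le le/=.
rewrite -(fineK fin) lee_fin; set I := fine _.
(* The 96 of [pair_bound] times the bound [2 expR (2 s)] for the pair at 2. *)
pose C := (192 * expR (2 * s))%R.
have C0 : (0 < C)%R by apply: mulr_gt0; [lra|exact: expR_gt0].
have key (w : R) : (0 < w)%R -> (w <= 1)%R -> (s <= I + w * C)%R.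
  move=> w0 w1; pose t := Num.sqrt w.
  have t2 : (t ^+ 2 = w)%R by rewrite sqr_sqrtr// ltW.
  have t1 : (t <= 1)%R by rewrite -sqrtr1 ler_sqrt.
  have t0 : (0 <= t)%R by exact: sqrtr_ge0.
  have mX2 : measurable_fun setT (fun x => X x ^+ 2)%R by exact: measurable_funX.
  have h : \int[P]_x (expR (t * X x) + expR (- (t * X x)))%:E <=
    \int[P]_x (2 + w * X x ^+ 2 + w ^+ 2 * (96 * (expR (2 * X x) + expR (- (2 * X x)))))%:E.
    apply: le_integral_EFin => [||x|x] //.
    - apply: measurable_funD; last by do 2 apply: measurable_funM => //.
      by apply: measurable_funD => //; exact: measurable_funM.
    - apply: (le_trans (expR_pair_le _)).
      rewrite exprMn t2 lerD2l exprMn (_ : (t ^+ 4 = w ^+ 2)%R); last by rewrite -t2; ring.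
      by rewrite -mulrA ler_wpM2l ?sqr_ge0//; exact: pair_bound.
  move: h; under eq_integral do rewrite -mulNr.
  rewrite integral_EFinD//; do ?by move=> x; rewrite expR_ge0.
  rewrite !mgf sqrrN t2.
  rewrite integral_EFinD; last 4 first.
  - by apply: measurable_funD => //; exact: measurable_funM.
  - by do 2 apply: measurable_funM => //.
  - by move=> x; rewrite addr_ge0// mulr_ge0 ?sqr_ge0// ltW.
  - by move=> x; apply: mulr_ge0; [exact: sqr_ge0|apply: mulr_ge0 => //; exact: pair0].
  rewrite integral_EFinD//; last 2 first.
  - exact: measurable_funM.
  - by move=> x; rewrite mulr_ge0 ?sqr_ge0// ltW.
  rewrite integral_cst1 integral_EFinZ//; last 2 first.
  - by move=> x; rewrite sqr_ge0.
  - exact: ltW.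
  rewrite (integral_EFinZ P (a := w ^+ 2)) ?sqr_ge0//; last exact: measurable_funM.
  rewrite integral_EFinZ// => h.
  have h2 := integral_expR_pair_le mX mgf_le 2.
  have h3 : (w ^+ 2)%:E * (96%:E * \int[P]_x (expR (2 * X x) + expR (- (2 * X x)))%:E) <=
     (w ^+ 2)%:E * (96%:E * (2 * expR (2 ^+ 2 * s / 2))%:E).
    by rewrite !lee_wpmul2l// lee_fin// sqr_ge0.
  have := le_trans h (leeD (lexx _) h3).
  rewrite -(fineK fin) -/I -!EFinM -!EFinD lee_fin.
  have -> : (2 ^+ 2 * s / 2 = 2 * s)%R by field.
  have := expR_ge1Dx (w * s / 2); move=> e1 e2.
  rewrite -(ler_pM2l w0); rewrite /C; move: e1 e2; nra.
apply/ler_addgt0Pr => e e0.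
pose w := Num.min 1%R (e / C)%R.
have w0 : (0 < w)%R by rewrite lt_min ltr01/= divr_gt0.
have w1 : (w <= 1)%R by rewrite /w ge_min lexx.
apply: (le_trans (key w w0 w1)); rewrite lerD2l -ler_pdivlMr//.
by rewrite /w ge_min lexx orbT.
Qed.

End gaussian_variance.

(** * Gaussian vectors *)

Section euclidean_moments.
Context {R : realType} {n : nat} d (T : measurableType d).
Local Open Scope ereal_scope.
Variables (P : probability T R) (X : T -> 'rV[R]_n) (s : R).
Hypotheses (mX : measurable_fun setT X) (s0 : (0 <= s)%R).
Hypothesis mgf : forall i (t : R),
  \int[P]_x (expR (t * X x 0%R i))%:E <= (expR (t ^+ 2 * s / 2))%:E.

Let mXi i : measurable_fun setT (fun x => X x 0%R i).
Proof. by move: i; apply/measurable_fun_rVP. Qed.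

Lemma integral_norm2_sqr_le : \int[P]_x (norm2 (X x) ^+ 2)%:E <= (n%:R * s)%:E.
Proof.
under eq_integral do rewrite norm2_rowE -sumEFin.
rewrite ge0_integral_sum//; last 2 first.
- by move=> i; apply/measurable_EFinP; exact: measurable_funX.
- by move=> i x _; rewrite lee_fin sqr_ge0.
apply: (@le_trans _ _ (\sum_(i < n) s%:E)).
  by apply: lee_sum => i _; exact: (subgaussian_variance_le (mXi i) s0 (mgf i)).
by rewrite sumEFin sumr_const card_ord mulr_natl.
Qed.

(** Cauchy-Schwarz against the vector of ones. *)
Let sqr_sum_le (a : 'I_n -> R) : ((\sum_i a i) ^+ 2 <= n%:R * \sum_i a i ^+ 2)%R.
Proof.
have := normr_dot_le (\row_i a i) (const_mx 1%R).
have -> : dot (\row_i a i) (const_mx 1%R) = (\sum_i a i)%R.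
  by apply: eq_bigr => i _; rewrite !mxE mulr1.
rewrite -ler_sqr ?nnegrE ?mulr_ge0 ?norm2_ge0// real_normK ?num_real// => /le_trans; apply.
rewrite exprMn !norm2_rowE mulrC.
under eq_bigr do rewrite mxE expr1n.
rewrite sumr_const card_ord.
by under eq_bigr do rewrite mxE.
Qed.

Lemma norm2_expr8_le (x : 'rV[R]_n) :
  (norm2 x ^+ 8 <= n%:R ^+ 3 * \sum_i x 0 i ^+ 8)%R.
Proof.
have -> : (norm2 x ^+ 8 = ((\sum_i x 0 i ^+ 2) ^+ 2) ^+ 2)%R.
  by rewrite -norm2_rowE -!exprM.
apply: (@le_trans _ _ ((n%:R * \sum_i (x 0 i ^+ 2) ^+ 2) ^+ 2)%R).
  rewrite ler_sqr; [exact: sqr_sum_le|by rewrite nnegrE sqr_ge0|rewrite nnegrE].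
  by rewrite mulr_ge0// sumr_ge0// => i _; exact: sqr_ge0.
rewrite exprMn (exprSr _ 2) -[leRHS]mulrA ler_wpM2l ?sqr_ge0//.
apply: (le_trans (sqr_sum_le (fun i => (x 0%R i ^+ 2) ^+ 2)%R)).
by under eq_bigr do rewrite -!exprM.
Qed.

(** Only its finiteness matters: it occurs in errors of order [r^3] per move, whose total tends to
    0. *)
Definition moment8_bound (k : nat) (v : R) : R :=
  (k%:R ^+ 3 * (k%:R * (8`!%:R * (2 * expR (v / 2)))))%R.

Lemma moment8_bound_ge0 k v : (0 <= moment8_bound k v)%R.
Proof.
apply: mulr_ge0; first exact: exprn_ge0.
by do 3 apply: mulr_ge0 => //; exact: expR_ge0.
Qed.

Lemma integral_norm2_expr8_le :
  \int[P]_x (norm2 (X x) ^+ 8)%:E <= (moment8_bound n s)%:E.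
Proof.
have mX8 i : measurable_fun setT (fun x => X x 0%R i ^+ 8)%R by exact: measurable_funX.
apply: (@le_trans _ _ (\int[P]_x (n%:R ^+ 3 * \sum_i X x 0%R i ^+ 8)%:E)).
  apply: le_integral_EFin => [|||x].
  - by apply: measurable_funX; exact: measurable_norm2.
  - by apply: measurable_funM => //; apply: (measurable_sum (index_enum 'I_n)
      (h := fun i x => X x 0%R i ^+ 8)%R).
  - by move=> x; rewrite exprn_ge0// norm2_ge0.
  - exact: norm2_expr8_le.
rewrite integral_EFinZ; last 3 first.
- by apply: (measurable_sum (index_enum 'I_n) (h := fun i x => X x 0%R i ^+ 8)%R).
- by move=> x; apply: sumr_ge0 => i _; rewrite exprn_even_ge0.
- by rewrite exprn_ge0.
rewrite /moment8_bound (EFinM (n%:R ^+ 3)) lee_wpmul2l ?lee_fin ?exprn_ge0//.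
under eq_integral do rewrite -sumEFin.
rewrite ge0_integral_sum//; last 2 first.
- by move=> i; exact/measurable_EFinP.
- by move=> i x _; rewrite lee_fin exprn_even_ge0.
apply: (@le_trans _ _ (\sum_(i < n) (8`!%:R * (2 * expR (s / 2)))%:E)).
  by apply: lee_sum => i _; exact: (subgaussian_even_moment (mXi i) (mgf i) (k := 7)).
by rewrite sumEFin sumr_const card_ord -(mulr_natl (_ * _) n).
Qed.

End euclidean_moments.

Section standard_gaussian.
Context {R : realType} {n : nat}.
Local Open Scope ereal_scope.
Variable N : probability 'rV[R]_n R.
Hypothesis NE : forall A, measurable A -> N A = std_normal A.
Let phi := @std_normal_pdf R n.

Let phi_ge0 x : (0 <= phi x)%R.
Proof. by rewrite /phi /std_normal_pdf mulr_ge0 ?expR_ge0// invr_ge0 exprn_ge0// sqrtr_ge0. Qed.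

Let measurable_phi : measurable_fun setT phi.
Proof.
apply: measurable_funM => //; apply: measurableT_comp => //; apply: measurableT_comp => //.
by apply: measurable_funM => //; apply: measurable_funX; apply: measurable_norm2; exact: measurable_id.
Qed.

Lemma integral_gaussianE (F : 'rV[R]_n -> \bar R) :
  measurable_fun setT F -> (forall x, 0 <= F x) ->
  \int[N]_x F x = \int[lebesgue_rV n]_x (F x * (phi x)%:E).
Proof. by move=> mF F0; apply: integral_density. Qed.

Let mulphi (F : 'rV[R]_n -> \bar R) :
  measurable_fun setT F -> measurable_fun setT (fun x => F x * (phi x)%:E).
Proof. by move=> mF; apply: emeasurable_funM => //; exact/measurable_EFinP. Qed.

(** Completing the square turns the tilted density into a translate of [phi]; the mass of [phi] is 1
    because [N] is a probability, so no Gaussian integral is computed. *)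
Lemma gaussian_mgf (v : 'rV[R]_n) :
  \int[N]_x (expR (dot v x))%:E = (expR (norm2 v ^+ 2 / 2))%:E.
Proof.
have mdot : measurable_fun setT (fun x => expR (dot v x)).
  by apply: measurableT_comp => //; apply: measurable_dot => //; exact: measurable_id.
rewrite integral_gaussianE; last 2 first.
- exact/measurable_EFinP.
- by move=> x; rewrite lee_fin expR_ge0.
have e x : (expR (dot v x))%:E * (phi x)%:E =
    (expR (norm2 v ^+ 2 / 2))%:E * (phi (x - v))%:E.
  rewrite -!EFinM /phi /std_normal_pdf; congr EFin.
  rewrite [LHS]mulrCA [RHS]mulrCA; congr (_ * _)%R.
  by rewrite -!expRD norm2_sqrB (dotC x v); congr expR; field.
under eq_integral do rewrite e.
rewrite ge0_integralZl//.
- rewrite (integral_lebesgue_rV_shift (- v) (F := fun x => (phi x)%:E))//.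
  + transitivity ((expR (norm2 v ^+ 2 / 2))%:E * \int[N]_x 1).
      rewrite integral_gaussianE//; congr (_ * _).
      by under [RHS]eq_integral do rewrite mul1e.
    by rewrite integral_cst1 mule1.
  + exact/measurable_EFinP.
- apply/measurable_EFinP; apply: measurableT_comp => //.
  by apply: measurable_rVB => //; exact: measurable_id.
- by move=> x _; rewrite lee_fin.
Qed.

Lemma gaussian_opp (F : 'rV[R]_n -> \bar R) :
  measurable_fun setT F -> (forall x, 0 <= F x) ->
  \int[N]_x F (- x)%R = \int[N]_x F x.
Proof.
move=> mF F0.
rewrite !integral_gaussianE//; last first.
  by apply: (measurableT_comp mF); apply: measurable_rVN; exact: measurable_id.
rewrite -[RHS](integral_lebesgue_rV_opp (F := fun x => F x * (phi x)%:E)); last 2 first.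
- exact: mulphi.
- by move=> x; apply: mule_ge0 => //; rewrite lee_fin.
by apply: eq_integral => x _; rewrite /phi /std_normal_pdf norm2N.
Qed.

Lemma gaussian_dot_sqr (v : 'rV[R]_n) :
  \int[N]_x (dot v x ^+ 2)%:E = (norm2 v ^+ 2)%:E.
Proof.
apply: (gaussian_variance (X := fun x => dot v x)).
- by apply: measurable_dot => //; exact: measurable_id.
- exact: sqr_ge0.
- move=> t; under eq_integral do rewrite -dotZl.
  by rewrite gaussian_mgf norm2Z exprMn real_normK ?num_real.
Qed.

Let gaussian_coord_mgf i (t : R) :
  \int[N]_x (expR (t * x 0%R i))%:E <= (expR (t ^+ 2 * 1 / 2))%:E.
Proof.
have e (x : 'rV[R]_n) : (t * x 0 i = dot (t *: delta_mx 0 i) x)%R.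
  rewrite dotZl /dot (bigD1 i)//= mxE !eqxx mul1r big1 ?addr0// => j ji.
  by rewrite mxE eqxx (negbTE ji) mul0r.
under eq_integral do rewrite e.
rewrite gaussian_mgf norm2Z exprMn real_normK ?num_real//.
suff -> : (norm2 (delta_mx 0 i : 'rV[R]_n) ^+ 2 = 1)%R by [].
rewrite norm2_rowE (bigD1 i)//= mxE !eqxx expr1n big1 ?addr0// => j ji.
by rewrite mxE eqxx (negbTE ji) expr0n.
Qed.

Lemma gaussian_norm2_sqr : \int[N]_x (norm2 x ^+ 2)%:E <= n%:R%:E.
Proof.
have := integral_norm2_sqr_le (X := id) (@measurable_id _ _ setT) ler01 gaussian_coord_mgf.
by rewrite mulr1.
Qed.

Lemma gaussian_norm2_expr8 : \int[N]_x (norm2 x ^+ 8)%:E <= (moment8_bound n (1 : R))%:E.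
Proof. exact: (integral_norm2_expr8_le (X := id) (@measurable_id _ _ setT) gaussian_coord_mgf). Qed.

(* Integrating first in x and substituting w = (a x + b y) / c, the product
   density becomes that of two independent standard Gaussians in w and in
   (c y - b w) / a. *)
Lemma gaussian_add (a b c : R) (F : 'rV[R]_n -> \bar R) :
  (0 < a)%R -> (0 < c)%R -> (c ^+ 2 = a ^+ 2 + b ^+ 2)%R ->
  measurable_fun setT F -> (forall x, 0 <= F x) ->
  \int[N]_y \int[N]_x F (a *: x + b *: y)%R = \int[N]_x F (c *: x)%R.
Proof.
move=> a0 c0 cE mF F0.
(* [x = q w + q' y] inverts the substitution: [a x + b y = c w]. *)
pose q := (c / a)%R; pose q' := (- (b / a))%R.
have q0 : (q != 0)%R by rewrite /q mulf_neq0 ?invr_eq0 ?gt_eqF.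
pose K : R := (`|q| ^+ n)%R.
have K0 : (0 <= K)%R by rewrite exprn_ge0.
pose J z : \bar R := (K * phi (q *: z.1 + q' *: z.2)%R * phi z.2)%:E * F (c *: z.1)%R.
have mlin (s t : R) : measurable_fun setT
    (fun z : 'rV[R]_n * 'rV[R]_n => s *: z.1 + t *: z.2)%R.
  by apply: measurable_rVD; apply: measurable_rVZc;
    [exact: measurable_fst|exact: measurable_snd].
have mJ : measurable_fun setT J.
  apply: emeasurable_funM.
    apply/measurable_EFinP; apply: measurable_funM.
      apply: measurable_funM => //.
      exact: (measurableT_comp measurable_phi (mlin q q')).
    exact: (measurableT_comp measurable_phi measurable_snd).
  by apply: (measurableT_comp mF); apply: measurable_rVZc; exact: measurable_fst.
have J0 z : 0 <= J z by rewrite /J mule_ge0// lee_fin !mulr_ge0.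
have mFab : measurable_fun setT
    (fun z : 'rV[R]_n * 'rV[R]_n => F (a *: z.1 + b *: z.2)%R).
  exact: (measurableT_comp mF (mlin a b)).
rewrite integral_gaussianE; last 2 first.
- exact: (measurable_fun_fubini_tonelli_G (m1 := N) _ mFab (fun z => F0 _)).
- by move=> y; exact: integral_ge0.
transitivity (\int[lebesgue_rV n]_y \int[lebesgue_rV n]_w J (w, y)).
  apply: eq_integral => y _.
  have mFy : measurable_fun setT (fun x : 'rV[R]_n => F (a *: x + b *: y)%R).
    exact: (measurableT_comp mF (measurable_rV_affine a (b *: y))).
  rewrite integral_gaussianE//.
  rewrite -(integral_lebesgue_rV_affine (q' *: y)
    (F := fun x => F (a *: x + b *: y)%R * (phi x)%:E) q0); last 2 first.
  - exact: mulphi.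
  - by move=> x; rewrite mule_ge0// lee_fin.
  rewrite -/K muleAC -ge0_integralZl//; last 3 first.
  - apply: (measurableT_comp (mulphi mFy)).
    exact: measurable_rV_affine.
  - by move=> x _; rewrite mule_ge0// lee_fin.
  - by rewrite -EFinM lee_fin mulr_ge0.
  apply: eq_integral => w _; rewrite /J/=.
  have -> : (a *: (q *: w + q' *: y) + b *: y = c *: w)%R.
    rewrite scalerDr !scalerA -addrA -scalerDl /q /q'.
    have -> : (a * - (b / a) + b = 0)%R by field; rewrite gt_eqF.
    by rewrite scale0r addr0; congr (_ *: _)%R; field; rewrite gt_eqF.
  rewrite [F _ * _]muleC muleA; congr (_ * _).
  by rewrite -!EFinM; congr EFin; rewrite mulrAC.
rewrite -(fubini_tonelli J)//.
rewrite integral_gaussianE//; last first.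
  by apply: (measurableT_comp mF); apply: measurable_rVZc; exact: measurable_id.
apply: eq_integral => w _.
(* Since [q'^2 + 1 = q^2], the exponent [|q w + q' y|^2 + |y|^2] is symmetric in [w] and [y]. *)
have swap y : (phi (q *: w + q' *: y) * phi y = phi w * phi (q *: y + q' *: w))%R.
  rewrite /phi /std_normal_pdf.
  rewrite [LHS]mulrACA [RHS]mulrACA; congr (_ * _)%R; rewrite -!expRD; congr expR.
  rewrite !norm2_sqrD !norm2Z !exprMn !real_normK ?num_real// !dotZl !dotZr (dotC y w).
  have -> : (q' ^+ 2 = q ^+ 2 - 1)%R.
    rewrite /q /q'; have -> : (b = Num.sg b * `|b|)%R by rewrite -numEsg.
    rewrite sqrrN !exprMn exprVn cE; rewrite -!exprMn -numEsg.
    by field; rewrite gt_eqF.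
  by field.
have e y : J (w, y) = (F (c *: w)%R * (phi w)%:E) * (K * phi (q *: y + q' *: w)%R)%:E.
  rewrite /J /= muleC -[RHS]muleA -EFinM; congr (_ * _%:E).
  by rewrite -mulrA swap mulrCA.
have mphi_aff : measurable_fun setT (fun y : 'rV[R]_n => phi (q *: y + q' *: w)%R).
  exact: (measurableT_comp measurable_phi (measurable_rV_affine _ _)).
under eq_integral do rewrite e.
rewrite ge0_integralZl//; last 3 first.
- by apply/measurable_EFinP; exact: measurable_funM.
- by move=> y _; rewrite lee_fin mulr_ge0.
- by rewrite mule_ge0// lee_fin.
rewrite integral_EFinZ// (integral_lebesgue_rV_affine (q' *: w) (F := fun x => (phi x)%:E) q0)//.
  transitivity ((F (c *: w)%R * (phi w)%:E) * \int[N]_x 1).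
    rewrite integral_gaussianE//; congr (_ * _).
    by under [RHS]eq_integral do rewrite mul1e.
  by rewrite integral_cst1 mule1.
exact/measurable_EFinP.
Qed.

End standard_gaussian.

(** * The target law and its Metropolis kernel *)

Section target_law.
Context {R : realType} {n : nat}.
Local Open Scope ereal_scope.
Variables (m M : R) (f : 'rV[R]_n -> R) (g : 'rV[R]_n -> 'rV[R]_n).
Hypotheses (m0 : (0 < m)%R) (mM : (m < M)%R).
Hypothesis fconv : forall x y,
  (m / 2 * norm2 (x - y) ^+ 2 <= f x - f y - dot (g y) (x - y))%R.
Hypothesis glip : forall x y, (norm2 (g x - g y) <= M * norm2 (x - y))%R.
Hypotheses (mf : measurable_fun setT f) (mg : measurable_fun setT g).
Variables (pi_ : probability 'rV[R]_n R) (c : R).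
Hypothesis piE : forall A, measurable A ->
  pi_ A = \int[lebesgue_rV n]_(x in A) (c * expR (- f x))%:E.

(** Proportionality leaves the sign of [c] open; a negative one would make the total mass
    nonpositive instead of 1. *)
Lemma density_constant_ge0 : (0 <= c)%R.
Proof.
rewrite leNgt; apply/negP => c0.
have := piE measurableT; rewrite probability_setT.
have -> : \int[lebesgue_rV n]_(x in setT) (c * expR (- f x))%:E =
          - \int[lebesgue_rV n]_x (- c * expR (- f x))%:E.
  rewrite -integral_ge0N; last first.
    by move=> x _; rewrite lee_fin mulr_ge0 ?expR_ge0// oppr_ge0 ltW.
  by apply: eq_integral => x _; rewrite -EFinN mulNr opprK.
move=> h; have : 0 <= \int[lebesgue_rV n]_x (- c * expR (- f x))%:E.
  by apply: integral_EFin_ge0 => x; rewrite mulr_ge0 ?expR_ge0// oppr_ge0 ltW.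
rewrite -oppe_le0 -h.
by rewrite lee_fin ler10.
Qed.

Let k (x : 'rV[R]_n) : R := (c * expR (- f x))%R.

Let mk : measurable_fun setT k.
Proof.
by apply: measurable_funM => //; apply: measurableT_comp => //; exact: measurableT_comp.
Qed.

Let k0 x : (0 <= k x)%R.
Proof. by rewrite mulr_ge0 ?expR_ge0// density_constant_ge0. Qed.

Lemma integral_targetE (F : 'rV[R]_n -> \bar R) :
  measurable_fun setT F -> (forall x, 0 <= F x) ->
  \int[pi_]_x F x = \int[lebesgue_rV n]_x (F x * (k x)%:E).
Proof. by move=> mF F0; apply: integral_density. Qed.

(* Translating the density by v costs at most exp(-g.v + M|v|^2/2), by the
   descent lemma: hence no integration by parts is needed. *)
Lemma target_grad_subgaussian (v : 'rV[R]_n) :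
  \int[pi_]_x (expR (- dot (g x) v))%:E <= (expR (M / 2 * norm2 v ^+ 2))%:E.
Proof.
have me : measurable_fun setT (fun x => expR (- dot (g x) v)).
  by apply: measurableT_comp => //; apply: measurableT_comp => //; exact: measurable_dot.
have mkv : measurable_fun setT (fun x : 'rV[R]_n => k (x + v)%R).
  by apply: (measurableT_comp mk); apply: measurable_rVD => //; exact: measurable_id.
rewrite integral_targetE; last 2 first.
- exact/measurable_EFinP.
- by move=> x; rewrite lee_fin expR_ge0.
under eq_integral do rewrite -EFinM.
apply: (@le_trans _ _ (\int[lebesgue_rV n]_x (expR (M / 2 * norm2 v ^+ 2) * k (x + v)%R)%:E)).
  apply: le_integral_EFin => [|||x].
  - exact: measurable_funM.
  - exact: measurable_funM.
  - by move=> x; rewrite mulr_ge0 ?expR_ge0.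
  - rewrite /k ![(expR _ * (c * _))%R]mulrCA ler_wpM2l ?density_constant_ge0//.
    rewrite -!expRD ler_expR.
    by have := descent m0 mM fconv glip x v; lra.
rewrite integral_EFinZ ?expR_ge0//.
rewrite (integral_lebesgue_rV_shift v (F := fun x => (k x)%:E)); last 2 first.
- exact/measurable_EFinP.
- by move=> x; rewrite lee_fin.
by rewrite -piE// probability_setT mule1.
Qed.

Let M0 : (0 <= M)%R. Proof. exact: ltW (lt_trans m0 mM). Qed.

Let grad_coord_mgf i (t : R) :
  \int[pi_]_x (expR (t * g x 0%R i))%:E <= (expR (t ^+ 2 * M / 2))%:E.
Proof.
have e x : (t * g x 0 i = - dot (g x) ((- t) *: delta_mx 0 i))%R.
  rewrite dotZr mulNr opprK /dot (bigD1 i)//= mxE !eqxx mulr1 big1 ?addr0// => j ji.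
  by rewrite mxE eqxx (negbTE ji) mulr0.
under eq_integral do rewrite e.
apply: (le_trans (target_grad_subgaussian _)).
rewrite lee_fin ler_expR norm2Z exprMn real_normK ?num_real// sqrrN.
suff -> : (norm2 (delta_mx 0 i : 'rV[R]_n) ^+ 2 = 1)%R by lra.
rewrite norm2_rowE (bigD1 i)//= mxE !eqxx expr1n big1 ?addr0// => j ji.
by rewrite mxE eqxx (negbTE ji) expr0n.
Qed.

Lemma target_grad_sqr : \int[pi_]_x (norm2 (g x) ^+ 2)%:E <= (n%:R * M)%:E.
Proof. exact: (integral_norm2_sqr_le mg M0 grad_coord_mgf). Qed.

Lemma target_grad_expr8 : \int[pi_]_x (norm2 (g x) ^+ 8)%:E <= (moment8_bound n M)%:E.
Proof. exact: (integral_norm2_expr8_le mg grad_coord_mgf). Qed.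

(** The Metropolis ratio [min 1 (exp (f x - f (x + u)))]. With the maximum in the exponent, its
    product with the density is visibly symmetric in the two ends of the jump. *)
Definition acceptance (x u : 'rV[R]_n) : R := (expR (- Num.max 0 (f (x + u) - f x)))%R.

Lemma acceptance_ge0 x u : (0 <= acceptance x u)%R.
Proof. exact: expR_ge0. Qed.

Lemma acceptance_le1 x u : (acceptance x u <= 1)%R.
Proof. by rewrite -expR0 ler_expR oppr_le0 le_max lexx. Qed.

Lemma measurable_acceptance d (T : measurableType d) (X U : T -> 'rV[R]_n) :
  measurable_fun setT X -> measurable_fun setT U ->
  measurable_fun setT (fun t => acceptance (X t) (U t)).
Proof.
move=> mX mU; apply: measurableT_comp => //; apply: measurableT_comp => //.
apply: measurable_maxr => //; apply: measurable_funB.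
  by apply: (measurableT_comp mf); exact: measurable_rVD.
exact: (measurableT_comp mf).
Qed.

Variable N : probability 'rV[R]_n R.
Hypothesis NE : forall A, measurable A -> N A = std_normal A.

(* Detailed balance: the flow density c exp(- max (f x) (f (x + u))) is
   invariant under (x, u) |-> (x + u, - u). *)
Lemma metropolis_invariant (r : R) (F : 'rV[R]_n -> R) :
  measurable_fun setT F -> (forall x, (0 <= F x)%R) ->
  \int[pi_]_x \int[N]_z (acceptance x (r *: z) * F (x + r *: z)%R
     + (1 - acceptance x (r *: z)) * F x)%:E = \int[pi_]_x (F x)%:E.
Proof.
move=> mF F0.
pose V := 'rV[R]_n.
have m1 : measurable_fun setT (fun q : V * V => q.1) by exact: measurable_fst.
have m2 : measurable_fun setT (fun q : V * V => r *: q.2)%R.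
  by apply: measurable_rVZc; exact: measurable_snd.
have m12 : measurable_fun setT (fun q : V * V => q.1 + r *: q.2)%R by exact: measurable_rVD.
have mA : measurable_fun setT (fun q : V * V => acceptance q.1 (r *: q.2)).
  exact: measurable_acceptance.
pose H1 (q : V * V) := (acceptance q.1 (r *: q.2) * F (q.1 + r *: q.2))%R.
pose H2 (q : V * V) := (acceptance q.1 (r *: q.2) * F q.1)%R.
pose H3 (q : V * V) := ((1 - acceptance q.1 (r *: q.2)) * F q.1)%R.
have mH1 : measurable_fun setT H1.
  by apply: measurable_funM => //; exact: (measurableT_comp mF).
have mH2 : measurable_fun setT H2.
  by apply: measurable_funM => //; exact: (measurableT_comp mF).
have mH3 : measurable_fun setT H3.
  by apply: measurable_funM; [exact: measurable_funB|exact: (measurableT_comp mF)].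
have H10 q : (0 <= H1 q)%R by rewrite mulr_ge0// acceptance_ge0.
have H20 q : (0 <= H2 q)%R by rewrite mulr_ge0// acceptance_ge0.
have H30 q : (0 <= H3 q)%R by rewrite mulr_ge0// subr_ge0 acceptance_le1.
pose K (x u : V) : R := (c * expR (- Num.max (f x) (f (x + u))))%R.
have K0 x u : (0 <= K x u)%R by rewrite mulr_ge0 ?expR_ge0// density_constant_ge0.
have KE x u : (acceptance x u * k x = K x u)%R.
  rewrite /acceptance /k /K mulrCA -expRD; congr (_ * expR _)%R.
  by rewrite /Num.max; case: ifPn; case: ifPn; lra.
have Ksym x u : K (x - u)%R u = K x (- u)%R by rewrite /K subrK maxC.
have mK d (T : measurableType d) (X U : T -> V) : measurable_fun setT X ->
    measurable_fun setT U -> measurable_fun setT (fun t => K (X t) (U t)).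
  move=> mX mU; apply: measurable_funM => //; apply: measurableT_comp => //.
  apply: measurableT_comp => //; apply: measurable_maxr; apply: (measurableT_comp mf) => //.
  exact: measurable_rVD.
(* The proposal integral goes outside, so that [x] can be translated by a multiple of [z] at fixed
   [z]. *)
have tonelli (H : V * V -> R) : measurable_fun setT H -> (forall q, (0 <= H q)%R) ->
    \int[pi_]_x \int[N]_z (H (x, z))%:E =
    \int[N]_z \int[lebesgue_rV n]_x (H (x, z) * k x)%:E.
  move=> mH H0.
  have mH' : measurable_fun setT (fun q => (H q)%:E) by exact/measurable_EFinP.
  have mHk : measurable_fun setT (fun q : V * V => (H q * k q.1)%:E).
    apply/measurable_EFinP; apply: measurable_funM => //.
    exact: (measurableT_comp mk).
  rewrite integral_targetE; last 2 first.
  - exact: (measurable_fun_fubini_tonelli_F _ mH' (fun q => _)).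
  - by move=> x; apply: integral_EFin_ge0.
  transitivity (\int[lebesgue_rV n]_x \int[N]_z (H (x, z) * k x)%:E).
    apply: eq_integral => x _.
    under [RHS]eq_integral do rewrite mulrC.
    rewrite integral_EFinZ//; first by rewrite muleC.
    by apply: (measurableT_comp mH); exact: measurable_pair1.
  rewrite (fubini_tonelli (fun q => (H q * k q.1)%:E))//.
  by move=> q; rewrite lee_fin mulr_ge0.
(* [H1] weighs the accepted flow at its arrival point, [H2] at its departure point. Translating [x]
   by [- r z] exchanges the two, and reflecting [z] restores the proposal. *)
have sym : \int[pi_]_x \int[N]_z (H1 (x, z))%:E = \int[pi_]_x \int[N]_z (H2 (x, z))%:E.
  rewrite (tonelli H1 mH1 H10) (tonelli H2 mH2 H20).
  have mKF : measurable_fun setT (fun q : V * V => (K q.1 (r *: q.2) * F q.1)%R).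
    by apply: measurable_funM; [exact: mK|exact: (measurableT_comp mF)].
  pose G (z : V) := \int[lebesgue_rV n]_x (K x (r *: z) * F x)%:E.
  have mG : measurable_fun setT G.
    have mKF' : measurable_fun setT (fun q : V * V => (K q.1 (r *: q.2) * F q.1)%:E).
      exact/measurable_EFinP.
    apply: (measurable_fun_fubini_tonelli_G (m1 := lebesgue_rV n) _ mKF') => q.
    by rewrite lee_fin mulr_ge0.
  transitivity (\int[N]_z G z); last first.
    by apply: eq_integral => z _; apply: eq_integral => x _; rewrite -KE mulrAC.
  rewrite -(gaussian_opp NE mG); last first.
    by move=> z; apply: integral_EFin_ge0 => x; rewrite mulr_ge0.
  apply: eq_integral => z _.
  transitivity (\int[lebesgue_rV n]_x (K x (r *: z) * F (x + r *: z))%:E).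
    by apply: eq_integral => x _; rewrite -KE mulrAC.
  rewrite -(integral_lebesgue_rV_shift (- (r *: z))
    (F := fun x => (K x (r *: z) * F (x + r *: z))%:E)); last 2 first.
  - apply/measurable_EFinP; apply: measurable_funM.
      by apply: mK => //; exact: measurable_id.
    by apply: (measurableT_comp mF); apply: measurable_rVD => //; exact: measurable_id.
  - by move=> x; rewrite lee_fin mulr_ge0.
  by apply: eq_integral => x _; rewrite Ksym subrK scalerN.
have split (Ha Hb : V * V -> R) : measurable_fun setT Ha -> measurable_fun setT Hb ->
    (forall q, (0 <= Ha q)%R) -> (forall q, (0 <= Hb q)%R) ->
    \int[pi_]_x \int[N]_z (Ha (x, z) + Hb (x, z))%:E =
    \int[pi_]_x \int[N]_z (Ha (x, z))%:E + \int[pi_]_x \int[N]_z (Hb (x, z))%:E.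
  move=> ma mb a0 b0.
  have ma' : measurable_fun setT (fun q => (Ha q)%:E) by exact/measurable_EFinP.
  have mb' : measurable_fun setT (fun q => (Hb q)%:E) by exact/measurable_EFinP.
  have a0' q : 0 <= (Ha q)%:E by rewrite lee_fin.
  have b0' q : 0 <= (Hb q)%:E by rewrite lee_fin.
  rewrite -(ge0_integralD pi_ measurableT (fun x _ => integral_EFin_ge0 N (fun z => a0 (x, z)))
    (measurable_fun_fubini_tonelli_F _ ma' a0')
    (fun x _ => integral_EFin_ge0 N (fun z => b0 (x, z)))
    (measurable_fun_fubini_tonelli_F _ mb' b0')).
  apply: eq_integral => x _; rewrite -(integral_EFinD N (measurableT_comp ma (measurable_pair1 x))
    (measurableT_comp mb (measurable_pair1 x)) (fun z => a0 (x, z)) (fun z => b0 (x, z))).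
  by [].
rewrite (split H1 H3 mH1 mH3 H10 H30) sym -(split H2 H3 mH2 mH3 H20 H30).
apply: eq_integral => x _; rewrite -[RHS](integral_cst1 N).
by apply: eq_integral => z _; rewrite /H2 /H3/= -mulrDl addrC subrK mul1r.
Qed.

End target_law.

Lemma ler_exprn_1D {R : realDomainType} (s : R) (i k : nat) :
  0 <= s -> (i <= k)%N -> s ^+ i <= 1 + s ^+ k.
Proof.
move=> s0 ik; have [s1|s1] := leP s 1.
  by apply: (@le_trans _ _ 1); [exact: exprn_ile1|rewrite lerDl exprn_ge0].
by apply: (@le_trans _ _ (s ^+ k)); [rewrite ler_weXn2l// ltW|rewrite lerDr].
Qed.

(** * Mean-square effect of one Metropolis move *)

Section local_error.
Context {R : realType} {n : nat}.
Local Open Scope ereal_scope.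
Variables (m M : R) (f : 'rV[R]_n -> R) (g : 'rV[R]_n -> 'rV[R]_n).
Hypotheses (m0 : (0 < m)%R) (mM : (m < M)%R).
Hypothesis fconv : forall x y,
  (m / 2 * norm2 (x - y) ^+ 2 <= f x - f y - dot (g y) (x - y))%R.
Hypothesis glip : forall x y, (norm2 (g x - g y) <= M * norm2 (x - y))%R.
Hypotheses (mf : measurable_fun setT f) (mg : measurable_fun setT g).
Variable N : probability 'rV[R]_n R.
Hypothesis NE : forall A, measurable A -> N A = std_normal A.

Let M0 : (0 < M)%R. Proof. exact: lt_trans m0 mM. Qed.

Let rej (x u : 'rV[R]_n) : R := (1 - acceptance f x u)%R.

Let rej_ge0 x u : (0 <= rej x u)%R.
Proof. by rewrite subr_ge0 acceptance_le1. Qed.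

Local Open Scope ring_scope.

(** One dominating function for the powers 3, 4 and 5 of [norm2 z] that the expansion of the
    rejection probability produces. *)
Let Kerr (z : 'rV[R]_n) : R := (4 + M ^+ 2 + M) * (1 + norm2 z ^+ 8).

Let Kerr_ge0 z : 0 <= Kerr z.
Proof.
rewrite /Kerr mulr_ge0 ?addr_ge0 ?sqr_ge0 ?(ltW M0)//.
by rewrite exprn_ge0 ?norm2_ge0.
Qed.

(* 1 - exp(-D) = D + O(D^2), where D is the positive part of the increment of
   f, itself within O(|u|^2) of the positive part of g x . u. *)
Let rejection_expansion x u (w := norm2 u) (G := norm2 (g x)) :
  rej x u <= G * w + M / 2 * w ^+ 2 /\
  `|rej x u - Num.max 0 (dot (g x) u)| <=
    2 * G ^+ 2 * w ^+ 2 + M ^+ 2 / 2 * w ^+ 4 + M / 2 * w ^+ 2.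
Proof.
have lo := tangent_below m0 fconv x u; have hi := descent m0 mM fconv glip x u.
have cs := dot_le_norm2 (g x) u; rewrite -/G -/w in cs.
have w0 : 0 <= w by exact: norm2_ge0.
have G0 : 0 <= G by exact: norm2_ge0.
have Mw : 0 <= M / 2 * w ^+ 2 by rewrite mulr_ge0 ?sqr_ge0// divr_ge0// ltW.
rewrite /rej /acceptance; rewrite -/w in hi.
set D := Num.max 0 (f (x + u) - f x); set Q := Num.max 0 (dot (g x) u).
have D0 : 0 <= D by rewrite le_max lexx.
have DQ : Q <= D by rewrite ge_max D0/= le_max lo orbT.
have QD : D <= Q + M / 2 * w ^+ 2.
  rewrite ge_max addr_ge0//=; last by rewrite le_max lexx.
  by apply: (le_trans hi); rewrite lerD2r le_max lexx orbT.
have QG : Q <= G * w by rewrite ge_max mulr_ge0.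
have e1 : 1 - D <= expR (- D) by exact: expR_ge1Dx.
(* From [(1 - D + D^2) (1 + D) = 1 + D^3 >= 1] and [1 + D <= expR D]. *)
have e2 : expR (- D) <= 1 - D + D ^+ 2.
  rewrite expRN -(ler_pM2r (expR_gt0 D)) mulVf ?gt_eqF ?expR_gt0//.
  apply: (@le_trans _ _ ((1 - D + D ^+ 2) * (1 + D))).
    have -> : (1 - D + D ^+ 2) * (1 + D) = 1 + D ^+ 3 by ring.
    by rewrite lerDl exprn_ge0.
  rewrite ler_wpM2l ?expR_ge1Dx//; nra.
split; first lra.
have D2 : D ^+ 2 <= 2 * G ^+ 2 * w ^+ 2 + M ^+ 2 / 2 * w ^+ 4.
  apply: (@le_trans _ _ ((G * w + M / 2 * w ^+ 2) ^+ 2)).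
    by rewrite ler_sqr ?nnegrE//; lra.
  rewrite -subr_ge0.
  have -> : 2 * G ^+ 2 * w ^+ 2 + M ^+ 2 / 2 * w ^+ 4 - (G * w + M / 2 * w ^+ 2) ^+ 2 =
    (G * w - M / 2 * w ^+ 2) ^+ 2 by field.
  exact: sqr_ge0.
by rewrite ler_norml; apply/andP; split; lra.
Qed.

(** These are the two ways in which a rejection enters the mean square: its probability against
    [|u|^2], and its deviation from the linear regime against [|u|]. Both are of order [r^3];
    [r <= 1] absorbs the higher powers. *)
Let rejection_bounds x z (r : R) : 0 <= r <= 1 ->
  rej x (r *: z) * norm2 (r *: z) ^+ 2 <= r ^+ 3 * (1 + norm2 (g x) ^+ 2) * Kerr z /\
  `|rej x (r *: z) - Num.max 0 (dot (g x) (r *: z))| * norm2 (r *: z) <=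
    r ^+ 3 * (1 + norm2 (g x) ^+ 2) * Kerr z.
Proof.
move=> /andP[r0 r1].
have [] := rejection_expansion x (r *: z); rewrite norm2Z ger0_norm//.
set s := norm2 z; set G := norm2 (g x) => b1 b2.
have s0 : 0 <= s by exact: norm2_ge0.
have G0 : 0 <= G by exact: norm2_ge0.
have r3 : 0 <= r ^+ 3 by rewrite exprn_ge0.
have S3 := @ler_exprn_1D _ s 3 8 s0 isT; have S4 := @ler_exprn_1D _ s 4 8 s0 isT.
have S5 := @ler_exprn_1D _ s 5 8 s0 isT.
have S : 0 <= 1 + s ^+ 8 by rewrite addr_ge0// exprn_ge0.
have M0' := ltW M0.
have G1 : G <= 1 + G ^+ 2 by nra.
have G2 : 1 <= 1 + G ^+ 2 by rewrite lerDl sqr_ge0.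
rewrite /Kerr -/s; set E := 1 + s ^+ 8 in S S3 S4 S5 *.
have rk (k : nat) : r ^+ (3 + k) <= r ^+ 3.
  by rewrite exprD ler_piMr// exprn_ile1.
have GE : 0 <= (1 + G ^+ 2) * E by rewrite mulr_ge0// addr_ge0// sqr_ge0.
have E_le : E <= (1 + G ^+ 2) * E by rewrite ler_peMl.
split.
  apply: (@le_trans _ _ ((G * (r * s) + M / 2 * (r * s) ^+ 2) * (r * s) ^+ 2)).
    by rewrite ler_wpM2r ?sqr_ge0.
  have -> : (G * (r * s) + M / 2 * (r * s) ^+ 2) * (r * s) ^+ 2 =
    r ^+ 3 * (G * s ^+ 3) + M / 2 * (r ^+ (3 + 1) * s ^+ 4) by ring.
  have h1 : G * s ^+ 3 <= (1 + G ^+ 2) * E by rewrite ler_pM// exprn_ge0.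
  have h2 : r ^+ (3 + 1) * s ^+ 4 <= r ^+ 3 * ((1 + G ^+ 2) * E).
    by rewrite ler_pM ?exprn_ge0// (le_trans S4).
  apply: (@le_trans _ _ ((1 + M / 2) * (r ^+ 3 * ((1 + G ^+ 2) * E)))).
    rewrite mulrDl mul1r lerD ?ler_wpM2l// divr_ge0//.
  have -> : r ^+ 3 * (1 + G ^+ 2) * ((4 + M ^+ 2 + M) * E) =
    (4 + M ^+ 2 + M) * (r ^+ 3 * ((1 + G ^+ 2) * E)) by ring.
  by rewrite ler_wpM2r ?mulr_ge0//; have := sqr_ge0 M; lra.
apply: (@le_trans _ _ ((2 * G ^+ 2 * (r * s) ^+ 2 + M ^+ 2 / 2 * (r * s) ^+ 4
    + M / 2 * (r * s) ^+ 2) * (r * s))).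
  by rewrite ler_wpM2r ?mulr_ge0.
have -> : (2 * G ^+ 2 * (r * s) ^+ 2 + M ^+ 2 / 2 * (r * s) ^+ 4
    + M / 2 * (r * s) ^+ 2) * (r * s) =
    2 * (r ^+ 3 * (G ^+ 2 * s ^+ 3)) + M ^+ 2 / 2 * (r ^+ (3 + 2) * s ^+ 5)
    + M / 2 * (r ^+ 3 * s ^+ 3) by ring.
have h1 : r ^+ 3 * (G ^+ 2 * s ^+ 3) <= r ^+ 3 * ((1 + G ^+ 2) * E).
  by rewrite ler_wpM2l// ler_pM ?exprn_ge0// lerDr.
have h2 : r ^+ (3 + 2) * s ^+ 5 <= r ^+ 3 * ((1 + G ^+ 2) * E).
  by rewrite ler_pM ?exprn_ge0// (le_trans S5).
have h3 : r ^+ 3 * s ^+ 3 <= r ^+ 3 * ((1 + G ^+ 2) * E).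
  by rewrite ler_wpM2l// (le_trans S3).
apply: (@le_trans _ _ ((2 + M ^+ 2 / 2 + M / 2) * (r ^+ 3 * ((1 + G ^+ 2) * E)))).
  have MM : 0 <= M ^+ 2 / 2 by rewrite divr_ge0// sqr_ge0.
  have M2 : 0 <= M / 2 by rewrite divr_ge0.
  move: h1 h2 h3; set Y := r ^+ 3 * (_ * E) => h1 h2 h3.
  rewrite (mulrDl (2 + M ^+ 2 / 2)) (mulrDl 2); by apply: lerD; [apply: lerD|]; apply: ler_wpM2l.
have -> : r ^+ 3 * (1 + G ^+ 2) * ((4 + M ^+ 2 + M) * E) =
    (4 + M ^+ 2 + M) * (r ^+ 3 * ((1 + G ^+ 2) * E)) by ring.
by rewrite ler_wpM2r ?mulr_ge0//; have := sqr_ge0 M; lra.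
Qed.

(** [A] stands for a position minus a sum of proposals: an accepted [u] enters both and leaves [A]
    unchanged, a rejected one enters the sum alone. [H] averages the new squared length over the
    coin. *)
Let H x (A : 'rV[R]_n) (u : 'rV[R]_n) : R :=
  acceptance f x u * norm2 A ^+ 2 + rej x u * norm2 (A - u) ^+ 2.

Let H_ge0 x A u : 0 <= H x A u.
Proof. by rewrite addr_ge0// mulr_ge0 ?sqr_ge0// acceptance_ge0. Qed.

(* Averaging over the signs of u turns the positive part of g x . u into the
   linear term; polarisation then keeps every integrand nonnegative. *)
Let H_symmetrised x A z (r : R) : 0 <= r <= 1 ->
  H x A (r *: z) + H x A (r *: (- z)) + (dot A (r *: z) ^+ 2 + dot (g x) (r *: z) ^+ 2) <=
  2 * norm2 A ^+ 2 + dot (A - g x) (r *: z) ^+ 2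
  + r ^+ 3 * (1 + norm2 (g x) ^+ 2) * (2 + 4 * norm2 A) * Kerr z.
Proof.
move=> r01.
have [p1 p2] := rejection_bounds x z r01.
have [q1 q2] := rejection_bounds x (- z) r01.
have KN : Kerr (- z) = Kerr z by rewrite /Kerr norm2N.
rewrite KN in q1 q2.
set B := r ^+ 3 * (1 + norm2 (g x) ^+ 2) * Kerr z in p1 p2 q1 q2.
rewrite (_ : _ * _ * Kerr z = (2 + 4 * norm2 A) * B); last by rewrite /B; ring.
set u := r *: z in p1 p2 *.
have uN : r *: (- z) = - u by rewrite scalerN.
rewrite uN !norm2N in q1 q2 *.
rewrite /H !norm2_sqrB !norm2N !dotNr dotBl.
have accE v : acceptance f x v = 1 - rej x v by rewrite /rej subKr.
rewrite !accE.
have cs := normr_dot_le A u.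
have A0 : 0 <= norm2 A by exact: norm2_ge0.
set a := rej x u in p1 p2 *; set a' := rej x (- u) in q1 q2 *.
set w := norm2 u in p1 p2 q1 q2 cs *.
rewrite dotNr in q2.
have w0 : 0 <= w by exact: norm2_ge0.
set t := dot (g x) u in p2 q2 *; set y := dot A u in cs *.
(* The positive parts at [u] and [- u] differ exactly by the linear term, so [a - a' - t] only
   carries the two expansion errors. *)
have maxE : Num.max 0 t - Num.max 0 (- t) = t.
  by rewrite /Num.max; case: ifPn; case: ifPn; lra.
have key : `|(a - a' - t) * y| <= 2 * norm2 A * B.
  rewrite normrM.
  apply: (@le_trans _ _ ((`|a - Num.max 0 t| + `|a' - Num.max 0 (- t)|) * (norm2 A * w))).
    apply: ler_pM => //; rewrite -{1}maxE.
    have -> : a - a' - (Num.max 0 t - Num.max 0 (- t)) =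
      (a - Num.max 0 t) - (a' - Num.max 0 (- t)) by ring.
    exact: ler_normB.
  have -> : (`|a - Num.max 0 t| + `|a' - Num.max 0 (- t)|) * (norm2 A * w) =
    norm2 A * (`|a - Num.max 0 t| * w + `|a' - Num.max 0 (- t)| * w) by ring.
  rewrite [leRHS](_ : _ = norm2 A * (B + B)); last by ring.
  by rewrite ler_wpM2l// lerD.
move: key; rewrite ler_norml => /andP[k1 k2].
rewrite -subr_ge0.
have -> : 2 * norm2 A ^+ 2 + (y - t) ^+ 2 + (2 + 4 * norm2 A) * B -
  ((1 - a) * norm2 A ^+ 2 + a * (norm2 A ^+ 2 - 2 * y + w ^+ 2) +
   ((1 - a') * norm2 A ^+ 2 + a' * (norm2 A ^+ 2 - 2 * - y + w ^+ 2)) + (y ^+ 2 + t ^+ 2)) =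
   (B - a * w ^+ 2) + (B - a' * w ^+ 2) + 2 * (2 * norm2 A * B + (a - a' - t) * y) by ring.
by move: p1 q1 k1; lra.
Qed.

Definition local_constant : R := (4 + M ^+ 2 + M) * (1 + moment8_bound n 1).

Lemma local_constant_ge0 : 0 <= local_constant.
Proof.
apply: mulr_ge0; first by rewrite !addr_ge0 ?sqr_ge0// ltW.
by apply: addr_ge0 => //; exact: moment8_bound_ge0.
Qed.

Local Open Scope ereal_scope.

(** The mean rejected proposal is [(r^2 / 2) g x] to leading order, half of the Gaussian mean of
    [(g x . u) u]. The error is split into a part inside the square and one outside, so that the
    former adds up linearly over the moves and the latter like a variance. *)
Lemma metropolis_local_error (x A : 'rV[R]_n) (r : R)
    (kap := (r ^+ 3 * (1 + norm2 (g x) ^+ 2) * local_constant)%R) : (0 <= r <= 1)%R ->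
  \int[N]_z (acceptance f x (r *: z) * norm2 A ^+ 2
    + (1 - acceptance f x (r *: z)) * norm2 (A - r *: z) ^+ 2)%:E <=
  ((norm2 (A - (r ^+ 2 / 2) *: g x) + kap) ^+ 2 + kap)%:E.
Proof.
move=> r01; have /andP[r0 r1] := r01.
have mrz : measurable_fun setT (fun z : 'rV[R]_n => r *: z)%R.
  by apply: measurable_rVZc; exact: measurable_id.
have mH : measurable_fun setT (fun z : 'rV[R]_n => H x A (r *: z)).
  have ma : measurable_fun setT (fun z : 'rV[R]_n => acceptance f x (r *: z)).
    exact: measurable_acceptance.
  apply: measurable_funD; apply: measurable_funM => //.
    exact: measurable_funB.
  by apply: measurable_funX; apply: measurable_norm2; exact: measurable_rVB.
have hs := fun z => H_symmetrised x A z r01.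
have h0 : forall z, (0 <= H x A (r *: z))%R by move=> z; exact: H_ge0.
pose h : 'rV[R]_n -> R := fun z => H x A (r *: z).
change (\int[N]_z (h z)%:E <=
  ((norm2 (A - (r ^+ 2 / 2) *: g x) + kap) ^+ 2 + kap)%:E).
have mh : measurable_fun setT h by exact: mH.
have {}h0 : forall z, (0 <= h z)%R by exact: h0.
have {}hs : forall z, (h z + h (- z) + (dot A (r *: z) ^+ 2 + dot (g x) (r *: z) ^+ 2) <=
  2 * norm2 A ^+ 2 + dot (A - g x) (r *: z) ^+ 2
  + r ^+ 3 * (1 + norm2 (g x) ^+ 2) * (2 + 4 * norm2 A) * Kerr z)%R by exact: hs.
clear mH; clearbody h.
have mhN : measurable_fun setT (fun z : 'rV[R]_n => h (- z)%R).
  by apply: (measurableT_comp mh); apply: measurable_rVN; exact: measurable_id.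
have mdot (v : 'rV[R]_n) : measurable_fun setT (fun z : 'rV[R]_n => dot v (r *: z)%R ^+ 2)%R.
  by apply: measurable_funX; exact: measurable_dot.
have mK : measurable_fun setT Kerr.
  apply: measurable_funM => //; apply: measurable_funD => //; apply: measurable_funX.
  by apply: measurable_norm2; exact: measurable_id.
have idot v : \int[N]_z (dot v (r *: z)%R ^+ 2)%:E = (r ^+ 2 * norm2 v ^+ 2)%:E.
  under eq_integral do rewrite dotZr exprMn.
  rewrite integral_EFinZ ?sqr_ge0//; last 2 first.
  - by apply: measurable_funX; apply: measurable_dot => //; exact: measurable_id.
  - by move=> z; exact: sqr_ge0.
  by rewrite gaussian_dot_sqr// -EFinM.
have iK : \int[N]_z (Kerr z)%:E <= local_constant%:E.
  have K0 : (0 <= 4 + M ^+ 2 + M)%R by rewrite !addr_ge0 ?sqr_ge0// ltW.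
  have mn8 : measurable_fun setT (fun z : 'rV[R]_n => norm2 z ^+ 8)%R.
    by apply: measurable_funX; apply: measurable_norm2; exact: measurable_id.
  have n80 (z : 'rV[R]_n) : (0 <= norm2 z ^+ 8)%R by rewrite exprn_ge0 ?norm2_ge0.
  rewrite integral_EFinZ//; last 2 first.
  - exact: measurable_funD.
  - by move=> z; rewrite addr_ge0.
  rewrite (EFinM (4 + M ^+ 2 + M)) lee_wpmul2l ?lee_fin//.
  rewrite integral_EFinD// integral_cst1 (EFinD 1%R) leeD2l//.
  exact: gaussian_norm2_expr8.
set c := (r ^+ 3 * (1 + norm2 (g x) ^+ 2) * (2 + 4 * norm2 A))%R.
have A0 : (0 <= norm2 A)%R by exact: norm2_ge0.
have c0 : (0 <= c)%R.
  by rewrite /c !mulr_ge0 ?exprn_ge0// addr_ge0 ?sqr_ge0// mulr_ge0.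
have big : \int[N]_z (h z + h (- z) +
      (dot A (r *: z) ^+ 2 + dot (g x) (r *: z) ^+ 2))%:E <=
    \int[N]_z (2 * norm2 A ^+ 2 + dot (A - g x) (r *: z) ^+ 2 + c * Kerr z)%:E.
  apply: le_integral_EFin => [|||z].
  - by apply: measurable_funD; exact: measurable_funD.
  - by apply: measurable_funD; [exact: measurable_funD|exact: measurable_funM].
  - by move=> z; rewrite (addr_ge0 (addr_ge0 (h0 z) (h0 _)) (addr_ge0 (sqr_ge0 _) (sqr_ge0 _))).
  - exact: hs.
set I := \int[N]_z (h z)%:E.
have I0 : 0 <= I by exact: integral_EFin_ge0.
have HNE : \int[N]_z (h (- z)%R)%:E = I.
  rewrite (gaussian_opp NE (F := fun z => (h z)%:E))//.
  exact/measurable_EFinP.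
have lhsE : \int[N]_z (h z + h (- z) +
      (dot A (r *: z) ^+ 2 + dot (g x) (r *: z) ^+ 2))%:E =
    I + I + (r ^+ 2 * norm2 A ^+ 2 + r ^+ 2 * norm2 (g x) ^+ 2)%:E.
  rewrite integral_EFinD; last 4 first.
  - exact: measurable_funD.
  - exact: measurable_funD.
  - by move=> z; exact: addr_ge0.
  - by move=> z; exact: (addr_ge0 (sqr_ge0 _) (sqr_ge0 _)).
  congr (_ + _).
    by rewrite integral_EFinD// HNE.
  by rewrite integral_EFinD ?idot// => z; exact: sqr_ge0.
have rhsE : \int[N]_z (2 * norm2 A ^+ 2 + dot (A - g x) (r *: z) ^+ 2 + c * Kerr z)%:E <=
    (2 * norm2 A ^+ 2 + r ^+ 2 * norm2 (A - g x) ^+ 2 + c * local_constant)%:E.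
  rewrite integral_EFinD; last 4 first.
  - exact: measurable_funD.
  - exact: measurable_funM.
  - by move=> z; exact: (addr_ge0 (mulr_ge0 (ler0n _ 2) (sqr_ge0 _)) (sqr_ge0 _)).
  - by move=> z; exact: mulr_ge0.
  rewrite integral_EFinD; last 4 first.
  - by [].
  - exact: mdot.
  - by move=> z; rewrite mulr_ge0 ?sqr_ge0.
  - by move=> z; exact: sqr_ge0.
  rewrite integral_cst1 idot (integral_EFinZ N mK Kerr_ge0 c0) -EFinD (EFinD (_ + _)) leeD2l//.
  by rewrite (EFinM c) lee_wpmul2l.
rewrite lhsE in big; have {big rhsE lhsE} := le_trans big rhsE.
have [->|Ioo] := eqVneq I +oo; first by rewrite !addye// leye_eq.
have Ifin : I \is a fin_num by rewrite ge0_fin_numE// ltey.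
rewrite -(fineK Ifin) -!EFinD !lee_fin; set i := fine I.
rewrite norm2_sqrB.
have kap0 : (0 <= kap)%R.
  apply: mulr_ge0; last exact: local_constant_ge0.
  by apply: mulr_ge0; [exact: exprn_ge0|exact: (addr_ge0 ler01 (sqr_ge0 _))].
have cE : (c * local_constant = 2 * kap + 4 * kap * norm2 A)%R by rewrite /c /kap; ring.
rewrite cE.
set B := norm2 (A - _); set G := norm2 (g x).
have B0 : (0 <= B)%R by exact: norm2_ge0.
have G0 : (0 <= G)%R by exact: norm2_ge0.
have AB : (norm2 A <= B + r ^+ 2 / 2 * G)%R.
  have := ler_norm2D (A - (r ^+ 2 / 2) *: g x) ((r ^+ 2 / 2) *: g x).
  by rewrite subrK norm2Z ger0_norm// divr_ge0// sqr_ge0.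
have B2 : (B ^+ 2 = norm2 A ^+ 2 - r ^+ 2 * dot A (g x) + (r ^+ 2 / 2) ^+ 2 * G ^+ 2)%R.
  rewrite /B norm2_sqrB norm2Z exprMn real_normK ?num_real// dotZr -/G.
  by field.
move: AB B2; set de := (r ^+ 2 / 2)%R; have -> : (r ^+ 2 = 2 * de)%R by rewrite /de; field.
move=> AB B2 hh.
(* Completing the square in [B] leaves [- de^2 G^2], which together with [kap^2] pays for the cross
   term [2 kap de G]. *)
have h1 : (kap * norm2 A <= kap * (B + de * G))%R by rewrite ler_wpM2l.
have h2 := sqr_ge0 (kap - de * G)%R.
by move: hh h1 h2 B2; nra.
Qed.

End local_error.

(** * The Metropolis chain *)

Section coin_extension.
Context {R : realType}.
Local Open Scope ereal_scope.

Let U : probability (measurableTypeR R) R := uniform_prob (@ltr01 R).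

Let U_below (a : R) : (0 <= a <= 1)%R -> U `]-oo, a]%classic = a%:E.
Proof.
move=> /andP[a0 a1]; transitivity (\int[U]_t (\1_`]-oo, a]%classic t)%:E).
  by rewrite integral_indic// setIT.
rewrite integral_uniform//; last first.
  by apply/measurable_EFinP; exact: measurable_indic.
rewrite subr0 invr1 mul1e integral_indic// setIC.
rewrite (_ : _ `&` _ = `[0%R, a]%classic).
  rewrite [LHS]lebesgue_measure_itv/= lte_fin.
  by case: ltgtP a0 => // [_ _|<- _]; rewrite ?oppr0 ?adde0// -EFinB subr0.
apply/seteqP; split => t /=; rewrite !in_itv/=.
  by move=> [/andP[-> _] ->].
by move=> /andP[t0 ta]; split=> //; rewrite t0 (le_trans ta).
Qed.

Let integral_coin (a x y : R) : (0 <= a <= 1)%R -> (0 <= x)%R -> (0 <= y)%R ->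
  \int[U]_t (if t <= a then x else y)%:E = (a * x + (1 - a) * y)%:E.
Proof.
move=> a01 x0 y0.
pose A := `]-oo, a]%classic : set R.
have mA : measurable A by exact: measurable_itv.
have e t : ((if t <= a then x else y) = x * \1_A t + y * \1_(~` A) t)%R.
  rewrite !indicE in_setC /A mem_setE /= in_itv/=.
  by case: ifP => _ /=; rewrite ?mulr1 ?mulr0 ?addr0 ?add0r.
under eq_integral do rewrite e.
have mI : measurable_fun setT (\1_A : measurableTypeR R -> R).
  exact: measurable_indic.
have mI' : measurable_fun setT (\1_(~` A) : measurableTypeR R -> R).
  by apply: measurable_indic; exact: measurableC.
have I0 (B : set R) t : (0 <= (\1_B t : R))%R by rewrite indicE.
have mxI : measurable_fun setT (fun t : measurableTypeR R => x * \1_A t)%R.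
  exact: measurable_funM.
have myI : measurable_fun setT (fun t : measurableTypeR R => y * \1_(~` A) t)%R.
  exact: measurable_funM.
rewrite (integral_EFinD U mxI myI (fun t => mulr_ge0 x0 (I0 _ t))
  (fun t => mulr_ge0 y0 (I0 _ t))).
have iA : \int[U]_t (\1_A t)%:E = a%:E.
  by transitivity (U A); [rewrite integral_indic// setIT|exact: U_below].
have iC : \int[U]_t (\1_(~` A) t)%:E = (1 - a)%:E.
  rewrite integral_indic ?setIT//; last exact: measurableC.
  by transitivity (1 - U A); [exact: probability_setC|rewrite [U A](@U_below a)].
rewrite (integral_EFinZ U mI (I0 A) x0) (integral_EFinZ U mI' (I0 _) y0) iA iC -!EFinM -EFinD.
by rewrite (mulrC x) (mulrC y).
Qed.

Context d1 d2 d3 (T1 : measurableType d1) (T2 : measurableType d2) (T3 : measurableType d3).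
Variables (P : probability T1 R) (N : probability T2 R).
Variables (a : T1 * T2 -> R) (Y1 Y2 : T1 * T2 -> T3).
Hypotheses (ma : measurable_fun setT a) (a01 : forall q, (0 <= a q <= 1)%R).
Hypotheses (mY1 : measurable_fun setT Y1) (mY2 : measurable_fun setT Y2).

(** An auxiliary uniform variable, compared with [a], chooses between [Y1] and [Y2]. Only the law of
    the outcome is kept, so the state space does not grow from move to move. *)
Lemma coin_extension : exists Q : probability T3 R, forall F : T3 -> R,
  measurable_fun setT F -> (forall x, (0 <= F x)%R) ->
  \int[Q]_x (F x)%:E =
  \int[P]_s \int[N]_z (a (s, z) * F (Y1 (s, z)) + (1 - a (s, z)) * F (Y2 (s, z)))%:E.
Proof.
pose PN : probability (T1 * T2)%type R := P \x N.
pose W : probability ((T1 * T2) * measurableTypeR R)%type R := PN \x U.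
pose h (w : (T1 * T2) * measurableTypeR R) := if (w.2 <= a w.1)%R then Y1 w.1 else Y2 w.1.
have mfst : measurable_fun setT (fun w : (T1 * T2) * measurableTypeR R => w.1) by exact: measurable_fst.
have mh : measurable_fun setT h.
  apply: measurable_fun_ifT.
  - apply: measurable_fun_ler; first exact: measurable_snd.
    exact: (measurableT_comp ma mfst).
  - exact: (measurableT_comp mY1 mfst).
  - exact: (measurableT_comp mY2 mfst).
exists (push_probability W mh) => F mF F0.
rewrite integral_push_probability; last 2 first.
- exact/measurable_EFinP.
- by move=> x; rewrite lee_fin.
have mFh : measurable_fun setT (fun w => (F (h w))%:E).
  by apply/measurable_EFinP; exact: (measurableT_comp mF).
rewrite (fubini_tonelli1 (fun w => (F (h w))%:E))//=; last first.
  by move=> w; rewrite lee_fin.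
transitivity (\int[PN]_q (a q * F (Y1 q) + (1 - a q) * F (Y2 q))%:E).
  apply: eq_integral => q _; rewrite /fubini_F /h /= -integral_coin//.
  by apply: eq_integral => t _; case: ifP.
rewrite (fubini_tonelli1 (fun q => (a q * F (Y1 q) + (1 - a q) * F (Y2 q))%:E))//.
  apply/measurable_EFinP; apply: measurable_funD; apply: measurable_funM => //.
  - exact: (measurableT_comp mF).
  - exact: measurable_funB.
  - exact: (measurableT_comp mF).
move=> q; have /andP[q0 q1] := a01 q.
by rewrite lee_fin addr_ge0// mulr_ge0// subr_ge0.
Qed.

End coin_extension.

(* Errors of nonzero mean accumulate linearly (S, q), centred ones in variance
   (T, C). *)
Lemma sqr_sqrt_step {R : realType} (S q T C : R) : 0 <= S -> 0 <= q -> 0 <= T -> 0 <= C ->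
  (S + Num.sqrt T + q) ^+ 2 + C <= (S + q + Num.sqrt (T + C)) ^+ 2.
Proof.
move=> S0 q0 T0 C0.
have h1 : Num.sqrt T ^+ 2 = T by rewrite sqr_sqrtr.
have h2 : Num.sqrt (T + C) ^+ 2 = T + C by rewrite sqr_sqrtr// addr_ge0.
have h3 : Num.sqrt T <= Num.sqrt (T + C) by rewrite ler_sqrt ?addr_ge0// lerDl.
have h4 := mulr_ge0 (addr_ge0 S0 q0) (_ : 0 <= Num.sqrt (T + C) - Num.sqrt T).
rewrite subr_ge0 in h4; have {}h4 := h4 h3.
nra.
Qed.

(** Agreement on indicators already identifies the law. The extended values let a kernel integral,
    not known to be finite, serve as test function. *)
Lemma integral_law_ereal {R : realType} d d' (T : measurableType d) (T' : measurableType d')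
    (P : probability T R) (Q : probability T' R) (h : T -> T') :
  measurable_fun setT h ->
  (forall F : T' -> R, measurable_fun setT F -> (forall x, 0 <= F x) ->
    (\int[P]_x (F (h x))%:E = \int[Q]_x (F x)%:E)%E) ->
  forall F : T' -> \bar R, measurable_fun setT F -> (forall x, (0 <= F x)%E) ->
    (\int[P]_x F (h x) = \int[Q]_x F x)%E.
Proof.
move=> mh PQ F mF F0; rewrite -(integral_push_probability P mh mF F0).
apply: eq_measure_integral => A mA _.
have m1 : measurable_fun setT (\1_A : T' -> R) by exact: measurable_indic.
have I0 x : 0 <= (\1_A : T' -> R) x by rewrite indicE.
have := PQ _ m1 I0.
rewrite -(integral_push_probability P mh (F := fun x => (\1_A x)%:E)).
- by rewrite !integral_indic// !setIT.
- exact/measurable_EFinP.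
- by move=> x; rewrite lee_fin.
Qed.

(** * The coupled chain and its accumulated errors *)

Section metropolis_chain.
Context {R : realType} {n : nat}.
Local Open Scope ereal_scope.
Notation V := 'rV[R]_n.
Variables (m M : R) (f : V -> R) (g : V -> V).
Hypotheses (m0 : (0 < m)%R) (mM : (m < M)%R).
Hypothesis fconv : forall x y,
  (m / 2 * norm2 (x - y) ^+ 2 <= f x - f y - dot (g y) (x - y))%R.
Hypothesis glip : forall x y, (norm2 (g x - g y) <= M * norm2 (x - y))%R.
Hypotheses (mf : measurable_fun setT f) (mg : measurable_fun setT g).
Variables (pi_ : probability V R) (c : R).
Hypothesis piE : forall A, measurable A ->
  pi_ A = \int[lebesgue_rV n]_(x in A) (c * expR (- f x))%:E.
Variable N : probability V R.
Hypothesis NE : forall A, measurable A -> N A = std_normal A.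
Variable rho : probability (V * V)%type R.
Hypothesis rho_snd : forall F : V -> R, measurable_fun setT F -> (forall x, (0 <= F x)%R) ->
  \int[rho]_q (F q.2)%:E = \int[pi_]_x (F x)%:E.
Variable r : R.
Hypotheses (r0 : (0 < r)%R) (r1 : (r <= 1)%R).

Let M0 : (0 < M)%R. Proof. exact: lt_trans m0 mM. Qed.

(* A state ((theta, x0), b, x) records the coupled starting points, the sum b
   of the Gaussian increments so far, and the position x of the Metropolis
   chain started at x0. *)
Notation St := ((V * V) * V * V)%type.

(** [r ^+ 3] times this bounds both the mean and the root mean square of [kap] under [pi_]:
    [(1 + G^2)^2 <= 4 + 2 G^8], and [4 + 2 mom >= 1] lets the same constant be squared. *)
Definition chain_constant : R :=
  (@local_constant R n M * (4 + 2 * moment8_bound n M))%R.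

Let K := chain_constant.
Let mom := moment8_bound n M.

Let mom0 : (0 <= mom)%R. Proof. exact: moment8_bound_ge0. Qed.

Let L0 : (0 <= @local_constant R n M)%R.
Proof. exact: local_constant_ge0 m0 mM. Qed.

Lemma chain_constant_ge0 : (0 <= K)%R.
Proof. by rewrite /K /chain_constant mulr_ge0// addr_ge0// mulr_ge0. Qed.

Let de : R := (r ^+ 2 / 2)%R.

Let de0 : (0 <= de)%R. Proof. by rewrite divr_ge0// sqr_ge0. Qed.

Let r30 : (0 <= r ^+ 3)%R. Proof. by rewrite exprn_ge0// ltW. Qed.

Definition chain_position_law (Lam : probability St R) := forall F : V -> R,
  measurable_fun setT F -> (forall x, (0 <= F x)%R) ->
  \int[Lam]_s (F s.2)%:E = \int[pi_]_x (F x)%:E.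

Let kap (x : V) : R := (r ^+ 3 * (1 + norm2 (g x) ^+ 2) * @local_constant R n M)%R.

Let mG8 : measurable_fun setT (fun x => norm2 (g x) ^+ 8)%R.
Proof. by apply: measurable_funX; exact: measurable_norm2. Qed.

Let mkap : measurable_fun setT kap.
Proof.
apply: measurable_funM => //; apply: measurable_funM => //; apply: measurable_funD => //.
by apply: measurable_funX; exact: measurable_norm2.
Qed.

Let kap0 x : (0 <= kap x)%R.
Proof.
apply: mulr_ge0 => //.
by apply: mulr_ge0; [exact: r30|exact: (addr_ge0 ler01 (sqr_ge0 _))].
Qed.

Let int8 : \int[pi_]_x (norm2 (g x) ^+ 8)%:E <= mom%:E.
Proof. exact: (target_grad_expr8 m0 mM fconv glip mf mg piE). Qed.

Let int_poly (a b : R) : (0 <= a)%R -> (0 <= b)%R ->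
  \int[pi_]_x (a + b * norm2 (g x) ^+ 8)%:E <= (a + b * mom)%:E.
Proof.
move=> a0 b0.
have G8 x : (0 <= norm2 (g x) ^+ 8)%R by rewrite exprn_ge0 ?norm2_ge0.
rewrite integral_EFinD//; last 2 first.
- exact: measurable_funM.
- by move=> x; rewrite mulr_ge0.
rewrite integral_cst1 integral_EFinZ// EFinD leeD2l// EFinM.
by rewrite lee_wpmul2l.
Qed.

Let int_kap : \int[pi_]_x (kap x)%:E <= (r ^+ 3 * K)%:E.
Proof.
pose B := (r ^+ 3 * @local_constant R n M)%R.
have B0 : (0 <= B)%R by rewrite /B mulr_ge0.
apply: (@le_trans _ _ (\int[pi_]_x (4 * B + 2 * B * norm2 (g x) ^+ 8)%:E)).
  apply: le_integral_EFin => [||//|x] //.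
    by apply: measurable_funD => //; exact: measurable_funM.
  have := @ler_exprn_1D _ (norm2 (g x)) 2 8 (norm2_ge0 _) isT => h.
  have h8 : (0 <= norm2 (g x) ^+ 8)%R by rewrite exprn_ge0 ?norm2_ge0.
  have -> : (kap x = B * (1 + norm2 (g x) ^+ 2))%R by rewrite /kap /B; ring.
  by nra.
apply: (le_trans (int_poly _ _)); do ?exact: mulr_ge0.
have -> : (4 * B + 2 * B * mom = r ^+ 3 * K)%R by rewrite /B /K /chain_constant -/mom; ring.
by [].
Qed.

Let int_kap2 : \int[pi_]_x (kap x ^+ 2)%:E <= ((r ^+ 3 * K) ^+ 2)%:E.
Proof.
pose B := (r ^+ 3 * @local_constant R n M)%R.
have B0 : (0 <= B)%R by rewrite /B mulr_ge0.
apply: (@le_trans _ _ (\int[pi_]_x (4 * B ^+ 2 + 2 * B ^+ 2 * norm2 (g x) ^+ 8)%:E)).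
  apply: le_integral_EFin => [|||x] //.
  - exact: measurable_funX.
  - by apply: measurable_funD => //; exact: measurable_funM.
  - by move=> x; exact: sqr_ge0.
  have := @ler_exprn_1D _ (norm2 (g x)) 4 8 (norm2_ge0 _) isT => h.
  have h8 : (0 <= norm2 (g x) ^+ 8)%R by rewrite exprn_ge0 ?norm2_ge0.
  have -> : (kap x ^+ 2 = B ^+ 2 * (1 + norm2 (g x) ^+ 2) ^+ 2)%R by rewrite /kap /B; ring.
  have -> : (4 * B ^+ 2 + 2 * B ^+ 2 * norm2 (g x) ^+ 8 =
    B ^+ 2 * (4 + 2 * norm2 (g x) ^+ 8))%R by ring.
  apply: ler_wpM2l; first exact: sqr_ge0.
  have h1 := sqr_ge0 (1 - norm2 (g x) ^+ 2)%R.
  by nra.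
apply: (le_trans (int_poly _ _)); do ?by apply: mulr_ge0 => //; exact: sqr_ge0.
have -> : (4 * B ^+ 2 + 2 * B ^+ 2 * mom = B ^+ 2 * (4 + 2 * mom))%R by ring.
have -> : (r ^+ 3 * K = B * (4 + 2 * mom))%R by rewrite /B /K /chain_constant -/mom; ring.
rewrite lee_fin (exprMn 2 B); apply: ler_wpM2l; first exact: sqr_ge0.
by move: mom0; nra.
Qed.

(** The pointwise error integrated over the current state: stationarity of the position turns the
    gradient-dependent [kap] into a constant. *)
Lemma chain_step_L2 (Lam : probability St R) (A : St -> V) (a : R) :
  measurable_fun setT A -> (0 <= a)%R -> chain_position_law Lam ->
  \int[Lam]_s (norm2 (A s - de *: g s.2) ^+ 2)%:E <= (a ^+ 2)%:E ->
  \int[Lam]_s \int[N]_z (acceptance f s.2 (r *: z) * norm2 (A s) ^+ 2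
    + (1 - acceptance f s.2 (r *: z)) * norm2 (A s - r *: z) ^+ 2)%:E <=
  ((a + r ^+ 3 * K) ^+ 2 + r ^+ 3 * K)%:E.
Proof.
move=> mA a0 J1 Aa.
have mx : measurable_fun setT (fun s : St => s.2) by exact: measurable_snd.
have mB : measurable_fun setT (fun s : St => norm2 (A s - de *: g s.2)).
  apply: measurable_norm2; apply: measurable_rVB => //; apply: measurable_rVZc.
  exact: (measurableT_comp mg).
have mkx : measurable_fun setT (fun s : St => kap s.2) by exact: (measurableT_comp mkap).
apply: (@le_trans _ _ (\int[Lam]_s ((norm2 (A s - de *: g s.2) + kap s.2) ^+ 2 + kap s.2)%:E)).
  apply: ge0_le_integral => //.
  - move=> s _; apply: integral_EFin_ge0 => z; apply: addr_ge0; apply: mulr_ge0; rewrite ?sqr_ge0//.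
      exact: acceptance_ge0.
    by rewrite subr_ge0 acceptance_le1.
  - have ma : measurable_fun setT (fun q : St * V => acceptance f q.1.2 (r *: q.2)).
      apply: measurable_acceptance => //.
        exact: (measurableT_comp mx measurable_fst).
      by apply: measurable_rVZc; exact: measurable_snd.
    have mA1 : measurable_fun setT (fun q : St * V => A q.1).
      exact: (measurableT_comp mA measurable_fst).
    have mH : measurable_fun setT (fun q : St * V =>
      (acceptance f q.1.2 (r *: q.2) * norm2 (A q.1) ^+ 2
    + (1 - acceptance f q.1.2 (r *: q.2)) * norm2 (A q.1 - r *: q.2) ^+ 2)%:E).
      apply/measurable_EFinP; apply: measurable_funD; apply: measurable_funM => //.
      - by apply: measurable_funX; exact: measurable_norm2.
      - exact: measurable_funB.
      - apply: measurable_funX; apply: measurable_norm2; apply: measurable_rVB => //.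
        by apply: measurable_rVZc; exact: measurable_snd.
    apply: (measurable_fun_fubini_tonelli_F _ mH) => q.
    rewrite lee_fin; apply: addr_ge0; apply: mulr_ge0; rewrite ?sqr_ge0//.
      exact: acceptance_ge0.
    by rewrite subr_ge0 acceptance_le1.
  - apply/measurable_EFinP; apply: measurable_funD => //; apply: measurable_funX.
    exact: measurable_funD.
  - move=> s _; apply: (metropolis_local_error m0 mM fconv glip mf NE).
    by rewrite (ltW r0) r1.
rewrite integral_EFinD//; last 2 first.
- by apply: measurable_funX; exact: measurable_funD.
- by move=> s; exact: sqr_ge0.
rewrite EFinD; apply: leeD.
  apply: L2_triangle => //; first by rewrite mulr_ge0// chain_constant_ge0.
  rewrite (J1 (fun x => kap x ^+ 2)%R).
  - exact: int_kap2.
  - exact: measurable_funX.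
  - by move=> x; exact: sqr_ge0.
by rewrite (J1 kap).
Qed.

Let q0 : (0 <= r ^+ 3 * K)%R. Proof. exact: mulr_ge0 r30 chain_constant_ge0. Qed.

(** What [sqr_sqrt_step] accumulates over [k] moves: linearly, [de] times the L^2 bound [sqrt (n M)]
    of the gradient plus an error; under the root, the variances. *)
Definition drift_bound (k : nat) : R :=
  (k%:R * (de * Num.sqrt (n%:R * M) + r ^+ 3 * K) + Num.sqrt (k%:R * (r ^+ 3 * K)))%R.

Definition displacement_bound (k : nat) : R :=
  (drift_bound k + Num.sqrt k%:R * r * Num.sqrt n%:R)%R.

(** At move [i] the gradient has changed since the start by at most [M] times the displacement, and
    this change acts during a time [de]. *)
Definition defect_bound (k : nat) : R :=
  (\sum_(i < k) (de * M * displacement_bound i + r ^+ 3 * K) + Num.sqrt (k%:R * (r ^+ 3 * K)))%R.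

Lemma drift_bound_ge0 k : (0 <= drift_bound k)%R.
Proof.
rewrite addr_ge0 ?sqrtr_ge0// mulr_ge0// addr_ge0// mulr_ge0 ?sqrtr_ge0//.
Qed.

Lemma displacement_bound_ge0 k : (0 <= displacement_bound k)%R.
Proof.
by rewrite addr_ge0 ?drift_bound_ge0// !mulr_ge0 ?sqrtr_ge0// ltW.
Qed.

Lemma defect_bound_ge0 k : (0 <= defect_bound k)%R.
Proof.
rewrite addr_ge0 ?sqrtr_ge0// sumr_ge0// => i _; rewrite addr_ge0//.
by apply: mulr_ge0; [apply: mulr_ge0 => //; exact: ltW|exact: displacement_bound_ge0].
Qed.

(* The drift is minus the sum of the rejected increments; the defect is its
   deviation from the drift - k de g x0 of one long step. *)
Let drift (s : St) : V := (s.2 - s.1.1.2 - s.1.2)%R.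

Let defect (k : nat) (s : St) : V := (drift s + (k%:R * de) *: g s.1.1.2)%R.

Let mth : measurable_fun setT (fun s : St => s.1.1).
Proof. exact: (measurableT_comp measurable_fst measurable_fst). Qed.
Let mx0 : measurable_fun setT (fun s : St => s.1.1.2).
Proof. exact: (measurableT_comp measurable_snd mth). Qed.
Let mb : measurable_fun setT (fun s : St => s.1.2).
Proof. exact: (measurableT_comp measurable_snd measurable_fst). Qed.
Let mx : measurable_fun setT (fun s : St => s.2).
Proof. exact: measurable_snd. Qed.

Let mdrift : measurable_fun setT drift.
Proof. by do 2 apply: measurable_rVB => //. Qed.

Let mdefect k : measurable_fun setT (defect k).
Proof.
by apply: measurable_rVD => //; apply: measurable_rVZc; exact: (measurableT_comp mg).
Qed.

(** The starting pair and the sum of proposals keep a product law, since acceptance affects only the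
    position. The position is left out because it depends on both. *)
Definition chain_start_law (k : nat) (Lam : probability St R) :=
  forall F : (V * V) * V -> R, measurable_fun setT F -> (forall x, (0 <= F x)%R) ->
  \int[Lam]_s (F s.1)%:E = \int[rho]_q \int[N]_z (F (q, (Num.sqrt k%:R * r) *: z)%R)%:E.

Definition chain_invariant (k : nat) (Lam : probability St R) :=
  [/\ chain_position_law Lam, chain_start_law k Lam,
      \int[Lam]_s (norm2 (drift s) ^+ 2)%:E <= (drift_bound k ^+ 2)%:E &
      \int[Lam]_s (norm2 (defect k s) ^+ 2)%:E <= (defect_bound k ^+ 2)%:E].

Let chain_init : exists Lam, chain_invariant 0 Lam.
Proof.
pose h (q : V * V) : St := (q, 0%R, q.2).
have mh : measurable_fun setT h.
  apply/measurable_fun_pair; last exact: measurable_snd.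
  by apply/measurable_fun_pair; [exact: measurable_id|exact: measurable_cst].
have intE (F : St -> R) : measurable_fun setT F -> (forall s, (0 <= F s)%R) ->
    \int[push_probability rho mh]_s (F s)%:E = \int[rho]_q (F (h q))%:E.
  move=> mF F0; rewrite integral_push_probability//; first exact/measurable_EFinP.
exists (push_probability rho mh); split.
- move=> F mF F0; rewrite (intE (fun s => F s.2))//; first exact: rho_snd.
  exact: (measurableT_comp mF).
- move=> F mF F0; rewrite (intE (fun s => F s.1))//; last first.
    exact: (measurableT_comp mF measurable_fst).
  apply: eq_integral => q _; rewrite sqrtr0 mul0r.
  by under eq_integral do rewrite scale0r; rewrite integral_cst1.
- rewrite (intE (fun s => norm2 (drift s) ^+ 2)%R); last 2 first.
  + by apply: measurable_funX; exact: measurable_norm2.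
  + by move=> s; exact: sqr_ge0.
  under eq_integral do rewrite /drift /= subrr subr0 norm2_0 expr0n/=.
  by rewrite integral_cst1 lee_fin sqr_ge0.
- rewrite (intE (fun s => norm2 (defect 0 s) ^+ 2)%R); last 2 first.
  + by apply: measurable_funX; exact: measurable_norm2.
  + by move=> s; exact: sqr_ge0.
  under eq_integral do rewrite /defect /drift /= subrr subr0 mul0r scale0r addr0 norm2_0 expr0n/=.
  by rewrite integral_cst1 lee_fin sqr_ge0.
Qed.

Let mnx : measurable_fun setT (fun s : St => norm2 (g s.2)).
Proof. by apply: measurable_norm2; exact: (measurableT_comp mg). Qed.

Let mnd : measurable_fun setT (fun s : St => norm2 (drift s)).
Proof. exact: measurable_norm2. Qed.

Let L2_pi_grad (Lam : probability St R) : chain_position_law Lam ->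
  \int[Lam]_s (norm2 (g s.2) ^+ 2)%:E <= (Num.sqrt (n%:R * M) ^+ 2)%:E.
Proof.
move=> J1; rewrite (J1 (fun x => norm2 (g x) ^+ 2)%R); last 2 first.
- by apply: measurable_funX; exact: measurable_norm2.
- by move=> x; exact: sqr_ge0.
rewrite sqr_sqrtr; last by rewrite mulr_ge0// ltW.
exact: (target_grad_sqr m0 mM fconv glip mf mg piE).
Qed.

Let L2_noise k (Lam : probability St R) : chain_start_law k Lam ->
  \int[Lam]_s (norm2 s.1.2 ^+ 2)%:E <= ((Num.sqrt k%:R * r * Num.sqrt n%:R) ^+ 2)%:E.
Proof.
move=> J2; rewrite (J2 (fun q => norm2 q.2 ^+ 2)%R); last 2 first.
- by apply: measurable_funX; apply: measurable_norm2; exact: measurable_snd.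
- by move=> x; exact: sqr_ge0.
set B := (_ ^+ 2)%R.
have nB : \int[N]_z (norm2 ((Num.sqrt k%:R * r) *: z)%R ^+ 2)%:E <= B%:E.
  under eq_integral do rewrite norm2Z exprMn real_normK ?num_real//.
  rewrite integral_EFinZ ?sqr_ge0//; last 2 first.
  - by apply: measurable_funX; apply: measurable_norm2; exact: measurable_id.
  - by move=> x; exact: sqr_ge0.
  rewrite /B (exprMn 2 (_ * r)%R) sqr_sqrtr// (EFinM (_ ^+ 2)).
  apply: lee_wpmul2l; first by rewrite lee_fin sqr_ge0.
  exact: gaussian_norm2_sqr.
apply: (le_trans _ nB); set C := \int[N]_z _.
have eC : \int[rho]_q C = C.
  transitivity (C * rho setT); last by rewrite probability_setT mule1.
  exact: (integral_cst rho measurableT C).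
by apply: (@le_trans _ _ (\int[rho]_q C)); [exact: lexx|rewrite eC].
Qed.

(** The clauses feed one another: the position law turns gradient terms into constants, the noise
    law and the drift bound control the displacement, and the displacement controls the growth of
    the defect. *)
Let chain_step k : (exists Lam, chain_invariant k Lam) ->
  exists Lam, chain_invariant k.+1 Lam.
Proof.
move=> [Lam [J1 J2 J3 J4]].
pose a (q : St * V) := acceptance f q.1.2 (r *: q.2).
(* Both outcomes add the proposal to the noise sum; only acceptance moves the chain. *)
pose Y1 (q : St * V) : St := (q.1.1.1, q.1.1.2 + r *: q.2, q.1.2 + r *: q.2)%R.
pose Y2 (q : St * V) : St := (q.1.1.1, q.1.1.2 + r *: q.2, q.1.2)%R.
have m1 : measurable_fun setT (fun q : St * V => q.1) by exact: measurable_fst.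
have m2 : measurable_fun setT (fun q : St * V => r *: q.2)%R.
  by apply: measurable_rVZc; exact: measurable_snd.
have mx' : measurable_fun setT (fun q : St * V => q.1.2) by exact: (measurableT_comp mx m1).
have mb' : measurable_fun setT (fun q : St * V => q.1.1.2) by exact: (measurableT_comp mb m1).
have mth' : measurable_fun setT (fun q : St * V => q.1.1.1) by exact: (measurableT_comp mth m1).
have ma : measurable_fun setT a by exact: measurable_acceptance.
have mY1 : measurable_fun setT Y1.
  by apply/measurable_fun_pair; [apply/measurable_fun_pair => //|]; exact: measurable_rVD.
have mY2 : measurable_fun setT Y2.
  by apply/measurable_fun_pair; [apply/measurable_fun_pair => //; exact: measurable_rVD|].
have a01 q : (0 <= a q <= 1)%R by rewrite acceptance_ge0 acceptance_le1.
have [Lam' intE] := coin_extension Lam N ma a01 mY1 mY2.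
have mix1 (x y : R) q : (x = y -> a q * x + (1 - a q) * y = x)%R.
  by move=> ->; rewrite -mulrDl addrC subrK mul1r.
have acc_drift s z : drift (Y1 (s, z)) = drift s.
  by rewrite /drift /=; apply/rowP => i; rewrite !mxE; ring.
have rej_drift s z : drift (Y2 (s, z)) = (drift s - r *: z)%R.
  by rewrite /drift /= opprD addrA.
exists Lam'; split.
- move=> F mF F0; rewrite (intE (fun s => F s.2))//; last exact: (measurableT_comp mF).
  rewrite -[RHS](metropolis_invariant mf piE NE r mF F0).
  pose H (x : V) := \int[N]_z (acceptance f x (r *: z) * F (x + r *: z)%R
     + (1 - acceptance f x (r *: z)) * F x)%:E.
  pose h (q : V * V) := (acceptance f q.1 (r *: q.2) * F (q.1 + r *: q.2)%R
     + (1 - acceptance f q.1 (r *: q.2)) * F q.1)%R.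
  have h0 q : (0 <= h q)%R.
    by rewrite addr_ge0// mulr_ge0 ?acceptance_ge0 ?subr_ge0 ?acceptance_le1.
  have mh : measurable_fun setT (fun q => (h q)%:E).
    have n1 : measurable_fun setT (fun q : V * V => q.1) by exact: measurable_fst.
    have n2 : measurable_fun setT (fun q : V * V => r *: q.2)%R.
      by apply: measurable_rVZc; exact: measurable_snd.
    have n3 : measurable_fun setT (fun q : V * V => acceptance f q.1 (r *: q.2)%R).
      exact: measurable_acceptance.
    apply/measurable_EFinP; apply: measurable_funD; apply: measurable_funM => //.
    - by apply: (measurableT_comp mF); exact: measurable_rVD.
    - exact: measurable_funB.
    - exact: (measurableT_comp mF).
  apply: (integral_law_ereal mx J1 (F := H)).
  + apply: (measurable_fun_fubini_tonelli_F _ mh) => q.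
    by rewrite lee_fin.
  + by move=> x; apply: integral_EFin_ge0 => z; exact: (h0 (x, z)).
- move=> F mF F0; rewrite (intE (fun s => F s.1))//; last first.
    exact: (measurableT_comp mF measurable_fst).
  pose G (q : (V * V) * V) := \int[N]_z (F (q.1, q.2 + r *: z)%R)%:E.
  have mG : measurable_fun setT G.
    have mFG : measurable_fun setT
        (fun w : ((V * V) * V) * V => (F (w.1.1, w.1.2 + r *: w.2)%R)%:E).
      apply/measurable_EFinP; apply: (measurableT_comp mF).
      apply/measurable_fun_pair; first exact: (measurableT_comp measurable_fst measurable_fst).
      apply: measurable_rVD; first exact: (measurableT_comp measurable_snd measurable_fst).
      by apply: measurable_rVZc; exact: measurable_snd.
    by apply: (measurable_fun_fubini_tonelli_F _ mFG) => q; rewrite lee_fin.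
  have G0 q : 0 <= G q by exact: integral_EFin_ge0.
  transitivity (\int[Lam]_s G s.1).
    apply: eq_integral => s _; apply: eq_integral => z _.
    by congr EFin; exact: mix1.
  pose spread (w : (V * V) * V) := (w.1, (Num.sqrt k%:R * r) *: w.2)%R.
  have mspread : measurable_fun setT spread.
    apply/measurable_fun_pair; first exact: measurable_fst.
    by apply: measurable_rVZc; exact: measurable_snd.
  pose RN : probability ((V * V) * V)%type R := rho \x N.
  have RNE (F' : (V * V) * V -> \bar R) : measurable_fun setT F' -> (forall x, 0 <= F' x) ->
      \int[push_probability RN mspread]_w F' w =
      \int[rho]_q \int[N]_z F' (q, (Num.sqrt k%:R * r) *: z)%R.
    move=> mF' F'0; rewrite integral_push_probability//.
    rewrite (fubini_tonelli1 (fun w => F' (spread w)))//.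
    exact: (measurableT_comp mF').
  rewrite (integral_law_ereal (Q := push_probability RN mspread) measurable_fst _ mG G0); last first.
    move=> F' mF' F'0; rewrite RNE; [exact: J2|exact/measurable_EFinP|].
    by move=> w; rewrite lee_fin.
  rewrite (RNE G mG G0); apply: eq_integral => q _.
  have mFq : measurable_fun setT (fun z => (F (q, z))%:E).
    by apply/measurable_EFinP; apply: (measurableT_comp mF); exact: measurable_pair1.
  have Fq0 z : 0 <= (F (q, z))%:E by rewrite lee_fin.
  have cE : ((Num.sqrt k.+1%:R * r) ^+ 2 = r ^+ 2 + (Num.sqrt k%:R * r) ^+ 2)%R.
    by rewrite !exprMn !sqr_sqrtr// -natr1; ring.
  (* At [k = 0] the coefficient of the earlier noise is 0, which [gaussian_add] admits for its
     second summand. *)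
  have c0 : (0 < Num.sqrt k.+1%:R * r)%R by rewrite mulr_gt0// sqrtr_gt0 ltr0n.
  rewrite -[RHS](gaussian_add NE r0 c0 cE mFq Fq0).
  by apply: eq_integral => y _; apply: eq_integral => z _; rewrite [(r *: z + _)%R]addrC.
- rewrite (intE (fun s => norm2 (drift s) ^+ 2)%R); last 2 first.
  + by apply: measurable_funX; exact: measurable_norm2.
  + by move=> s; exact: sqr_ge0.
  under eq_integral do under eq_integral do rewrite acc_drift rej_drift.
  apply: (le_trans (chain_step_L2
    (a := (drift_bound k + de * Num.sqrt (n%:R * M))%R) mdrift _ J1 _)).
  + by rewrite addr_ge0 ?drift_bound_ge0// mulr_ge0 ?sqrtr_ge0.
  + apply: (L2_mono (G := fun s => (norm2 (drift s) + de * norm2 (g s.2))%R)).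
    * by apply: measurable_norm2; apply: measurable_rVB => //; apply: measurable_rVZc;
        exact: (measurableT_comp mg).
    * by apply: measurable_funD => //; exact: measurable_funM.
    * move=> s; rewrite ger0_norm ?norm2_ge0//; apply: (le_trans (ler_norm2D _ _)).
      by rewrite norm2N norm2Z ger0_norm.
    * apply: L2_triangle => //.
      - exact: measurable_funM.
      - exact: drift_bound_ge0.
      - by rewrite mulr_ge0 ?sqrtr_ge0.
      - by apply: L2_scale => //; exact: L2_pi_grad.
  + rewrite lee_fin -/K /drift_bound.
    have S0 : (0 <= de * Num.sqrt (n%:R * M) + r ^+ 3 * K)%R.
      by rewrite addr_ge0// mulr_ge0 ?sqrtr_ge0.
    have := sqr_sqrt_step (mulr_ge0 (ler0n R k) S0) S0 (mulr_ge0 (ler0n R k) q0) q0.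
    set A := (de * _)%R; set B := (r ^+ 3 * K)%R.
    have -> : (k%:R * (A + B) + (A + B) = k.+1%:R * (A + B))%R by rewrite -natr1; ring.
    have -> : (k%:R * B + B = k.+1%:R * B)%R by rewrite -natr1; ring.
    by rewrite !addrA.
(* [A s - de g x] is the old defect plus [de (g x0 - g x)], whose norm is at most [de M] times the
   displacement. *)
- pose A (s : St) : V := (defect k s + de *: g s.1.1.2)%R.
  have mg0 : measurable_fun setT (fun s : St => g s.1.1.2) by exact: (measurableT_comp mg).
  have mA : measurable_fun setT A by apply: measurable_rVD => //; exact: measurable_rVZc.
  rewrite (intE (fun s => norm2 (defect k.+1 s) ^+ 2)%R); last 2 first.
  + by apply: measurable_funX; exact: measurable_norm2.
  + by move=> s; exact: sqr_ge0.
  have acc_defect s z : defect k.+1 (Y1 (s, z)) = A s.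
    by rewrite /defect acc_drift /A /defect -natr1 mulrDl mul1r scalerDl addrA.
  have rej_defect s z : defect k.+1 (Y2 (s, z)) = (A s - r *: z)%R.
    rewrite /defect rej_drift /A /defect -natr1 mulrDl mul1r scalerDl.
    by rewrite [LHS]addrAC !addrA.
  under eq_integral do under eq_integral do rewrite acc_defect rej_defect.
  have displ : \int[Lam]_s (norm2 (s.2 - s.1.1.2) ^+ 2)%:E <= (displacement_bound k ^+ 2)%:E.
    apply: (L2_mono (G := fun s => (norm2 (drift s) + norm2 s.1.2)%R)).
    - by apply: measurable_norm2; exact: measurable_rVB.
    - by apply: measurable_funD => //; exact: measurable_norm2.
    - move=> s; rewrite ger0_norm ?norm2_ge0//; apply: (le_trans _ (ler_norm2D _ _)).
      by rewrite /drift subrK.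
    - apply: L2_triangle => //.
      + exact: measurable_norm2.
      + exact: drift_bound_ge0.
      + by rewrite !mulr_ge0 ?sqrtr_ge0// ltW.
      + exact: L2_noise.
  apply: (le_trans (chain_step_L2
    (a := (defect_bound k + de * M * displacement_bound k)%R) mA _ J1 _)).
  + rewrite addr_ge0 ?defect_bound_ge0// mulr_ge0 ?displacement_bound_ge0// mulr_ge0//.
    exact: ltW.
  + apply: (L2_mono (G := fun s => (norm2 (defect k s) + de * M * norm2 (s.2 - s.1.1.2)%R)%R)).
    * apply: measurable_norm2; apply: measurable_rVB => //; apply: measurable_rVZc.
      exact: (measurableT_comp mg).
    * apply: measurable_funD; first exact: measurable_norm2.
      by apply: measurable_funM => //; apply: measurable_norm2; exact: measurable_rVB.
    * move=> s; rewrite ger0_norm ?norm2_ge0// /A -addrA -scalerBr.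
      apply: (le_trans (ler_norm2D _ _)); rewrite lerD2l norm2Z ger0_norm// -mulrA ler_wpM2l//.
      by rewrite -(norm2N (s.2 - _)) opprB; exact: glip.
    * apply: L2_triangle => //.
      - exact: measurable_norm2.
      - by apply: measurable_funM => //; apply: measurable_norm2; exact: measurable_rVB.
      - exact: defect_bound_ge0.
      - by rewrite mulr_ge0 ?displacement_bound_ge0// mulr_ge0// ltW.
      - by apply: L2_scale => //; apply: measurable_norm2; exact: measurable_rVB.
  + rewrite lee_fin -/K /defect_bound big_ord_recr /=.
    set B := (\sum_(i < k) _)%R.
    have D0 : (0 <= de * M * displacement_bound k)%R.
      by rewrite mulr_ge0 ?displacement_bound_ge0// mulr_ge0// ltW.
    have B0 : (0 <= B)%R.
      apply: sumr_ge0 => i _; rewrite addr_ge0//.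
      by rewrite mulr_ge0 ?displacement_bound_ge0// mulr_ge0// ltW.
    have := sqr_sqrt_step B0 (addr_ge0 D0 q0) (mulr_ge0 (ler0n R k) q0) q0.
    set C := (r ^+ 3 * K)%R.
    have -> : (k%:R * C + C = k.+1%:R * C)%R by rewrite -natr1; ring.
    by rewrite !addrA.
Qed.

Lemma exists_chain k : exists Lam, chain_invariant k Lam.
Proof. by elim: k => [|k IH]; [exact: chain_init|exact: chain_step]. Qed.

End metropolis_chain.

(** * One step of the algorithm *)

Section defect_limit.
Context {R : realType}.

Lemma sum_ord_le (N : nat) : \sum_(i < N) (i%:R : R) <= N%:R ^+ 2 / 2.
Proof.
elim: N => [|N IH]; first by rewrite big_ord0 expr0n/= mul0r.
by rewrite big_ord_recr/= -natr1; move: IH; lra.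
Qed.

(** A left Riemann sum of an increasing function lies below its integral; this is where the 2/3 of
    [step_error] arises. *)
Lemma sum_sqrt_le (N : nat) : \sum_(i < N) Num.sqrt (i%:R : R) <= 2 / 3 * (N%:R * Num.sqrt N%:R).
Proof.
elim: N => [|N IH]; first by rewrite big_ord0 mul0r mulr0.
rewrite big_ord_recr/=; apply: (le_trans (lerD IH (lexx _))).
set s := Num.sqrt (N%:R : R); set t := Num.sqrt (N.+1%:R : R).
have s0 : 0 <= s by exact: sqrtr_ge0.
have t0 : 0 <= t by exact: sqrtr_ge0.
have sE : N%:R = s ^+ 2 by rewrite sqr_sqrtr.
have tE : t ^+ 2 = s ^+ 2 + 1 by rewrite sqr_sqrtr// -natr1 sE.
rewrite -[N.+1%:R]natr1 sE.
have : s ^+ 3 + 3 / 2 * s <= (s ^+ 2 + 1) * t.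
  rewrite -ler_sqr ?nnegrE; last 2 first.
  - by rewrite addr_ge0 ?exprn_ge0// mulr_ge0.
  - by rewrite mulr_ge0// addr_ge0// sqr_ge0.
  by rewrite (exprMn 2 _ t) tE; have := sqr_ge0 s; nra.
by lra.
Qed.

Variables (n : nat) (M h : R).
Hypotheses (M0 : 0 < M) (h0 : 0 < h).
Hypothesis K0 : 0 <= @chain_constant R n M.

(** [M] times the integral over [0 <= s <= h] of [s sqrt (n M) + sqrt (2 s n)], the bound for the
    L^2 displacement at time [s]: drift plus noise. *)
Definition step_error : R :=
  M * Num.sqrt n%:R * (Num.sqrt M * (h ^+ 2 / 2) + 2 / 3 * (h * Num.sqrt (2 * h))).

Let K := @chain_constant R n M.

Lemma defect_bound_le (N : nat) (r : R) : 0 < r -> N%:R * (r ^+ 2 / 2) = h ->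
  @defect_bound R n M r N <=
  step_error + (h * M + 1) * (2 * h * r * K + Num.sqrt (2 * h * r * K)).
Proof.
move=> r0 Nr.
have Nr3 : N%:R * (r ^+ 3 * K) = 2 * h * r * K by rewrite -Nr; field.
have N0 : (0 : R) < N%:R.
  by rewrite ltr0n lt0n; apply/eqP => N0; move: Nr h0; rewrite N0 mul0r => <-; rewrite ltxx.
have sNr : Num.sqrt N%:R * r = Num.sqrt (2 * h).
  rewrite -[r in LHS]ger0_norm ?(ltW r0)// -sqrtr_sqr -sqrtrM//.
  by congr Num.sqrt; rewrite -Nr; field.
(* [tau] gathers the local errors of all [N] moves; since [N r^3 = 2 h r], it vanishes with [r]. *)
set tau := 2 * h * r * K + Num.sqrt (2 * h * r * K).
set de := r ^+ 2 / 2.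
have de0 : 0 <= de by rewrite divr_ge0// sqr_ge0.
have r3K : 0 <= r ^+ 3 * K by rewrite mulr_ge0// exprn_ge0// ltW.
have disp (i : 'I_N) : @displacement_bound R n M r i <=
    i%:R * (de * Num.sqrt (n%:R * M)) + tau + Num.sqrt i%:R * (r * Num.sqrt n%:R).
  have iN : i%:R <= (N%:R : R) by rewrite ler_nat ltnW.
  have d1 : i%:R * (r ^+ 3 * K) <= N%:R * (r ^+ 3 * K) by rewrite ler_wpM2r.
  have d2 : Num.sqrt (i%:R * (r ^+ 3 * K)) <= Num.sqrt (N%:R * (r ^+ 3 * K)).
    by rewrite ler_sqrt// mulr_ge0.
  rewrite /displacement_bound /drift_bound -/K -/de /tau -Nr3.
  by move: d1 d2; lra.
rewrite /defect_bound -/K -/de Nr3.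
have key : \sum_(i < N) (de * M * @displacement_bound R n M r i + r ^+ 3 * K) <=
   \sum_(i < N) (i%:R * (de ^+ 2 * M * Num.sqrt (n%:R * M)) + (de * M * tau + r ^+ 3 * K)
     + Num.sqrt i%:R * (de * M * r * Num.sqrt n%:R)).
  apply: ler_sum => i _.
  have := ler_wpM2l (mulr_ge0 de0 (ltW M0)) (disp i); rewrite -/de => d1.
  have -> : i%:R * (de ^+ 2 * M * Num.sqrt (n%:R * M)) + (de * M * tau + r ^+ 3 * K)
     + Num.sqrt i%:R * (de * M * r * Num.sqrt n%:R) =
     de * M * (i%:R * (de * Num.sqrt (n%:R * M)) + tau + Num.sqrt i%:R * (r * Num.sqrt n%:R))
     + r ^+ 3 * K by ring.
  by rewrite lerD2r.
move: key; set C0 := de * M * tau + r ^+ 3 * K => key.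
have C0E : C0 = de * M * tau + r ^+ 3 * K by [].
clearbody C0.
apply: (le_trans (lerD key (lexx _))).
rewrite !big_split/= -!mulr_suml sumr_const card_ord -(mulr_natl C0 N) C0E.
have a1 : (\sum_(i < N) i%:R) * (de ^+ 2 * M * Num.sqrt (n%:R * M)) <=
    N%:R ^+ 2 / 2 * (de ^+ 2 * M * Num.sqrt (n%:R * M)).
  rewrite ler_wpM2r ?sum_ord_le// mulr_ge0 ?sqrtr_ge0// mulr_ge0 ?sqr_ge0// ltW//.
have a2 : (\sum_(i < N) Num.sqrt i%:R) * (de * M * r * Num.sqrt n%:R) <=
    2 / 3 * (N%:R * Num.sqrt N%:R) * (de * M * r * Num.sqrt n%:R).
  rewrite ler_wpM2r ?sum_sqrt_le// mulr_ge0 ?sqrtr_ge0// mulr_ge0 ?(ltW r0)// mulr_ge0// ltW//.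
apply: (le_trans (lerD (lerD (lerD a1 (lexx _)) a2) (lexx _))).
have -> : N%:R ^+ 2 / 2 * (de ^+ 2 * M * Num.sqrt (n%:R * M)) =
    M * Num.sqrt n%:R * (Num.sqrt M * ((N%:R * de) ^+ 2 / 2)).
  by rewrite sqrtrM//; field.
have -> : 2 / 3 * (N%:R * Num.sqrt N%:R) * (de * M * r * Num.sqrt n%:R) =
    M * Num.sqrt n%:R * (2 / 3 * ((N%:R * de) * (Num.sqrt N%:R * r))) by field.
have -> : N%:R * (de * M * tau + r ^+ 3 * K) =
    (N%:R * de) * M * tau + N%:R * (r ^+ 3 * K) by ring.
rewrite Nr3 /de Nr sNr /step_error le_eqVlt; apply/orP; left; apply/eqP.
by rewrite /tau; ring.
Qed.

(** At fixed [h] the proposal variance is [2 h / N], so a large [N] makes every term carrying [K]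
    small. *)
Lemma exists_fine_step (e : R) : 0 < e -> exists N r,
  [/\ 0 < r, r <= 1, N%:R * (r ^+ 2 / 2) = h & @defect_bound R n M r N <= step_error + e].
Proof.
move=> e0.
have hM : 0 < h * M + 1 by rewrite addr_gt0// mulr_gt0.
(* With [y = 2 h r K], the aim is [sqrt y <= b]; as [b <= 1], also [y <= b], and the two together
   cost at most [2 b (h M + 1) <= e]. *)
pose b := Num.min 1 (e / (h * M + 1) / 2).
have b0 : 0 < b by rewrite lt_min ltr01/= !divr_gt0.
have hK : 0 <= 2 * h * K by apply: mulr_ge0 => //; apply: mulr_ge0 => //; exact: ltW.
pose rm := Num.min 1 (b ^+ 2 / (2 * h * K + 1)).
have rm0 : 0 < rm by rewrite lt_min ltr01/= divr_gt0 ?exprn_gt0// ltr_wpDl.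
pose N := (Num.truncn (2 * h / rm ^+ 2)).+1.
have NE : 2 * h / rm ^+ 2 < N%:R.
  have x0 : 0 <= 2 * h / rm ^+ 2 by rewrite divr_ge0 ?sqr_ge0// mulr_ge0// ltW.
  by have /andP[] := truncn_itv x0.
have N0 : (0 : R) < N%:R by rewrite ltr0n.
pose r := Num.sqrt (2 * h / N%:R).
have r2 : r ^+ 2 = 2 * h / N%:R by rewrite sqr_sqrtr// divr_ge0// mulr_ge0// ltW.
have r0 : 0 < r by rewrite sqrtr_gt0 divr_gt0// mulr_gt0.
have rrm : r <= rm.
  rewrite -ler_sqr ?nnegrE ?(ltW r0) ?(ltW rm0)// r2.
  by rewrite ler_pdivrMr// [_ ^+ 2 * _]mulrC -ler_pdivrMr ?exprn_gt0// ltW.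
exists N, r; split => //.
- by rewrite (le_trans rrm)// ge_min lexx.
- by rewrite r2; field; rewrite gt_eqF.
apply: (le_trans (defect_bound_le r0 _)); first by rewrite r2; field; rewrite gt_eqF.
rewrite lerD2l.
have y0 : 0 <= 2 * h * r * K by rewrite mulrAC mulr_ge0// ltW.
have yb : 2 * h * r * K <= b ^+ 2.
  have : r * (2 * h * K + 1) <= b ^+ 2.
    by rewrite -ler_pdivlMr ?ltr_wpDl// (le_trans rrm)// ge_min lexx orbT.
  by move: r0; lra.
have sb : Num.sqrt (2 * h * r * K) <= b.
  by rewrite -[leRHS]ger0_norm ?(ltW b0)// -sqrtr_sqr ler_sqrt// sqr_ge0.
have b1 : b <= 1 by rewrite ge_min lexx.
have be : b <= e / (h * M + 1) / 2 by rewrite ge_min lexx orbT.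
rewrite mulrC -ler_pdivlMr//.
have : b ^+ 2 <= b by rewrite expr2 ler_piMl// ltW.
by move: yb sb be; lra.
Qed.

End defect_limit.

(** * Couplings and the one-step bound for [W2] *)

Section wasserstein_step.
Context {R : realType} {n : nat}.
Local Open Scope ereal_scope.
Notation V := 'rV[R]_n.

Lemma integral_coupling_fst (mu nu : probability V R) rho (F : V -> \bar R) :
  coupling mu nu rho -> measurable_fun setT F -> (forall x, 0 <= F x) ->
  \int[rho]_q F q.1 = \int[mu]_x F x.
Proof.
move=> cpl mF F0; rewrite -(integral_push_probability rho measurable_fst mF F0).
apply: eq_measure_integral => A mA _.
have [e _] := cpl A mA; apply: (etrans _ e); apply: (congr1 rho).
by apply/seteqP; split => [q|q []].
Qed.

Lemma integral_coupling_snd (mu nu : probability V R) rho (F : V -> \bar R) :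
  coupling mu nu rho -> measurable_fun setT F -> (forall x, 0 <= F x) ->
  \int[rho]_q F q.2 = \int[nu]_x F x.
Proof.
move=> cpl mF F0; rewrite -(integral_push_probability rho measurable_snd mF F0).
apply: eq_measure_integral => A mA _.
have [_ e] := cpl A mA; apply: (etrans _ e); apply: (congr1 rho).
by apply/seteqP; split => [q|q []].
Qed.

Lemma W2_le_cost (mu nu : probability V R) rho (a : R) : coupling mu nu rho -> (0 <= a)%R ->
  \int[rho]_z (norm2 (z.1 - z.2) ^+ 2)%:E <= (a ^+ 2)%:E -> W2 mu nu <= a%:E.
Proof.
move=> cpl a0 cost.
have -> : a%:E = sqrte (a ^+ 2)%:E by rewrite /= sqrtr_sqr ger0_norm.
rewrite lee_sqrt; last by rewrite lee_fin sqr_ge0.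
by apply: (le_trans _ cost); apply: ereal_inf_lbound; exists rho.
Qed.

Lemma W2_ge0 (mu nu : probability V R) : 0 <= W2 mu nu.
Proof. exact: sqrte_ge0. Qed.

Lemma exists_near_optimal_coupling (mu nu : probability V R) (w : R) :
  W2 mu nu < w%:E -> exists2 rho, coupling mu nu rho &
    \int[rho]_z (norm2 (z.1 - z.2) ^+ 2)%:E <= (w ^+ 2)%:E.
Proof.
move=> h.
have w0 : (0 < w)%R by rewrite -lte_fin (le_lt_trans (W2_ge0 mu nu)).
set I := ereal_inf [set \int[rho]_z (norm2 (z.1 - z.2) ^+ 2)%:E | rho in coupling mu nu].
have I_lt : I < (w ^+ 2)%:E.
  rewrite ltNge; apply/negP => le; move: h; rewrite ltNge => /negP; apply.
  have -> : w%:E = sqrte (w ^+ 2)%:E by rewrite /= sqrtr_sqr gtr0_norm.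
  rewrite lee_sqrt//; apply: (le_trans _ le).
  by rewrite lee_fin sqr_ge0.
have [_ [rho cpl <-] lt] := ereal_inf_lt I_lt.
by exists rho => //; exact: ltW.
Qed.

Variables (m M : R) (f : V -> R) (g : V -> V).
Hypotheses (m0 : (0 < m)%R) (mM : (m < M)%R).
Hypothesis fconv : forall x y,
  (m / 2 * norm2 (x - y) ^+ 2 <= f x - f y - dot (g y) (x - y))%R.
Hypothesis glip : forall x y, (norm2 (g x - g y) <= M * norm2 (x - y))%R.
Hypotheses (mf : measurable_fun setT f) (mg : measurable_fun setT g).
Variables (pi_ : probability V R) (c : R).
Hypothesis piE : forall A, measurable A ->
  pi_ A = \int[lebesgue_rV n]_(x in A) (c * expR (- f x))%:E.
Variable N : probability V R.
Hypothesis NE : forall A, measurable A -> N A = std_normal A.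
Variables (h : R) (mu nu : probability V R).
Hypotheses (h0 : (0 < h)%R) (hle : (h * (m + M) <= 2)%R).
Hypothesis nuE : forall F : V -> R, measurable_fun setT F -> (forall x, (0 <= F x)%R) ->
  \int[nu]_x (F x)%:E =
  \int[mu]_x \int[N]_z (F (x - h *: g x + Num.sqrt (2 * h) *: z)%R)%:E.

Let M0 : (0 < M)%R. Proof. exact: lt_trans m0 mM. Qed.

Let mh1 : (0 <= 1 - m * h)%R.
Proof.
have : (h * m <= h * M)%R by rewrite ler_wpM2l// ltW.
by move: hle; rewrite mulrDr; lra.
Qed.

(** The Gaussian sum of the chain serves as the noise of the algorithm, so it drops out of the
    difference of the endpoints: what is left is a difference of two gradient steps minus the
    defect. *)
Lemma W2_step_coupled rho (w e : R) : coupling mu pi_ rho -> (0 <= w)%R -> (0 < e)%R ->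
  \int[rho]_z (norm2 (z.1 - z.2) ^+ 2)%:E <= (w ^+ 2)%:E ->
  W2 nu pi_ <= ((1 - m * h) * w + (step_error n M h + e))%:E.
Proof.
move=> cpl w0 e0 cost.
have K0 : (0 <= @chain_constant R n M)%R by exact: (chain_constant_ge0 m0 mM).
have [k [r [r0 r1 kr defect]]] := exists_fine_step M0 h0 K0 e0.
have rho_snd (F : V -> R) : measurable_fun setT F -> (forall x, (0 <= F x)%R) ->
    \int[rho]_q (F q.2)%:E = \int[pi_]_x (F x)%:E.
  move=> mF F0; apply: (integral_coupling_snd cpl (F := fun x => (F x)%:E)).
    exact/measurable_EFinP.
  by move=> x; rewrite lee_fin.
have [Lam [J1 J2 J3 J4]] := exists_chain m0 mM fconv glip mf mg piE NE rho_snd r0 r1 k.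
have krs : (Num.sqrt k%:R * r = Num.sqrt (2 * h))%R.
  rewrite -[r in LHS]ger0_norm ?(ltW r0)// -sqrtr_sqr -sqrtrM//.
  by congr Num.sqrt; rewrite -kr; field.
pose Y (t : (V * V) * V * V) : V * V := (t.1.1.1 - h *: g t.1.1.1 + t.1.2, t.2)%R.
have mth : measurable_fun setT (fun t : (V * V) * V * V => t.1.1.1).
  exact: (measurableT_comp measurable_fst (measurableT_comp measurable_fst measurable_fst)).
have mx0 : measurable_fun setT (fun t : (V * V) * V * V => t.1.1.2).
  exact: (measurableT_comp measurable_snd (measurableT_comp measurable_fst measurable_fst)).
have mb : measurable_fun setT (fun t : (V * V) * V * V => t.1.2).
  exact: (measurableT_comp measurable_snd measurable_fst).
have mx : measurable_fun setT (fun t : (V * V) * V * V => t.2) by exact: measurable_snd.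
have mgth : measurable_fun setT (fun t : (V * V) * V * V => h *: g t.1.1.1)%R.
  by apply: measurable_rVZc; exact: (measurableT_comp mg).
have mY : measurable_fun setT Y.
  by apply/measurable_fun_pair => //; apply: measurable_rVD => //; exact: measurable_rVB.
have step0 : (0 <= (1 - m * h) * w + (step_error n M h + e))%R.
  rewrite addr_ge0 ?mulr_ge0// addr_ge0 ?(ltW e0)// /step_error.
  rewrite mulr_ge0// ?mulr_ge0 ?sqrtr_ge0 ?(ltW M0)// addr_ge0//.
    by rewrite mulr_ge0 ?sqrtr_ge0// divr_ge0// sqr_ge0.
  by rewrite !mulr_ge0 ?sqrtr_ge0// ltW.
apply: (W2_le_cost (rho := push_probability Lam mY)) => //.
(* The first marginal is [nu] by the product law of start and noise, the second is [pi_] by the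
   position law. *)
- move=> A mA; split.
    pose F (q : (V * V) * V) : R := \1_A (q.1.1 - h *: g q.1.1 + q.2)%R.
    have F0 q : (0 <= F q)%R by rewrite /F indicE.
    have m1 : measurable_fun setT (\1_A : V -> R) by exact: measurable_indic.
    have mstep : measurable_fun setT (fun x : V => x - h *: g x)%R.
      by apply: measurable_rVB; [exact: measurable_id|exact: measurable_rVZc].
    have mF : measurable_fun setT F.
      apply: (measurableT_comp m1); apply: measurable_rVD; last exact: measurable_snd.
      exact: (measurableT_comp mstep (measurableT_comp measurable_fst measurable_fst)).
    transitivity (\int[Lam]_s (F s.1)%:E).
      transitivity (\int[push_probability Lam mY]_z (\1_(A `*` setT) z)%:E).
        by rewrite integral_indic ?setIT//; exact: measurableX.
      rewrite integral_push_probability; last 2 first.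
      + by apply/measurable_EFinP; apply: measurable_indic; exact: measurableX.
      + by move=> z; rewrite lee_fin indicE.
      apply: eq_integral => s _; rewrite /F !indicE /=; congr ((nat_of_bool _)%:R%:E).
      by apply/idP/idP; rewrite !inE; [case|split].
    rewrite (J2 F mF F0) krs.
    transitivity (\int[nu]_x (\1_A x)%:E); last by rewrite integral_indic// setIT.
    have I0 x : (0 <= (\1_A : V -> R) x)%R by rewrite indicE.
    rewrite (nuE m1 I0).
    rewrite -(integral_coupling_fst cpl (F := fun x =>
      \int[N]_z (\1_A (x - h *: g x + Num.sqrt (2 * h) *: z)%R)%:E))//.
    + have mG : measurable_fun setT (fun q : V * V =>
          (\1_A (q.1 - h *: g q.1 + Num.sqrt (2 * h) *: q.2)%R : R)%:E).
        apply/measurable_EFinP; apply: (measurableT_comp m1); apply: measurable_rVD.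
          exact: (measurableT_comp mstep measurable_fst).
        by apply: measurable_rVZc; exact: measurable_snd.
      apply: (measurable_fun_fubini_tonelli_F _ mG) => q.
      by rewrite lee_fin indicE.
    + by move=> x; apply: integral_EFin_ge0 => z; rewrite indicE.
  have m1 : measurable_fun setT (\1_A : V -> R) by exact: measurable_indic.
  transitivity (\int[Lam]_s (\1_A s.2)%:E).
    transitivity (\int[push_probability Lam mY]_z (\1_(setT `*` A) z)%:E).
      by rewrite integral_indic ?setIT//; exact: measurableX.
    rewrite integral_push_probability; last 2 first.
    + by apply/measurable_EFinP; apply: measurable_indic; exact: measurableX.
    + by move=> z; rewrite lee_fin indicE.
    apply: eq_integral => s _; rewrite !indicE /=; congr ((nat_of_bool _)%:R%:E).
    by apply/idP/idP; rewrite !inE; [case|split].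
  rewrite (J1 (\1_A) m1); first by rewrite integral_indic// setIT.
  by move=> x; rewrite indicE.
- rewrite integral_push_probability; last 2 first.
  + apply/measurable_EFinP; apply: measurable_funX; apply: measurable_norm2.
    by apply: measurable_rVB; [exact: measurable_fst|exact: measurable_snd].
  + by move=> z; rewrite lee_fin sqr_ge0.
  have mdist : measurable_fun setT (fun t : (V * V) * V * V => norm2 (t.1.1.1 - t.1.1.2)).
    by apply: measurable_norm2; exact: measurable_rVB.
  pose D (t : (V * V) * V * V) : V :=
    (t.2 - t.1.1.2 - t.1.2 + (k%:R * (r ^+ 2 / 2)) *: g t.1.1.2)%R.
  have mD : measurable_fun setT (fun t => norm2 (D t)).
    apply: measurable_norm2; apply: measurable_rVD.
      by apply: measurable_rVB => //; exact: measurable_rVB.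
    by apply: measurable_rVZc; exact: (measurableT_comp mg).
  apply: (L2_mono (F := fun t => norm2 ((Y t).1 - (Y t).2))
    (G := fun t => ((1 - m * h) * norm2 (t.1.1.1 - t.1.1.2)%R + norm2 (D t))%R)).
  + apply: measurable_norm2; apply: measurable_rVB => //.
    by apply: measurable_rVD => //; exact: measurable_rVB.
  + by apply: measurable_funD => //; exact: measurable_funM.
  + move=> t; rewrite ger0_norm ?norm2_ge0//.
    (* The gradient step from [x0] is added and subtracted, using [k r^2 / 2 = h]. *)
    have -> : ((Y t).1 - (Y t).2 = (t.1.1.1 - h *: g t.1.1.1 - (t.1.1.2 - h *: g t.1.1.2)) - D t)%R.
      by rewrite /D kr /Y /=; apply/rowP => i; rewrite !mxE; ring.
    apply: (le_trans (ler_norm2D _ _)); rewrite norm2N lerD2r.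
    exact: (gradient_step_contracts m0 mM fconv glip).
  + apply: L2_triangle => //.
    * exact: measurable_funM.
    * by rewrite mulr_ge0.
    * by apply: (le_trans _ defect); exact: (defect_bound_ge0 m0 mM).
    * apply: L2_scale => //.
      rewrite (J2 (fun q => norm2 (q.1.1 - q.1.2) ^+ 2)%R).
      - apply: le_trans cost; rewrite le_eqVlt; apply/orP; left; apply/eqP.
        by apply: eq_integral => q _; exact: (integral_cst1 N (norm2 (q.1 - q.2) ^+ 2)%R).
      - apply: measurable_funX; apply: measurable_norm2.
        apply: measurable_rVB; first exact: (measurableT_comp measurable_fst measurable_fst).
        exact: (measurableT_comp measurable_snd measurable_fst).
      - by move=> q; exact: sqr_ge0.
    * apply: (le_trans J4); rewrite lee_fin ler_sqr ?nnegrE//.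
        exact: (defect_bound_ge0 m0 mM).
      by apply: (le_trans _ defect); exact: (defect_bound_ge0 m0 mM).
Qed.

(** The slack [e] is shared between the coupling cost and the refinement of the chain;
    [1 - m h <= 1] keeps the first half from growing. *)
Lemma W2_step (w : R) : W2 mu pi_ <= w%:E ->
  W2 nu pi_ <= ((1 - m * h) * w + step_error n M h)%:E.
Proof.
move=> hw.
have w0 : (0 <= w)%R by rewrite -lee_fin (le_trans (W2_ge0 mu pi_)).
have key (e : R) : (0 < e)%R -> W2 nu pi_ <= ((1 - m * h) * w + step_error n M h + e)%:E.
  move=> e0; pose w' := (w + e / 2)%R.
  have lt : W2 mu pi_ < w'%:E by apply: (le_lt_trans hw); rewrite lte_fin /w'; lra.
  have [rho cpl cost] := exists_near_optimal_coupling lt.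
  have w'0 : (0 <= w')%R by rewrite /w'; lra.
  have e2 : (0 < e / 2)%R by rewrite divr_gt0.
  apply: (le_trans (W2_step_coupled cpl w'0 e2 cost)).
  have mh : (0 <= m * h)%R by rewrite mulr_ge0// ltW.
  rewrite lee_fin /w'.
  have : (0 <= m * h * (e / 2))%R by rewrite mulr_ge0// ltW.
  by lra.
have fin : W2 nu pi_ \is a fin_num.
  by rewrite ge0_fin_numE ?W2_ge0// (le_lt_trans (key 1%R ltr01))// ltry.
rewrite -(fineK fin) lee_fin; apply/ler_addgt0Pr => e e0.
by rewrite -lee_fin (fineK fin); exact: key.
Qed.

End wasserstein_step.

(** * Laws along the algorithm *)

(** Rectangles form a generating pi-system; finite mass makes the constant sequence [setT] a valid
    exhaustion. *)
Lemma measure_eq_rectangles {R : realType} d1 d2 (T1 : measurableType d1) (T2 : measurableType d2)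
    (m1 m2 : {measure set (T1 * T2)%type -> \bar R}) :
  (m1 setT < +oo)%E ->
  (forall A B, measurable A -> measurable B -> m1 (A `*` B) = m2 (A `*` B)) ->
  forall C, measurable C -> m1 C = m2 C.
Proof.
move=> fin eqr C mC.
pose G : set (set (T1 * T2)) :=
  [set C | exists A, measurable A /\ exists B, measurable B /\ C = A `*` B].
apply: (measure_unique G (fun=> setT)) => //.
- rewrite measurable_prod_measurableType //; congr (<<s _ >>).
  rewrite predeqE; split => [[A mA [B mB <-]]|[A [mA [B [mB ->]]]]].
    by exists A; split => //; exists B.
  by exists A => //; exists B.
- move=> /= _ _ [X1 [mX1 [X2 [mX2 ->]]]] [Y1 [mY1 [Y2 [mY2 ->]]]].
  rewrite -setXI; exists (X1 `&` Y1); split; first exact: measurableI.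
  by exists (X2 `&` Y2); split => //; exact: measurableI.
- move=> _; exists setT; split => //; exists setT; split => //.
  by rewrite setXTT.
- by rewrite bigcup_const//; exists 0%N.
- by move=> A [A1 [mA1 [A2 [mA2 ->]]]]; exact: eqr.
Qed.

Section markov_recursion.
Context {R : realType} {n : nat} d (T : measurableType d).
Notation V := 'rV[R]_n.
Variables (P : probability T R) (theta xi : nat -> {RV P >-> V}).
Variable Phi : nat -> V * V -> V.
Hypothesis mPhi : forall k, measurable_fun setT (Phi k).
Hypothesis thetaS : forall k w, theta k.+1 w = Phi k (theta k w, xi k w).
Hypothesis xi_indep : mutually_independent xi.
Hypothesis theta0_indep : independent_of_sequence (theta 0%N) xi.
Local Open Scope ereal_scope.

Let mpre (X : {RV P >-> V}) A : measurable A -> measurable (X @^-1` A).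
Proof. by move=> mA; rewrite -[X in measurable X]setTI; exact: (measurable_funP X). Qed.

Let mcyl (J : seq nat) (A : nat -> set V) : (forall j, measurable (A j)) ->
  measurable (\bigcap_(j in [set` J]) (xi j @^-1` A j)).
Proof.
move=> mA; apply: fin_bigcap_measurable => // j _.
exact: mpre.
Qed.

Let cyl_sigma (J : seq nat) (A : nat -> set V) : (forall j, measurable (A j)) ->
  sigma_sequence xi (\bigcap_(j in [set` J]) (xi j @^-1` A j)).
Proof.
move=> mA; rewrite /sigma_sequence.
set G := \bigcup_j _.
change (@measurable _ (g_sigma_algebraType G) (\bigcap_(j in [set` J]) (xi j @^-1` A j))).
apply: fin_bigcap_measurable => // j _.
apply: sub_sigma_algebra; exists j => //.
by exists (A j); rewrite ?setTI.
Qed.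

(** The next state is a function of [(theta k, xi k)]. For an event [E] about later noises,
    [P (Z in C, E)] and [P E * P (Z in C)] agree on rectangles [C] by the induction hypothesis for
    [k :: J] and [[:: k]], hence on all [C]. This is why arbitrary finite [J] must be carried
    along. *)
Lemma state_independent_of_future k (J : seq nat) (A : set V) (B : nat -> set V) :
  uniq J -> all (leq k) J -> measurable A -> (forall j, measurable (B j)) ->
  P (theta k @^-1` A `&` \bigcap_(j in [set` J]) (xi j @^-1` B j)) =
  P (theta k @^-1` A) * P (\bigcap_(j in [set` J]) (xi j @^-1` B j)).
Proof.
elim: k J A B => [|k IH] J A B uJ kJ mA mB.
  by apply: theta0_indep => //; exact: cyl_sigma.
set E := \bigcap_(j in _) _.
have mE : measurable E by exact: mcyl.
pose Z (w : T) := (theta k w, xi k w).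
have mZ : measurable_fun setT Z by apply/measurable_fun_pair; exact: measurable_funP.
pose m1 : {measure set (V * V)%type -> \bar R} :=
  measure_function_pushforward__canonical__measure_function_Measure (mrestr P mE) mZ.
have PE0 : (0 <= fine (P E))%R by rewrite fine_ge0.
pose m2 : {measure set (V * V)%type -> \bar R} :=
  mscale (NngNum PE0)
    (measure_function_pushforward__canonical__measure_function_Measure P mZ).
have m1E C : m1 C = P (Z @^-1` C `&` E) by [].
have m2E C : m2 C = P E * P (Z @^-1` C).
  by rewrite /m2 /= /mscale /= /pushforward fineK ?fin_num_measure.
have eq12 : forall C, measurable C -> m1 C = m2 C.
  apply: measure_eq_rectangles.
    by rewrite /m1 /= /pushforward /mrestr /= setTI ltey_eq fin_num_measure.
  move=> A1 A2 mA1 mA2; rewrite m1E m2E.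
  have Zr : Z @^-1` (A1 `*` A2) = theta k @^-1` A1 `&` xi k @^-1` A2 by [].
  rewrite Zr.
  (* [xi k] is consumed in passing to [k.+1], and [J] starts at [k.+1]; so the entry at [k] is free
     to hold [A2] without disturbing [E]. *)
  pose B' j := if j == k then A2 else B j.
  have mB' j : measurable (B' j) by rewrite /B'; case: ifP.
  have kNJ : k \notin J.
    by apply/negP => kinJ; move/allP : kJ => /(_ _ kinJ); rewrite ltnn.
  have EB' : \bigcap_(j in [set` J]) (xi j @^-1` B' j) = E.
    apply: eq_bigcapr => j /= jJ; rewrite /B'; case: eqP => // jk.
    by rewrite -jk jJ in kNJ.
  have consE : \bigcap_(j in [set` k :: J]) (xi j @^-1` B' j) = xi k @^-1` A2 `&` E.
    rewrite -EB'; apply/seteqP; split => w /=.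
      move=> h; split; first by have := h k (mem_head _ _); rewrite /B' eqxx.
      by move=> j /= jJ; apply: h; rewrite /= inE jJ orbT.
    move=> [h1 h2] j /=; rewrite inE => /predU1P[->|jJ]; last exact: h2.
    by rewrite /B' eqxx.
  have kJ' : all (leq k) J by apply: sub_all kJ => j; exact: ltnW.
  rewrite -setIA -consE IH//=; last 2 first.
  - by rewrite kNJ.
  - by rewrite leqnn.
  have one : \bigcap_(j in [set` [:: k]]) (xi j @^-1` B' j) = xi k @^-1` A2.
    apply/seteqP; split => w /=.
      by move=> /(_ k); rewrite /= inE eqxx /B' eqxx; apply.
    by move=> h j /=; rewrite inE => /eqP ->; rewrite /B' eqxx.
  rewrite -[in RHS]one (IH [:: k])//=; last by rewrite leqnn.
  have -> : P (\bigcap_(j in [set` k :: J]) (xi j @^-1` B' j)) =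
      P (\bigcap_(j in [set` [:: k]]) (xi j @^-1` B' j)) * P E.
    rewrite -EB' (@xi_indep (k :: J)) ?(@xi_indep [:: k]) ?(@xi_indep J)//=; last by rewrite kNJ.
    by rewrite big_cons big_seq1.
  by rewrite muleA muleC.
have mA' : measurable (Phi k @^-1` A).
  by rewrite -[X in measurable X]setTI; exact: mPhi.
have thE : theta k.+1 @^-1` A = Z @^-1` (Phi k @^-1` A).
  by apply/seteqP; split => w /=; rewrite thetaS.
have := eq12 _ mA'; rewrite m1E m2E -thE => ->.
by rewrite muleC.
Qed.

(** Independence from the single noise [xi k] gives the joint law on rectangles; uniqueness of the
    product measure and Tonelli do the rest. *)
Lemma recursion_law k (F : V -> \bar R) : measurable_fun setT F -> (forall x, 0 <= F x) ->
  \int[distribution P (theta k.+1)]_x F x =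
  \int[distribution P (theta k)]_x \int[distribution P (xi k)]_z F (Phi k (x, z)).
Proof.
move=> mF F0.
pose Z (w : T) := (theta k w, xi k w).
have mZ : measurable_fun setT Z by apply/measurable_fun_pair; exact: measurable_funP.
have mFP : measurable_fun setT (fun q => F (Phi k q)) by exact: (measurableT_comp mF).
rewrite -(fubini_tonelli1 (fun q => F (Phi k q)))//=.
transitivity (\int[push_probability P mZ]_q F (Phi k q)).
  rewrite ge0_integral_distribution// integral_push_probability//.
  by apply: eq_integral => w _ /=; rewrite thetaS.
apply: eq_measure_integral => C mC _; apply/esym.
apply: product_measure_unique => // A1 A2 mA1 mA2.
have := @state_independent_of_future k [:: k] A1 (fun=> A2) isT.
rewrite /= leqnn.
have -> : \bigcap_(j in [set` [:: k]]) (xi j @^-1` A2) = xi k @^-1` A2.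
  apply/seteqP; split => w /=; first by move=> /(_ k); rewrite /= inE eqxx; apply.
  by move=> h j /=; rewrite inE => /eqP ->.
by apply.
Qed.

End markov_recursion.

(** * The recursion over step sizes *)

Section step_size_recursion.
Context {R : realType}.
Variables (m M s : R).
Hypotheses (m0 : 0 < m) (mM : m < M) (s0 : 0 <= s).

Let M0 : 0 < M. Proof. exact: lt_trans m0 mM. Qed.

Lemma step_gt0 (K k : nat) : 0 < step m M K k.
Proof.
rewrite /step divr_gt0// ltr_wpDr ?addr_gt0// mulr_ge0 ?le_max ?lexx ?orbT//.
by rewrite mulr_ge0 ?divr_ge0// ltW.
Qed.

Lemma step_le (K k : nat) : step m M K k * (m + M) <= 2.
Proof.
have D0 : 0 <= 2 / 3 * m * Num.max (k%:R - K%:R) 0.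
  rewrite mulr_ge0 ?le_max ?lexx ?orbT//.
  by rewrite mulr_ge0 ?divr_ge0// ltW.
rewrite /step mulrAC ler_pdivrMr; last by rewrite ltr_pwDl ?addr_gt0.
by rewrite ler_wpM2l// addrC lerDl.
Qed.

(** In units of [M sqrt n / A^(3/2)], the noise term at [h = 2 / A] is exactly [8/3] and the drift
    term at most 2, because [M <= A]; together [14/3]. *)
Lemma step_error_le (n : nat) (A : R) : m + M <= A ->
  step_error n M (2 / A) <= 14 / 3 * (M * Num.sqrt n%:R) / (A * Num.sqrt A).
Proof.
move=> mMA; have A0 : 0 < A by apply: lt_le_trans mMA; rewrite addr_gt0.
set a := Num.sqrt A; set t := Num.sqrt (2 : R).
have a0 : 0 < a by rewrite sqrtr_gt0.
have t0 : 0 < t by rewrite sqrtr_gt0.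
have aE : A = a ^+ 2 by rewrite sqr_sqrtr// ltW.
have tE : t ^+ 2 = 2 by rewrite sqr_sqrtr.
have e1 : Num.sqrt (2 * (2 / A)) = 2 / a.
  rewrite aE -[RHS]ger0_norm ?divr_ge0 ?(ltW a0)// -sqrtr_sqr; congr Num.sqrt.
  by field; rewrite gt_eqF.
have Ma : Num.sqrt M <= a by rewrite ler_sqrt ?(ltW A0)// (le_trans _ mMA)// lerDr ltW.
rewrite /step_error e1.
have MN : 0 <= M * Num.sqrt n%:R by rewrite mulr_ge0 ?sqrtr_ge0// ltW.
have -> : 14 / 3 * (M * Num.sqrt n%:R) / (A * a) =
    M * Num.sqrt n%:R * (a * ((2 / A) ^+ 2 / 2) + 2 / 3 * (2 / A * (2 / a))).
  by rewrite aE; field; rewrite gt_eqF.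
rewrite ler_wpM2l// lerD2r ler_wpM2r//.
by rewrite divr_ge0// sqr_ge0.
Qed.

Variable w : nat -> R.
Variable K : nat.
Let A (j : nat) : R := M + m + 2 / 3 * m * j%:R.
Let C : R := M * s / m.

Hypothesis w0 : forall k, 0 <= w k.
Hypothesis w_before : forall k, (k < K)%N ->
  w k.+1 <= (1 - m * (2 / A 0)) * w k + 14 / 3 * (M * s) / (A 0 * Num.sqrt (A 0)).
Hypothesis w_after : forall j,
  w (K + j).+1 <= (1 - m * (2 / A j)) * w (K + j) + 14 / 3 * (M * s) / (A j * Num.sqrt (A j)).
Hypothesis w_burn_in : ((M - m) / (M + m)) ^+ K * w 0 <= C / Num.sqrt (A 0).

Let A_gt0 j : 0 < A j.
Proof. by rewrite ltr_wpDr ?addr_gt0// mulr_ge0// mulr_ge0 ?divr_ge0// ltW. Qed.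

Let Am j : 2 * m < A j.
Proof.
have : 0 <= 2 / 3 * m * j%:R by rewrite mulr_ge0// mulr_ge0 ?divr_ge0// ltW.
by move: mM; rewrite /A; lra.
Qed.

Let C0 : 0 <= C. Proof. by rewrite divr_ge0 ?mulr_ge0// ltW. Qed.

Let errE j : 14 / 3 * (M * s) / (A j * Num.sqrt (A j)) =
  m * (2 / A j) * (7 / 3 * (C / Num.sqrt (A j))).
Proof.
by rewrite /C; field; rewrite !gt_eqF ?sqrtr_gt0.
Qed.

(** At constant step the excess over the fixed point shrinks by
    [1 - 2 m / (M + m) = (M - m) / (M + m)] each time. *)
Let before k : (k <= K)%N ->
  w k <= ((M - m) / (M + m)) ^+ k * w 0 + 7 / 3 * (C / Num.sqrt (A 0)).
Proof.
elim: k => [_|k IH kK].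
  by rewrite expr0 mul1r lerDl mulr_ge0// divr_ge0// sqrtr_ge0.
apply: (le_trans (w_before kK)); rewrite errE.
have -> : (M - m) / (M + m) = 1 - m * (2 / A 0).
  by rewrite /A mulr0 addr0; field; rewrite gt_eqF// addr_gt0.
have q0 : 0 <= 1 - m * (2 / A 0).
  rewrite subr_ge0 mulrA ler_pdivrMr// mul1r mulrC; exact: ltW.
have := ler_wpM2l q0 (IH (ltnW kK)).
have -> : (M - m) / (M + m) = 1 - m * (2 / A 0).
  by rewrite /A mulr0 addr0; field; rewrite gt_eqF// addr_gt0.
by rewrite exprS; lra.
Qed.

(** The burn-in ends at [1 + 7/3 = 10/3 <= 7/2]; afterwards the surplus of 7/2 over 7/3 pays for the
    decrease of the bound from [A j] to [A j.+1]. *)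
Lemma step_size_bound j : w (K + j) <= 7 / 2 * (C / Num.sqrt (A j)).
Proof.
elim: j => [|j IH].
  rewrite addn0; apply: (le_trans (before (leqnn K))).
  have : 0 <= C / Num.sqrt (A 0) by rewrite divr_ge0// sqrtr_ge0.
  by move: w_burn_in; lra.
rewrite addnS; apply: (le_trans (w_after j)); rewrite errE.
have q0 : 0 <= 1 - m * (2 / A j).
  rewrite subr_ge0 mulrA ler_pdivrMr// mul1r mulrC; exact: ltW.
apply: (le_trans (lerD (ler_wpM2l q0 IH) (lexx _))).
have AS : A j.+1 = A j + 2 / 3 * m by rewrite /A -natr1; ring.
set a := Num.sqrt (A j); set b := Num.sqrt (A j.+1).
have a0 : 0 < a by rewrite sqrtr_gt0.
have b0 : 0 < b by rewrite sqrtr_gt0.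
have aE : a ^+ 2 = A j by rewrite sqr_sqrtr// ltW.
have bE : b ^+ 2 = A j + 2 / 3 * m by rewrite sqr_sqrtr ?AS// -AS ltW.
(* With A (j + 1) = A j (1 + y), the bounds combine to 7/2 (1 - 3 y) + 7 y =
   7/2 (1 - y), and (1 - y) sqrt (1 + y) <= 1. *)
pose y := 2 / 3 * (m / A j).
have y0 : 0 <= y by rewrite mulr_ge0// divr_ge0// ltW.
have y1 : y <= 1.
  by rewrite /y mulrA ler_pdivrMr// mul1r; move: (Am j) m0; lra.
have key : (1 - y) * b <= a.
  rewrite -ler_sqr ?nnegrE ?(ltW a0)//; last by rewrite mulr_ge0 ?(ltW b0)//; lra.
  rewrite exprMn bE aE.
  have -> : A j + 2 / 3 * m = A j * (1 + y) by rewrite /y; field; rewrite gt_eqF.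
  rewrite mulrCA ler_piMr ?(ltW (A_gt0 j))//.
  by have := sqr_ge0 y; nra.
have -> : (1 - m * (2 / A j)) * (7 / 2 * (C / a)) + m * (2 / A j) * (7 / 3 * (C / a)) =
    7 / 2 * (C * ((1 - y) / a)).
  by rewrite /y; field; rewrite !gt_eqF.
rewrite ler_wpM2l// ler_wpM2l//.
by rewrite ler_pdivrMr// mulrC ler_pdivlMr.
Qed.

End step_size_recursion.

(** The threshold, exponentiated: [1 + 2 m / (M - m)] is the inverse of the contraction factor, so
    the threshold counts the contractions that bring [r] down to [M sqrt p / (m sqrt (M + m))]. *)
Lemma burn_in_bound {R : realType} (p K : nat) (m M r : R) :
  (1 <= p)%N -> 0 < m -> m < M -> 0 <= r ->
  (K1_threshold p m M r%:E <= K%:R%:E)%E ->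
  ((M - m) / (M + m)) ^+ K * r <= M * Num.sqrt p%:R / m / Num.sqrt (M + m).
Proof.
move=> p1 m0 mM r0 thr.
have M0 : 0 < M by exact: lt_trans mM.
have Mm : 0 < M - m by rewrite subr_gt0.
have MpM : 0 < M + m by rewrite addr_gt0.
have sp : 0 < Num.sqrt (p%:R : R) by rewrite sqrtr_gt0 ltr0n.
have sM : 0 < Num.sqrt (M + m) by rewrite sqrtr_gt0.
(* Here the threshold contains [ln 0 = -oo], and the claim is immediate. *)
have [r00|rn0] := eqVneq r 0.
  by rewrite r00 mulr0 !divr_ge0 ?mulr_ge0// ltW.
have rp : 0 < r by rewrite lt_def rn0.
move: thr; rewrite /K1_threshold !inver.
set L := ln (1 + 2 * m / (M - m)).
have L0 : 0 < L by rewrite ln_gt0// ltrDl !divr_gt0// mulr_gt0.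
rewrite !gt_eqF// -EFinM lne_EFin ?divr_gt0//.
rewrite -!EFinD -EFinM lee_fin ler_pdivrMr// => thr.
have : expR (ln (r / Num.sqrt p%:R) + ln (m / M) + 2^-1 * ln (M + m)) <= expR (K%:R * L).
  by rewrite ler_expR.
have q0 : 0 < (M - m) / (M + m) by rewrite divr_gt0.
have half : expR (2^-1 * ln (M + m)) = Num.sqrt (M + m).
  rewrite -[LHS]ger0_norm ?expR_ge0// -sqrtr_sqr -expRM_natl.
  by rewrite mulrA divff ?pnatr_eq0// mul1r lnK.
have qE : 1 + 2 * m / (M - m) = ((M - m) / (M + m))^-1.
  by field; rewrite !gt_eqF.
rewrite !expRD half !lnK ?posrE ?divr_gt0// expRM_natl /L qE lnK ?posrE ?invr_gt0//.
rewrite exprVn -[X in _ <= X]mul1r ler_pdivlMr ?exprn_gt0// => h.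
rewrite !ler_pdivlMr//.
have -> : ((M - m) / (M + m)) ^+ K * r * Num.sqrt (M + m) * m =
  (r / Num.sqrt p%:R * (m / M) * Num.sqrt (M + m) * ((M - m) / (M + m)) ^+ K) *
  (M * Num.sqrt p%:R).
  by move: (_ ^+ K) => Q; field; rewrite !gt_eqF.
by rewrite ler_piMl// mulr_ge0// ltW.
Qed.

Lemma grad_measurable {R : realType} {n : nat} (f : 'rV[R]_n -> R) :
  continuously_differentiable f ->
  measurable_fun setT f /\ measurable_fun setT (grad f).
Proof.
move=> [df cg]; split.
  by apply: continuous_measurable_rV => x; exact: differentiable_continuous.
apply/measurable_fun_rVP => i; apply: continuous_measurable_rV => x.
apply: (@continuous_comp _ _ _ (grad f) (fun y : 'rV[R]_n => y 0 i)).
  exact: cg.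
exact: coord_continuous.
Qed.

Theorem theorem2 (R : realType) (p : nat) (p_ge1 : (1 <= p)%N)
    (m M : R) (m_gt0 : 0 < m) (m_lt_M : m < M)
    (f : 'rV[R]_p -> R) (f_C1 : continuously_differentiable f)
    (f_strongly_convex : forall x y : 'rV[R]_p,
      f x - f y - dot (grad f y) (x - y) >= m / 2 * norm2 (x - y) ^+ 2)
    (grad_f_Lipschitz : forall x y : 'rV[R]_p,
      norm2 (grad f x - grad f y) <= M * norm2 (x - y))
    (target : probability 'rV[R]_p R)
    (target_density :
      has_density_proportional_to target (fun x => expR (- f x)))
    (d : measure_display) (T : measurableType d) (P : probability T R)
    (theta0 : {RV P >-> 'rV[R]_p})
    (xi : nat -> {RV P >-> 'rV[R]_p}) (* xi k is the noise of step k + 1 *)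
    (xi_law : forall (k : nat) (A : set 'rV[R]_p), measurable A ->
      distribution P (xi k) A = std_normal A)
    (xi_indep : mutually_independent xi)
    (theta0_xi_indep : independent_of_sequence theta0 xi)
    (W2_fin : (W2 (distribution P theta0) target < +oo)%E)
    (K1 : nat)
    (K1_def : is_smallest_nat_above
      (K1_threshold p m M (W2 (distribution P theta0) target)) K1)
    (theta : nat -> {RV P >-> 'rV[R]_p})
    (theta_init : forall w : T, theta 0%N w = theta0 w)
    (theta_rec : forall (k : nat) (w : T),
      theta k.+1 w = theta k w - step m M K1 k *: grad f (theta k w)
        + Num.sqrt (2 * step m M K1 k) *: xi k w)
    (k : nat) (K1_le_k : (K1 <= k)%N) :
  (W2 (distribution P (theta k)) target <=
    ((35 / 10 * M * Num.sqrt p%:R) /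
     (m * Num.sqrt (M + m + 2 / 3 * m * (k%:R - K1%:R))))%:E)%E.
Proof.
have [mf mg] := grad_measurable f_C1.
have [c piE] := target_density.
(* The noises share one law, so a single [N] serves for every step. *)
pose N : probability 'rV[R]_p R := distribution P (xi 0%N).
have NE A : measurable A -> N A = std_normal A by exact: xi_law.
pose h j := step m M K1 j.
pose Phi j (q : 'rV[R]_p * 'rV[R]_p) : 'rV[R]_p :=
  q.1 - h j *: grad f q.1 + Num.sqrt (2 * h j) *: q.2.
have mPhi j : measurable_fun setT (Phi j).
  apply: measurable_rVD; last by apply: measurable_rVZc; exact: measurable_snd.
  apply: measurable_rVB; first exact: measurable_fst.
  by apply: measurable_rVZc; exact: (measurableT_comp mg measurable_fst).
have theta00 : theta 0%N = theta0 by apply/mfuneqP => w; exact: theta_init.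
have theta0_indep : independent_of_sequence (theta 0%N) xi by rewrite theta00.
have W2_next j (w : R) : (W2 (distribution P (theta j)) target <= w%:E)%E ->
    (W2 (distribution P (theta j.+1)) target <=
      ((1 - m * h j) * w + step_error p M (h j))%:E)%E.
  apply: (W2_step m_gt0 m_lt_M f_strongly_convex grad_f_Lipschitz mf mg piE NE).
  - exact: step_gt0.
  - exact: step_le.
  - move=> F mF F0.
    rewrite (recursion_law mPhi theta_rec xi_indep theta0_indep); last 2 first.
    + exact/measurable_EFinP.
    + by move=> x; rewrite lee_fin.
    apply: eq_integral => x _; apply: eq_measure_integral => A mA _.
    exact: (etrans (xi_law j A mA) (esym (NE A mA))).
pose w j := fine (W2 (distribution P (theta j)) target).
have wE j : (W2 (distribution P (theta j)) target = (w j)%:E)%E.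
  (* Finiteness of the distance holds at time 0 by [W2_fin] and is preserved by each step. *)
  rewrite /w fineK//; elim: j => [|j IH].
    by rewrite theta00 ge0_fin_numE// W2_ge0.
  rewrite ge0_fin_numE ?W2_ge0//.
  by apply: le_lt_trans (W2_next j (fine _) _) (ltry _); rewrite fineK.
have w_ge0 j : 0 <= w j by rewrite fine_ge0// W2_ge0.
have p_gt0 : (0 : R) < Num.sqrt p%:R by rewrite sqrtr_gt0 ltr0n.
pose A j := M + m + 2 / 3 * m * j%:R.
(* [l = 0] covers all [j <= K1], where the positive part in the step size is 0; the two cases agree
   at [j = K1]. *)
have w_step j l : j = (K1 + l)%N \/ (j <= K1)%N /\ l = 0%N ->
    w j.+1 <= (1 - m * (2 / A l)) * w j
      + 14 / 3 * (M * Num.sqrt p%:R) / (A l * Num.sqrt (A l)).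
  move=> jl.
  have hE : h j = 2 / A l.
    rewrite /h /step /A; congr (2 / (M + m + 2 / 3 * m * _)).
    case: jl => [->|[jK ->]].
      by rewrite natrD addrAC subrr add0r max_l.
    by rewrite max_r// subr_le0 ler_nat.
  have := @W2_next j (w j); rewrite !wE lexx lee_fin hE => /(_ isT) /le_trans; apply.
  rewrite lerD2l; apply: (step_error_le m_gt0 m_lt_M).
  have : 0 <= 2 / 3 * m * l%:R by rewrite mulr_ge0// mulr_ge0 ?divr_ge0// ltW.
  by rewrite /A; lra.
have burn : ((M - m) / (M + m)) ^+ K1 * w 0%N <=
    M * Num.sqrt p%:R / m / Num.sqrt (A 0%N).
  rewrite /A mulr0 addr0; apply: burn_in_bound => //.
  by rewrite -wE theta00; case: K1_def.
have := @step_size_bound R m M (Num.sqrt p%:R) m_gt0 m_lt_M (sqrtr_ge0 _) w K1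
  (fun j jK => w_step j 0%N (or_intror (conj (ltnW jK) erefl)))
  (fun l => w_step _ l (or_introl erefl)) burn (k - K1)%N.
rewrite subnKC// wE lee_fin => /le_trans; apply.
rewrite natrB// le_eqVlt; apply/orP; left; apply/eqP.
have sA : 0 < Num.sqrt (M + m + 2 / 3 * m * (k%:R - K1%:R)).
  rewrite sqrtr_gt0 ltr_wpDr ?(addr_gt0 (lt_trans m_gt0 m_lt_M))//.
  by rewrite mulr_ge0 ?subr_ge0 ?ler_nat// mulr_ge0 ?divr_ge0// ltW.
by field; rewrite !gt_eqF.
Qed.
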